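(* Let $(E,\mathcal{E})$ be a measurable space. Suppose that $Q\in\mathcal{T}(E,\mathcal{E})$ is quasi-compact on $\mathcal{B}$, and let the real number $\rho$ be such that $r_e(Q)<\rho<r(Q)$. Then: (i) there exist bounded kernels $L$ and $N$ such that $Q=L+N$, $LN=NL=0$, $r(N)<\rho$, $L$ has finite-dimensional range and the non-zero eigenvalues of $L$ have modulus $\ge\rho$. Moreover, there exists an integer $\ell_\rho$ such that, for any $\ell\ge\ell_\rho$, there exists a probability measure $\nu$ on $(E,\mathcal{E})$ such that: (ii) $\Delta_\nu(Q^\ell)\le\rho^\ell$; (iii) if moreover $\mathcal{E}$ is countably generated, then there exists $\alpha\in\mathcal{H}_\nu$ such that $S=Q^\ell-T_{\nu,\alpha}\ge0$ and $\|S\|^{1/\ell}<\rho$.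
   Context: A bounded positive kernel on $(E,\mathcal{E})$ is a function $Q:E\times\mathcal{E}\to\mathbb{R}_+$ such that $Q(\cdot,A)$ is $\mathcal{E}$-measurable for every $A\in\mathcal{E}$, $Q(x,\cdot)$ is a positive measure for every $x\in E$, and $\sup_{x}Q(x,E)<+\infty$; $\mathcal{T}(E,\mathcal{E})$ is the set of these. A bounded kernel is a function $K:E\times\mathcal{E}\to\mathbb{C}$ such that $K(\cdot,A)$ is measurable for every $A\in\mathcal{E}$, $K(x,\cdot)$ is a bounded complex measure for every $x\in E$, and $\sup_{(x,A)\in E\times\mathcal{E}}|K(x,A)|<+\infty$. $\mathcal{B}$ is the Banach space of bounded measurable complex functions on $E$ with the supremum norm. Kernels are identified with the bounded operators $Kf(x)=\int_E f(y)\,K(x,dy)$ on $\mathcal{B}$; $\|\cdot\|$ also denotes the operator norm on $\mathcal{B}$, and products and powers are those of operators. $K_1-K_2\ge0$ means $K_1(x,A)\ge K_2(x,A)$ for all $(x,A)\in E\times\mathcal{E}$. For a probability measure $\nu$ on $(E,\mathcal{E})$: $\Delta_\nu(Q)=\limsup_{A\in\mathcal{E},\,\nu(A)\to0}\big(\sup_{x\in E}Q(x,A)\big)$, i.e. $\lim_{\eta\to0^+}\sup\{Q(x,A):x\in E,\ A\in\mathcal{E},\ \nu(A)\le\eta\}$; $\mathcal{H}_\nu$ is the set of nonnegative $\mathcal{E}\otimes\mathcal{E}$-measurable functions $\alpha$ on $E\times E$ such that $\lim_{m\to+\infty}\sup_{x\in E}\int_{\{y:\alpha(x,y)\ge m\}}\alpha(x,y)\,d\nu(y)=0$;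 and $T_{\nu,\alpha}(x,A)=\int_A\alpha(x,y)\,d\nu(y)$. $r(\cdot)$ is the spectral radius of a bounded operator on $\mathcal{B}$. The essential spectral radius $r_e(T)$ of a bounded operator $T$ on a Banach space $\mathcal{B}$ is the infimum of $r(T)$ and of the real numbers $\rho\ge0$ such that $\mathcal{B}=F_\rho\oplus H_\rho$ where $F_\rho,H_\rho$ are $T$-invariant subspaces, $H_\rho$ is closed, $r(T_{|H_\rho})<\rho$, $\dim F_\rho<+\infty$ and all eigenvalues of $T_{|F_\rho}$ have modulus $\ge\rho$. $T$ is quasi-compact if $r_e(T)<r(T)$. *)

(* Defs.v *)
From HB Require Import structures.
From mathcomp Require Import all_boot all_order all_algebra.
From mathcomp Require Import complex ring lra.
From mathcomp Require Import all_classical all_reals all_analysis measurable_realfun.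

Set Implicit Arguments.
Unset Strict Implicit.
Unset Printing Implicit Defensive.

Import Order.TTheory GRing.Theory Num.Theory.
Import numFieldNormedType.Exports.

Local Open Scope classical_set_scope.
Local Open Scope ring_scope.

Notation normc := (@ComplexField.Normc.normc _).

Section complex_facts.
Context (R : realType).
Implicit Types (z w : R[i]).

Lemma normc_normr z : `|z| = (normc z)%:C%C.
Proof. by []. Qed.

Lemma normc_ge0 z : 0 <= normc z.
Proof. by case: z => a b /=; exact: sqrtr_ge0. Qed.

Lemma normc_le_ReIm z : normc z <= `|complex.Re z| + `|complex.Im z|.
Proof.
case: z => a b /=; rewrite -[leRHS]ger0_norm ?addr_ge0// -sqrtr_sqr.
rewrite ler_sqrt ?sqr_ge0// sqrrD !real_normK ?num_real//.
by rewrite [leRHS]addrAC lerDl mulrn_wge0// mulr_ge0.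
Qed.

Lemma Re_le_normc z : `|complex.Re z| <= normc z.
Proof.
case: z => a b /=; rewrite -sqrtr_sqr ler_sqrt ?addr_ge0 ?sqr_ge0//.
by rewrite lerDl sqr_ge0.
Qed.

Lemma Im_le_normc z : `|complex.Im z| <= normc z.
Proof.
case: z => a b /=; rewrite -sqrtr_sqr ler_sqrt ?addr_ge0 ?sqr_ge0//.
by rewrite lerDr sqr_ge0.
Qed.

End complex_facts.

Section bounded_measurable_functions.
Context (d : measure_display) (E : measurableType d) (R : realType).

(* The Borel sigma-algebra of R[i] is that of R * R, so that a complex function
   is measurable iff its real and imaginary parts are. *)
Definition bmfun_set : set (E -> R[i]) :=
  [set f : E -> R[i] | [/\ measurable_fun setT (fun x => complex.Re (f x)),
               measurable_fun setT (fun x => complex.Im (f x)) &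
               exists M : R, forall x, normc (f x) <= M]].

Definition bmfun_pred : {pred E -> R[i]} := mem bmfun_set.

Record bmfun := BMFun {
  bmfun_val :> E -> R[i] ;
  bmfun_valP : bmfun_val \in bmfun_pred
}.

HB.instance Definition _ := [isSub for bmfun_val].
HB.instance Definition _ := [Choice of bmfun by <:].

Lemma bmfunP (f : bmfun) : bmfun_set f.
Proof. exact: set_mem (bmfun_valP f). Qed.

Lemma bmfun_submod_closed : submod_closed bmfun_pred.
Proof.
split=> [|c f g /set_mem[rf jf [Mf hf]] /set_mem[rg jg [Mg hg]]]; apply: mem_set.
  split; [exact: measurable_cst|exact: measurable_cst|].
  by exists 0 => x; rewrite ComplexField.Normc.normc0.
case: c => a b; split.
- rewrite (_ : (fun x => _) = (((fun x => a * complex.Re (f x)) \-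
    (fun x => b * complex.Im (f x))) \+ (fun x => complex.Re (g x)))); last first.
    by apply/funext => x; rewrite !fctE/=; case: (f x) (g x) => ? ? [].
  by apply: measurable_funD => //; apply: measurable_funB; exact: measurable_funM.
- rewrite (_ : (fun x => _) = (((fun x => a * complex.Im (f x)) \+
    (fun x => b * complex.Re (f x))) \+ (fun x => complex.Im (g x)))); last first.
    by apply/funext => x; rewrite !fctE/=; case: (f x) (g x) => ? ? [].
  by apply: measurable_funD => //; apply: measurable_funD; exact: measurable_funM.
- exists (normc (a +i* b)%C * Mf + Mg) => x.
  apply: (le_trans (le_normcD _ _)).
  rewrite [X in X + _]ComplexField.Normc.normcM lerD//.
  by rewrite ler_wpM2l// normc_ge0.
Qed.

HB.instance Definition _ :=
  GRing.isSubmodClosed.Build _ _ bmfun_pred bmfun_submod_closed.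
HB.instance Definition _ :=
  [SubChoice_isSubLmodule of bmfun by <:].

Lemma bmfunE (f g : bmfun) : (forall x, f x = g x) -> f = g.
Proof. by move=> fg; apply/val_inj/funext. Qed.

Definition supnorm (f : bmfun) : R := sup [set normc (f x) | x in setT].

Lemma normc_le_supnorm (f : bmfun) x : normc (f x) <= supnorm f.
Proof.
apply: ub_le_sup; last by exists x.
by have [_ _ [M fM]] := bmfunP f; exists M => _ [y _ <-].
Qed.

Lemma supnorm_le (f : bmfun) (M : R) :
  (forall x, normc (f x) <= M) -> supnorm f <= M.
Proof.
move=> fM; apply: ge_sup; first by exists (normc (f point)); exists point.
by move=> _ [x _ <-].
Qed.

Let norm (f : bmfun) : R[i] := (supnorm f)%:C%C.

Let ler_normD (f g : bmfun) : norm (f + g) <= norm f + norm g.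
Proof.
rewrite /norm -rmorphD lecR; apply: supnorm_le => x.
by rewrite (le_trans (le_normcD _ _))// lerD// normc_le_supnorm.
Qed.

Let normrZ (c : R[i]) (f : bmfun) : norm (c *: f) = `|c| * norm f.
Proof.
rewrite /norm normc_normr -rmorphM; congr (_%:C%C); apply/eqP.
rewrite eq_le; apply/andP; split.
  apply: supnorm_le => x; rewrite [leLHS]ComplexField.Normc.normcM.
  by rewrite ler_wpM2l ?normc_ge0// normc_le_supnorm.
have [->|c0] := eqVneq c 0.
  rewrite ComplexField.Normc.normc0 mul0r.
  exact: le_trans (normc_ge0 _) (normc_le_supnorm _ point).
have nc0 : 0 < normc c.
  rewrite lt_neqAle normc_ge0 andbT eq_sym.
  by apply: contra c0 => /eqP/ComplexField.Normc.eq0_normc->.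
rewrite -ler_pdivlMl//; apply: supnorm_le => x; rewrite ler_pdivlMl//.
rewrite -ComplexField.Normc.normcM.
exact: (normc_le_supnorm (c *: f) x).
Qed.

Let normr0_eq0 (f : bmfun) : norm f = 0 -> f = 0.
Proof.
move=> /complexI f0; apply: bmfunE => x.
apply/ComplexField.Normc.eq0_normc/eqP; rewrite eq_le normc_ge0 andbT.
by rewrite -f0 normc_le_supnorm.
Qed.

HB.instance Definition _ :=
  @Lmodule_isNormed.Build R[i] bmfun norm ler_normD normrZ normr0_eq0.

Lemma bmfun_normE (f : bmfun) : `|f| = (supnorm f)%:C%C.
Proof. by []. Qed.

Lemma bmfun_complete (F : set_system (bmfun)) :
  ProperFilter F -> cauchy F -> cvg F.
Proof.
move=> FF Fc.
pose U (g : E -> R[i]) (e : R) := [set f : bmfun | forall x, normc (f x - g x) <= e].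
have distC (z w : R[i]) : normc (z - w) = normc (w - z).
  by rewrite -opprB normcN.
have tri (z w t : R[i]) : normc (z - w) <= normc (z - t) + normc (t - w).
  by rewrite (le_trans _ (le_normcD _ _))// addrA subrK.
have FU (e : R) : 0 < e -> exists f0 : bmfun, F (U f0 e).
  move=> e0; have e0' : 0 < e%:C%C by rewrite -[0]/((0 : R)%:C%C) ltcR.
  have [f0 Ff0] := (cauchyP F).1 Fc _ e0'.
  exists f0; apply: filterS Ff0 => f; rewrite -ball_normE/= bmfun_normE ltcR => fe x.
  rewrite distC; exact: le_trans (normc_le_supnorm (f0 - f) x) (ltW fe).
have ex_lim x : exists z : R[i], forall e, 0 < e -> F [set f | normc (f x - z) <= e].
  have cv (p : R[i] -> R) : (forall z w, p (z - w) = p z - p w) ->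
      (forall z, `|p z| <= normc z) ->
      cvg ((fun f : bmfun => p (f x)) @ F).
    move=> pB pn; apply: R_complete; apply/cauchyP => e e0.
    have e20 : 0 < e / 2 by rewrite divr_gt0.
    have [f0 Ff0] := FU _ e20; exists (p (f0 x)).
    change (F [set f | `|p (f0 x) - p (f x)| < e]).
    apply: filterS Ff0 => f /(_ x) fe; rewrite /= -pB.
    rewrite (le_lt_trans (pn _))// distC (le_lt_trans fe)//.
    by rewrite ltr_pdivrMr// mulr2n mulrDr mulr1 ltrDl.
  have [||a ca] := (cvg_ex _).1 (cv (@complex.Re R) _ _).
  - by move=> [? ?] [? ?].
  - exact: Re_le_normc.
  have [||b cb] := (cvg_ex _).1 (cv (@complex.Im R) _ _).
  - by move=> [? ?] [? ?].
  - exact: Im_le_normc.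
  exists (a +i* b)%C => e e0.
  have e20 : 0 < e / 2 by rewrite divr_gt0.
  have Fa : F [set f | `|a - complex.Re (f x)| <= e / 2].
    by have /cvgrPdist_le/(_ _ e20) := ca.
  have Fb : F [set f | `|b - complex.Im (f x)| <= e / 2].
    by have /cvgrPdist_le/(_ _ e20) := cb.
  apply: filterS (filterI Fa Fb) => f [/= fa fb]; rewrite (le_trans (normc_le_ReIm _))//.
  rewrite [leRHS]splitr lerD//.
    rewrite (_ : complex.Re _ = complex.Re (f x) - a); last by case: (f x).
    by rewrite distrC.
  rewrite (_ : complex.Im _ = complex.Im (f x) - b); last by case: (f x).
  by rewrite distrC.
have [g gP] := choice ex_lim.
have Ug (f0 : bmfun) e : 0 < e -> F (U f0 e) ->
    forall x, normc (f0 x - g x) <= e + e.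
  move=> e0 Ff0 x; have [f [/= f1 f2]] := filter_ex (filterI Ff0 (gP x e e0)).
  by rewrite (le_trans (tri _ _ (f x)))// lerD// distC.
have approx n : exists f0 : bmfun, forall x, normc (f0 x - g x) <= n.+1%:R^-1.
  have e0 : 0 < (n.+1%:R^-1 / 2 : R) by rewrite divr_gt0.
  have [f0 Ff0] := FU _ e0; exists f0 => x.
  by rewrite [leRHS]splitr; exact: Ug.
have [f_ f_g] := choice approx.
have cvp (p : R[i] -> R) : (forall z w, p (z - w) = p z - p w) ->
    (forall z, `|p z| <= normc z) ->
    forall x, (fun n => p (f_ n x)) @ \oo --> p (g x).
  move=> pB pn x; apply/cvgrPdist_le => e e0; near=> n.
  rewrite distrC -pB (le_trans (pn _))// (le_trans (f_g n x))//.
  by apply/ltW; near: n; exact: (near_infty_natSinv_lt (PosNum e0)).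
have mg : bmfun_set g.
  split.
  - apply: (@measurable_fun_cvg _ _ _ setT (fun n x => complex.Re (f_ n x))) => //.
      by move=> n; have [] := bmfunP (f_ n).
    by move=> x _; apply: cvp => [[? ?] [? ?]|z]//; exact: Re_le_normc.
  - apply: (@measurable_fun_cvg _ _ _ setT (fun n x => complex.Im (f_ n x))) => //.
      by move=> n; have [] := bmfunP (f_ n).
    by move=> x _; apply: cvp => [[? ?] [? ?]|z]//; exact: Im_le_normc.
  - have [_ _ [M fM]] := bmfunP (f_ 0%N); exists (1 + M) => x.
    rewrite -[g x](subrK (f_ 0%N x)) (le_trans (le_normcD _ _))// lerD//.
    by rewrite distC (le_trans (f_g _ _))// invr1.
apply/cvg_ex; exists (BMFun (mem_set mg)).
apply/cvgrPdist_le => e e0.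
have [r r0 ->] : exists2 r : R, 0 < r & e = r%:C%C.
  case: e e0 => a b; rewrite ltcE/= => /andP[/eqP-> a0].
  by exists a.
have r30 : 0 < r / 3 by rewrite divr_gt0.
have [f0 Ff0] := FU _ r30; have Ugf := Ug _ _ r30 Ff0.
apply: filterS Ff0 => f fe; rewrite bmfun_normE lecR; apply: supnorm_le => x.
rewrite (le_trans (tri _ _ (f0 x)))//.
rewrite (_ : r = (r / 3 + r / 3) + r / 3); last by field.
rewrite lerD//; first by rewrite distC; exact: Ugf.
by rewrite distC; exact: fe.
Unshelve. all: by end_near. Qed.

HB.instance Definition _ := Uniform_isComplete.Build (bmfun) bmfun_complete.

End bounded_measurable_functions.
Arguments bmfun {d} E R.
Arguments bmfun_pred {d E R}.

Section bounded_measurable_induction.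
Import HBNNSimple.
Context (d : measure_display) (E : measurableType d) (R : realType).

Definition bounded_measurable (f : E -> R) :=
  measurable_fun setT f /\ exists M : R, forall x, `|f x| <= M.

Lemma bounded_measurableZ a f :
  bounded_measurable f -> bounded_measurable (fun x => a * f x).
Proof.
move=> [mf [M fM]]; split; first exact: measurable_funM.
by exists (`|a| * M) => x; rewrite normrM ler_wpM2l.
Qed.

Lemma bounded_measurableD f g : bounded_measurable f -> bounded_measurable g ->
  bounded_measurable (fun x => f x + g x).
Proof.
move=> [mf [M fM]] [mg [N gN]]; split; first exact: measurable_funD.
by exists (M + N) => x; rewrite (le_trans (ler_normD _ _))// lerD.
Qed.

Lemma bounded_measurable_indic A :
  measurable A -> bounded_measurable (\1_A : E -> R).
Proof.
move=> mA; split; first exact: measurable_indic.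
by exists 1 => x; rewrite ger0_norm// indicE; case: (_ \in _).
Qed.

Lemma bounded_measurable_ind (P : (E -> R) -> Prop) :
  (forall A, measurable A -> P \1_A) ->
  (forall a f g, bounded_measurable f -> bounded_measurable g ->
    P f -> P g -> P (fun x => a * f x + g x)) ->
  (forall (f_ : (E -> R)^nat) f M, (forall n, bounded_measurable (f_ n)) ->
    bounded_measurable f ->
    (forall n x, `|f_ n x| <= M) -> (forall x, f_ n x @[n --> \oo] --> f x) ->
    (forall n, P (f_ n)) -> P f) ->
  forall f, bounded_measurable f -> P f.
Proof.
move=> P1 PD Plim f [mf [M fM]].
have bm1 A : measurable A -> bounded_measurable (\1_A : E -> R).
  exact: bounded_measurable_indic.
have bmD a g h : bounded_measurable g -> bounded_measurable h ->
    bounded_measurable (fun x => a * g x + h x).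
  by move=> bg; apply: bounded_measurableD; exact: bounded_measurableZ.
have P0 : P (fun=> 0) /\ bounded_measurable (fun=> 0 : R).
  rewrite (_ : (fun=> 0) = (\1_(set0 : set E) : E -> R)).
    by split; [exact: P1|exact: bm1].
  by apply/funext => x; rewrite indic0.
have Psum (s : seq R) (A : R -> set E) : (forall r, measurable (A r)) ->
    P (fun x => \sum_(r <- s) r * \1_(A r) x) /\
    bounded_measurable (fun x => \sum_(r <- s) r * \1_(A r) x).
  move=> mA; elim: s => [|r s [Ps bs]].
    by under [X in P X]eq_fun do rewrite big_nil;
       under [X in bounded_measurable X]eq_fun do rewrite big_nil.
  under [X in P X]eq_fun do rewrite big_cons.
  under [X in bounded_measurable X]eq_fun do rewrite big_cons.
  split; last by apply: bmD => //; exact: bm1.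
  by apply: PD => //; [exact: bm1|exact: P1].
have Pnn (g : {nnsfun E >-> R}) : P g /\ bounded_measurable g.
  rewrite (_ : (g : E -> R) = (fun x => \sum_(r <- finmap.enum_fset
    (fset_set (range g))) r * \1_(g @^-1` [set r]) x)).
    by apply: Psum => r; exact: measurable_sfunP.
  by apply/funext => x; rewrite fimfunE fsbig_finite.
have M0 : 0 <= M by exact: le_trans (normr_ge0 _) (fM point).
pose h x := M * \1_(setT : set E) x + f x.
have bh : bounded_measurable h by apply: bmD; [exact: bm1|split; last exists M].
have h0 x : 0 <= h x.
  by rewrite /h indicT mulr1 -lerBlDl sub0r; move: (fM x); rewrite ler_norml => /andP[].
have mh : measurable_fun setT (EFin \o h) by apply/measurable_EFinP; case: bh.
have h0' x : setT x -> (0 <= (EFin \o h) x)%E by rewrite lee_fin h0.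
pose g_ := nnsfun_approx measurableT mh.
have gh n x : g_ n x <= h x.
  by rewrite -lee_fin nnsfun_approxE; exact: le_approx.
have Ph : P h.
  apply: (Plim (fun n => g_ n) h (M + M)) => //.
  - by move=> n; case: (Pnn (g_ n)).
  - move=> n x; rewrite ger0_norm// (le_trans (gh n x))// /h indicT mulr1 lerD2l.
    exact: le_trans (ler_norm _) (fM x).
  - move=> x.
    have := @cvg_nnsfun_approx _ _ _ _ measurableT _ mh h0' x Logic.I.
    by move=> /fine_cvgP[_].
  - by move=> n; case: (Pnn (g_ n)).
rewrite (_ : f = (fun x => (- M) * \1_(setT : set E) x + h x)).
  by apply: PD => //; [exact: bm1|exact: P1].
by apply/funext => x; rewrite /h addrA -mulrDl addNr mul0r add0r.
Qed.

End bounded_measurable_induction.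

Section charge_integral.
Context (d : measure_display) (E : measurableType d) (R : realType).
Implicit Types (nu : {charge set E -> \bar R}).

Definition hahn_pos nu : set E := projT1 (cid (Hahn_decomposition nu)).

Definition hahn_neg nu : set E :=
  projT1 (cid (projT2 (cid (Hahn_decomposition nu)))).

Lemma hahnP nu : hahn_decomposition nu (hahn_pos nu) (hahn_neg nu).
Proof. exact: projT2 (cid (projT2 (cid (Hahn_decomposition nu)))). Qed.

(* The values of the Jordan parts on measurable sets, hence the integral, do not
   depend on the chosen Hahn decomposition. *)
Definition charge_integral nu (f : E -> R) : R :=
  \int[jordan_pos (hahnP nu)]_y f y - \int[jordan_neg (hahnP nu)]_y f y.

Let bm := @bounded_measurable d E R.

Lemma bounded_measurable_integrable (m : {finite_measure set E -> \bar R}) f :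
  bm f -> m.-integrable setT (EFin \o f).
Proof.
move=> [mf [M fM]]; apply: measurable_bounded_integrable => //.
  by rewrite ltey_eq fin_num_measure.
exists M; split; first exact: num_real.
by move=> x xM y _ /=; rewrite (le_trans (fM y))// ltW.
Qed.

Lemma Rintegral_bounded_cvg (m : {finite_measure set E -> \bar R})
    (f_ : (E -> R)^nat) f M :
  (forall n, bm (f_ n)) -> bm f -> (forall n x, `|f_ n x| <= M) ->
  (forall x, f_ n x @[n --> \oo] --> f x) ->
  (\int[m]_y f_ n y) @[n --> \oo] --> \int[m]_y f y.
Proof.
move=> bf_ bf fM f_f; apply: fine_cvg; rewrite fineK; last first.
  by apply: integrable_fin_num => //; exact: bounded_measurable_integrable.
apply: (@dominated_cvg _ _ _ m setT measurableT (fun n x => (f_ n x)%:E)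
  (EFin \o f) (cst M%:E)) => //.
- by move=> n; apply/measurable_EFinP; case: (bf_ n).
- by move=> x _; apply: cvg_EFin => //; [exact: nearW|exact: f_f].
- apply: (@bounded_measurable_integrable m (cst M)); split=> //.
  by exists `|M|.
- by move=> n x _; rewrite /= lee_fin.
Qed.

Lemma charge_integral_cvg nu (f_ : (E -> R)^nat) f M :
  (forall n, bm (f_ n)) -> bm f -> (forall n x, `|f_ n x| <= M) ->
  (forall x, f_ n x @[n --> \oo] --> f x) ->
  charge_integral nu (f_ n) @[n --> \oo] --> charge_integral nu f.
Proof. by move=> *; apply: cvgB; exact: Rintegral_bounded_cvg. Qed.

Lemma charge_integral_indic nu A : measurable A ->
  charge_integral nu \1_A = fine (nu A).
Proof.
move=> mA; rewrite /charge_integral /Rintegral !integral_indic// !setIT.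
rewrite (jordan_decomp (hahnP nu) mA) /cadd /= cscaleN1 fineD ?fineN//.
  by rewrite fin_num_measure.
by rewrite fin_numN fin_num_measure.
Qed.

Lemma charge_integral_lin nu a f g : bm f -> bm g ->
  charge_integral nu (fun x => a * f x + g x) =
  a * charge_integral nu f + charge_integral nu g.
Proof.
move=> bf bg.
have lin (m : {finite_measure set E -> \bar R}) :
    \int[m]_y (a * f y + g y) = a * \int[m]_y f y + \int[m]_y g y.
  rewrite RintegralD//; first by rewrite RintegralZl//; exact: bounded_measurable_integrable.
    exact/bounded_measurable_integrable/bounded_measurableZ.
  exact: bounded_measurable_integrable.
by rewrite /charge_integral !lin; ring.
Qed.

Lemma charge_integral_bound nu C f M : bm f -> (forall x, `|f x| <= M) ->
  (forall A, measurable A -> `|fine (nu A)| <= C) ->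
  `|charge_integral nu f| <= (C + C) * M.
Proof.
move=> bf fM nuC.
have M0 : 0 <= M by exact: le_trans (normr_ge0 _) (fM point).
have [[mP _] [mN _] _ _] := hahnP nu.
have bound (m : {finite_measure set E -> \bar R}) :
    fine (m setT) <= C -> `|\int[m]_y f y| <= C * M.
  move=> mC; apply: (@le_trans _ _ (\int[m]_y M)); last first.
    by rewrite Rintegral_cst// mulrC ler_wpM2r.
  apply: (le_trans (le_normr_Rintegral _ _)) => //.
    exact: bounded_measurable_integrable.
  apply: le_Rintegral => //.
    apply: bounded_measurable_integrable; case: bf => mf _; split.
      exact: measurableT_comp.
    by exists M => x; rewrite normr_id.
  by apply: (@bounded_measurable_integrable m (cst M)); split=> //; exists `|M|.
rewrite /charge_integral (le_trans (ler_normB _ _))// mulrDl lerD//; apply: bound.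
  change (fine (jordan_pos (hahnP nu) setT) <= C).
  rewrite jordan_posE cjordan_posE /crestr0 mem_set// /crestr setTI.
  by rewrite (le_trans (ler_norm _))// nuC.
change (fine (jordan_neg (hahnP nu) setT) <= C).
rewrite jordan_negE cjordan_negE /crestr0 mem_set// /crestr setTI fineN.
by rewrite (le_trans (ler_norm _))// normrN nuC.
Qed.

Lemma measurable_charge_integral (k : E -> {charge set E -> \bar R}) f :
  (forall A, measurable A -> measurable_fun setT (fun x => fine (k x A))) ->
  bm f -> measurable_fun setT (fun x => charge_integral (k x) f).
Proof.
move=> mk; move: f; apply: bounded_measurable_ind.
- move=> A mA; under eq_fun do rewrite charge_integral_indic//; exact: mk.
- move=> a f g bf bg mf mg; under eq_fun do rewrite charge_integral_lin//.
  by apply: measurable_funD => //; exact: measurable_funM.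
- move=> f_ f M bf_ bf fM f_f mf_.
  apply: (@measurable_fun_cvg _ _ _ setT (fun n x => charge_integral (k x) (f_ n))) => //.
  by move=> x _; exact: (charge_integral_cvg bf_ bf fM f_f).
Qed.

End charge_integral.

Section bounded_kernels.
Context (d : measure_display) (E : measurableType d) (R : realType).

(* A bounded complex measure is a pair of finite signed measures; its values are
   meaningful on measurable sets only. *)
Record bounded_kernel := BoundedKernel {
  kernel_re : E -> {charge set E -> \bar R} ;
  kernel_im : E -> {charge set E -> \bar R} ;
  kernel_val x A : R[i] := (fine (kernel_re x A) +i* fine (kernel_im x A))%C ;
  measurable_kernel_re : forall A, measurable A ->
    measurable_fun setT (fun x => complex.Re (kernel_val x A)) ;
  measurable_kernel_im : forall A, measurable A ->
    measurable_fun setT (fun x => complex.Im (kernel_val x A)) ;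
  kernel_bounded : exists M : R, forall x A, measurable A ->
    normc (kernel_val x A) <= M
}.

Local Coercion kernel_val : bounded_kernel >-> Funclass.

Lemma bmfun_Re (f : bmfun E R) : bounded_measurable (fun x => complex.Re (f x)).
Proof.
have [mf _ [M fM]] := bmfunP f; split => //.
by exists M => x; rewrite (le_trans (Re_le_normc _)).
Qed.

Lemma bmfun_Im (f : bmfun E R) : bounded_measurable (fun x => complex.Im (f x)).
Proof.
have [_ mf [M fM]] := bmfunP f; split => //.
by exists M => x; rewrite (le_trans (Im_le_normc _)).
Qed.

Definition kernel_integral (K : bounded_kernel) (f : E -> R[i]) (x : E) : R[i] :=
  let u y := complex.Re (f y) in
  let v y := complex.Im (f y) in
  ((charge_integral (kernel_re K x) u - charge_integral (kernel_im K x) v) +i*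
   (charge_integral (kernel_re K x) v + charge_integral (kernel_im K x) u))%C.

Lemma kernel_integral_bound (K : bounded_kernel) : exists2 C : R, 0 <= C &
  forall (f : bmfun E R) x, normc (kernel_integral K f x) <= C * supnorm f.
Proof.
have [C KC] := kernel_bounded K.
have C0 : 0 <= C by apply: le_trans (normc_ge0 _) (KC point set0 measurable0).
exists (2 * ((C + C) + (C + C))) => [|f x]; first by rewrite mulr_ge0// !addr_ge0.
have sf : forall y, `|complex.Re (f y)| <= supnorm f.
  by move=> y; rewrite (le_trans (Re_le_normc _))// normc_le_supnorm.
have sg : forall y, `|complex.Im (f y)| <= supnorm f.
  by move=> y; rewrite (le_trans (Im_le_normc _))// normc_le_supnorm.
have Kr A : measurable A -> `|fine (kernel_re K x A)| <= C.
  by move=> mA; apply: le_trans (KC x A mA); exact: (Re_le_normc (K x A)).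
have Ki A : measurable A -> `|fine (kernel_im K x A)| <= C.
  by move=> mA; apply: le_trans (KC x A mA); exact: (Im_le_normc (K x A)).
have c1 := charge_integral_bound (bmfun_Re f) sf Kr.
have c2 := charge_integral_bound (bmfun_Im f) sg Ki.
have c3 := charge_integral_bound (bmfun_Im f) sg Kr.
have c4 := charge_integral_bound (bmfun_Re f) sf Ki.
have e1 := le_trans (ler_normB _ _) (lerD c1 c2).
have e2 := le_trans (ler_normD _ _) (lerD c3 c4).
apply: le_trans (normc_le_ReIm _) _; apply: le_trans (lerD e1 e2) _.
by rewrite le_eqVlt; apply/orP; left; apply/eqP; ring.
Qed.

Lemma kernel_integral_bmfun (K : bounded_kernel) (f : bmfun E R) :
  kernel_integral K f \in bmfun_pred.
Proof.
apply: mem_set.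
have mr g : bounded_measurable g ->
    measurable_fun setT (fun x => charge_integral (kernel_re K x) g).
  by move=> bg; apply: measurable_charge_integral => // A; exact: (measurable_kernel_re K).
have mi g : bounded_measurable g ->
    measurable_fun setT (fun x => charge_integral (kernel_im K x) g).
  by move=> bg; apply: measurable_charge_integral => // A; exact: (measurable_kernel_im K).
split.
- by apply: measurable_funB; [exact/mr/bmfun_Re|exact/mi/bmfun_Im].
- by apply: measurable_funD; [exact/mr/bmfun_Im|exact/mi/bmfun_Re].
- have [C _ KC] := kernel_integral_bound K.
  by exists (C * supnorm f) => x; exact: KC.
Qed.

Definition kernel_op (K : bounded_kernel) (f : bmfun E R) : bmfun E R :=
  BMFun (kernel_integral_bmfun K f).

Lemma kernel_op_linear K : linear (kernel_op K).
Proof.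
move=> [a b] f g; apply: bmfunE => x.
have linE c (h k : bmfun E R) y : (c *: h + k) y = c * h y + k y by [].
have lin nu (h k : bmfun E R) : 
    charge_integral nu (fun y => complex.Re (((a +i* b)%C *: h + k) y)) =
    a * charge_integral nu (fun y => complex.Re (h y)) -
    b * charge_integral nu (fun y => complex.Im (h y)) +
    charge_integral nu (fun y => complex.Re (k y)).
  have bh := bmfun_Re h; have bh' := bmfun_Im h; have bk := bmfun_Re k.
  rewrite -addrA -mulNr -charge_integral_lin// -charge_integral_lin//.
    congr charge_integral; apply/funext => y; rewrite linE.
    by case: (h y) (k y) => ? ? [? ?] /=; ring.
  by apply: bounded_measurableD => //; exact: bounded_measurableZ.
have lin' nu (h k : bmfun E R) :
    charge_integral nu (fun y => complex.Im (((a +i* b)%C *: h + k) y)) =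
    a * charge_integral nu (fun y => complex.Im (h y)) +
    (b * charge_integral nu (fun y => complex.Re (h y)) +
    charge_integral nu (fun y => complex.Im (k y))).
  have bh := bmfun_Re h; have bh' := bmfun_Im h; have bk := bmfun_Im k.
  rewrite -charge_integral_lin// -charge_integral_lin//.
    congr charge_integral; apply/funext => y; rewrite linE.
    by case: (h y) (k y) => ? ? [? ?] /=; ring.
  by apply: bounded_measurableD => //; exact: bounded_measurableZ.
apply/eqP; rewrite linE eq_complex /= !lin !lin' /=.
by apply/andP; split; apply/eqP; ring.
Qed.

HB.instance Definition _ K :=
  GRing.isLinear.Build R[i] (bmfun E R) (bmfun E R) _ (kernel_op K)
    (kernel_op_linear K).

Lemma kernel_op_bounded K : exists2 C : R, 0 <= C &
  forall f, `|kernel_op K f| <= C%:C%C * `|f|.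
Proof.
have [C C0 KC] := kernel_integral_bound K; exists C => // f.
by rewrite !bmfun_normE -rmorphM lecR; apply: supnorm_le => x; exact: KC.
Qed.

End bounded_kernels.
Arguments bounded_kernel {d} E R.
Coercion kernel_val : bounded_kernel >-> Funclass.

Section positive_kernels.
Context (d : measure_display) (E : measurableType d) (R : realType).
Implicit Types (Q : R.-fker E ~> E).

Section complex_kernel.
Variable Q : R.-fker E ~> E.

Definition fker_charge (x : E) : set E -> \bar R := Q x.

Let fker_charge_finite x A : measurable A -> fker_charge x A \is a fin_num.
Proof. exact: (kernel_finite_transition (s := Q) x). Qed.

HB.instance Definition _ x :=
  isCharge.Build _ _ _ (fker_charge x) (measure0 (Q x))
    (fker_charge_finite x) (@measure_semi_sigma_additive _ _ _ (Q x)).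

Let fker_val x A : R[i] := (fine (fker_charge x A) +i* fine (@czero _ E R A))%C.

Let fker_val_Re A : measurable A ->
  measurable_fun setT (fun x => complex.Re (fker_val x A)).
Proof.
move=> mA; apply: (measurableT_comp _ (measurable_kernel Q A mA)).
exact: fine_measurable.
Qed.

Let fker_val_Im A : measurable A ->
  measurable_fun setT (fun x => complex.Im (fker_val x A)).
Proof. by []. Qed.

Let fker_val_bounded : exists M : R, forall x A, measurable A ->
  normc (fker_val x A) <= M.
Proof.
have [M QM] := measure_uub Q; exists M => x A mA.
rewrite /= expr0n addr0 sqrtr_sqr ger0_norm ?fine_ge0// -lee_fin.
rewrite fineK; last exact: fker_charge_finite.
by apply: le_trans (ltW (QM x)); rewrite le_measure// inE.
Qed.

Definition complex_kernel : bounded_kernel E R :=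
  @BoundedKernel _ E R fker_charge (fun=> czero)
    fker_val_Re fker_val_Im fker_val_bounded.

Lemma complex_kernelE x A : complex_kernel x A = (fine (Q x A))%:C%C.
Proof. by []. Qed.

Let fker_finite_measure x :
  exists m : {finite_measure set E -> \bar R}, Q x = m.
Proof.
have Qfin := @kernel_finite_transition _ _ _ _ R Q x.
have sfin : sigma_finite setT (Q x).
  by apply: fin_num_fun_sigma_finite => //; rewrite measure0.
pose H1 := isFinite.Build _ _ _ _ Qfin.
pose H2 := isSFinite.Build _ _ _ _ (sfinite_measure_sigma_finite sfin).
pose H3 := isSigmaFinite.Build _ _ _ _ sfin.
exists (HB.pack_for (FiniteMeasure.type E R) (Measure.sort (Q x)) H1 H2 H3).
exact: eq_measure.
Qed.

Lemma charge_integral_fker x f : bounded_measurable f ->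
  charge_integral (fker_charge x) f = \int[Q x]_y f y.
Proof.
have [m Qm] := fker_finite_measure x.
move: f; apply: bounded_measurable_ind.
- move=> A mA; rewrite charge_integral_indic//.
  by rewrite /Rintegral integral_indic// setIT.
- move=> a f g bf bg fE gE; rewrite charge_integral_lin// fE gE Qm.
  have fi := @bounded_measurable_integrable _ _ _ m _ bf.
  have gi := @bounded_measurable_integrable _ _ _ m _ bg.
  rewrite RintegralD ?RintegralZl//.
  exact/bounded_measurable_integrable/bounded_measurableZ.
- move=> f_ f M bf_ bf fM f_f fE.
  have c1 := charge_integral_cvg (nu := fker_charge x) bf_ bf fM f_f.
  have c2 := Rintegral_bounded_cvg (m := m) bf_ bf fM f_f.
  rewrite (_ : (fun n => _) = (fun n => \int[m]_y f_ n y)) in c1.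
    by rewrite Qm; exact: cvg_unique c1 c2.
  by apply/funext => n; rewrite fE Qm.
Qed.

Lemma kernel_op_fker (f : bmfun E R) x : kernel_op complex_kernel f x =
  ((\int[Q x]_y complex.Re (f y)) +i* (\int[Q x]_y complex.Im (f y)))%C.
Proof.
have c0 g : bounded_measurable g ->
    charge_integral (czero : {charge set E -> \bar R}) g = 0.
  move: g; apply: bounded_measurable_ind.
  - by move=> A mA; rewrite charge_integral_indic.
  - by move=> a g h bg bh g0 h0; rewrite charge_integral_lin// g0 h0 mulr0 addr0.
  - move=> f_ g M bf_ bf fM f_f fE.
    have c1 := charge_integral_cvg (nu := czero) bf_ bf fM f_f.
    rewrite (_ : (fun n => _) = (fun n => 0)) in c1; last exact/funext.
    by apply: cvg_unique c1 _ => //; exact: cvg_cst.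
rewrite /= /kernel_integral/= !c0 ?subr0 ?addr0; try exact: bmfun_Re; try exact: bmfun_Im.
by rewrite !charge_integral_fker//; [exact: bmfun_Im|exact: bmfun_Re].
Qed.

End complex_kernel.

Section kernel_snd.
Variable Q : R.-fker E ~> E.

Definition ker_snd (z : E * E) : {measure set E -> \bar R} := Q z.2.

Let measurable_ker_snd U : measurable U ->
  measurable_fun setT (ker_snd ^~ U).
Proof.
by move=> mU; exact: (measurableT_comp (measurable_kernel Q U mU) measurable_snd).
Qed.

HB.instance Definition _ := isKernel.Build _ _ _ _ _ ker_snd measurable_ker_snd.

Let ker_snd_uub : measure_fam_uub ker_snd.
Proof. by have [M QM] := measure_uub Q; exists M => z; exact: QM. Qed.

HB.instance Definition _ := Kernel_isFinite.Build _ _ _ _ _ ker_snd ker_snd_uub.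

End kernel_snd.

Import KCOMP_FINITE_KERNEL.

Fixpoint kernel_pow Q (n : nat) : R.-fker E ~> E :=
  if n is m.+1 then (Q \; ker_snd (kernel_pow Q m))%E
  else kdirac (@measurable_id _ E setT).

Lemma kernel_powS Q n x A :
  kernel_pow Q n.+1 x A = (\int[Q x]_y kernel_pow Q n y A)%E.
Proof. by []. Qed.

(* Kernel iterates are the powers of the operator. *)
Lemma kernel_op_pow Q n :
  kernel_op (complex_kernel (kernel_pow Q n)) =1 iter n (kernel_op (complex_kernel Q)).
Proof.
elim: n => [f|n IHn f]; apply: bmfunE => x.
  rewrite kernel_op_fker /=.
  have D0 g : bounded_measurable g -> \int[\d_x]_y g y = g x.
    move=> [mg _]; rewrite /Rintegral integral_dirac//.
      by rewrite diracT mul1e.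
    exact/measurable_EFinP.
  rewrite [X in (X +i* _)%C]D0; last exact: bmfun_Re.
  rewrite [X in (_ +i* X)%C]D0; last exact: bmfun_Im.
  by case: (f x).
set P := kernel_pow Q n.
have [C PC] := kernel_bounded (complex_kernel P).
have PC' y A : measurable A -> `|fine (fker_charge P y A)| <= C.
  by move=> mA; apply: le_trans (PC y A mA); exact: (Re_le_normc (complex_kernel P y A)).
pose phi g y := charge_integral (fker_charge P y) g.
have phib g M : bounded_measurable g -> (forall x, `|g x| <= M) ->
    forall y, `|phi g y| <= (C + C) * M.
  by move=> bg gM y; exact: charge_integral_bound bg gM (PC' y).
have bphi g : bounded_measurable g -> bounded_measurable (phi g).
  move=> bg; split.
    apply: measurable_charge_integral => // A.
    exact: (measurable_kernel_re (complex_kernel P)).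
  by have [_ [M gM]] := bg; exists ((C + C) * M); exact: phib.
have powS g : bounded_measurable g ->
    charge_integral (fker_charge (kernel_pow Q n.+1) x) g =
    charge_integral (fker_charge Q x) (phi g).
  move: g; apply: bounded_measurable_ind.
  - move=> A mA; rewrite charge_integral_indic//.
    rewrite charge_integral_fker; last exact/bphi/bounded_measurable_indic.
    congr fine; apply: eq_integral => y _.
    rewrite /phi charge_integral_indic// fineK//.
    exact: (kernel_finite_transition (s := P) y).
  - move=> a f0 g bf bg fE gE; rewrite charge_integral_lin// fE gE.
    rewrite -charge_integral_lin//; [|exact: bphi|exact: bphi].
    by congr charge_integral; apply/funext => y; rewrite /phi charge_integral_lin.
  - move=> f_ g M bf_ bg fM f_g fE.
    have c1 := charge_integral_cvg
      (nu := fker_charge (kernel_pow Q n.+1) x) bf_ bg fM f_g.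
    rewrite (_ : (fun n => _) =
      (fun k => charge_integral (fker_charge Q x) (phi (f_ k)))) in c1; last first.
      exact/funext.
    apply: cvg_unique c1 _ => //.
    apply: (charge_integral_cvg (M := (C + C) * M)) => //.
    + by move=> k; exact: bphi.
    + exact: bphi.
    + by move=> k; exact: phib.
    + by move=> y; exact: charge_integral_cvg bf_ bg fM f_g.
rewrite iterS -IHn !kernel_op_fker.
have phiE g : bounded_measurable g ->
    \int[kernel_pow Q n.+1 x]_y g y = \int[Q x]_y (\int[P y]_z g z).
  move=> bg; rewrite -charge_integral_fker// powS// charge_integral_fker//.
    by apply: eq_Rintegral => y _; rewrite /phi charge_integral_fker.
  exact: bphi.
by congr (_ +i* _)%C; rewrite phiE; try exact: bmfun_Re; try exact: bmfun_Im;
  apply: eq_Rintegral => y _; rewrite kernel_op_fker.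
Qed.

End positive_kernels.

Section spectral_theory.
Context (R : realType) (V : completeNormedModType R[i]).
Implicit Types (T : {linear V -> V}) (F H : set V) (lam : R[i]) (rho : R).

Definition opnorm T : R :=
  sup [set complex.Re `|T v| | v in [set v : V | `|v| <= 1]].

Definition linear_subspace H :=
  H 0 /\ forall (a : R[i]) u v, H u -> H v -> H (a *: u + v).

Definition invariant T H := forall v, H v -> H (T v).

Definition finite_dim H := exists (n : nat) (e : 'I_n -> V),
  H = [set \sum_(i < n) c i *: e i | c in [set: 'I_n -> R[i]]].

Definition direct_sum F H :=
  (forall v, exists f h, [/\ F f, H h & v = f + h]) /\ F `&` H = [set 0].

Definition eigenvalue_on T H lam :=
  exists v, [/\ H v, v != 0 & T v = lam *: v].

(* T - lam is invertible in the algebra of bounded operators of the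
   T-invariant subspace H; only the values of S on H matter *)
Definition resolvent_on T H lam := exists S : V -> V,
  [/\ forall v, H v -> H (S v),
     forall (a : R[i]) u v, H u -> H v -> S (a *: u + v) = a *: S u + S v,
     exists M : R[i], forall v, H v -> `|S v| <= M * `|v|,
     forall v, H v -> S (T v - lam *: v) = v &
     forall v, H v -> T (S v) - lam *: S v = v].

Definition spectrum_on T H : set R[i] := [set lam | ~ resolvent_on T H lam].

(* [sup set0 = 0], so the operator of the space {0} has spectral radius 0; the
   spectrum of a bounded operator on a closed subspace H is a bounded set *)
Definition spectral_radius_on T H : R :=
  sup [set normc lam | lam in spectrum_on T H].

Definition spectral_radius T : R := spectral_radius_on T setT.

Definition spectral_splitting T rho := exists F H,
  [/\ [/\ linear_subspace F, linear_subspace H & direct_sum F H],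
     invariant T F /\ invariant T H,
     closed H /\ spectral_radius_on T H < rho,
     finite_dim F &
     forall lam, eigenvalue_on T F lam -> rho <= normc lam].

Definition ess_spectral_radius T : R :=
  inf (spectral_radius T |` [set rho | 0 <= rho /\ spectral_splitting T rho]).

Definition quasi_compact T := ess_spectral_radius T < spectral_radius T.

End spectral_theory.

Section absolute_continuity.
Context (d : measure_display) (E : measurableType d) (R : realType).
Implicit Types (nu : probability E R) (alpha : E * E -> R).

(* The function of eta is nondecreasing, so the limit exists in \bar R. *)
Definition Delta nu (Q : R.-fker E ~> E) : \bar R :=
  lim ((fun eta : R => ereal_sup
    [set Q x A | x in [set: E] &
                 A in [set A | measurable A /\ (nu A <= eta%:E)%E]]) @ 0^'+).

(* the class of densities alpha denoted by H_nu *)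
Definition unif_integrable_density nu alpha :=
  [/\ forall z, 0 <= alpha z,
     measurable_fun setT alpha &
     (fun m : R => ereal_sup
       [set (\int[nu]_(y in [set y | (m <= alpha (x, y))%R]) (alpha (x, y))%:E)%E
         | x in [set: E]]) @ +oo --> 0%E].

(* the kernel T_(nu, alpha) *)
Definition density_kernel nu alpha (x : E) (A : set E) : \bar R :=
  (\int[nu]_(y in A) (alpha (x, y))%:E)%E.

Definition countably_generated :=
  exists2 G : set (set E), countable G & @measurable d E = <<s G >>.

End absolute_continuity.
Arguments countably_generated {d} E.

(* Main.v *)
(** With P the spectral projection onto F_rho, put L = Q P and N = Q (1 - P).
    P f is controlled by the values of Q^k f at finitely many points x_1, ..., x_p
    up to a multiple of (r / s)^k |f| with r < s: P has finite rank, a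
    finite-dimensional space of functions embeds into the values at finitely many
    points, and Q^k is bounded below by s^k / C on it while Q^k (1 - P) is
    O(r^k). Hence P preserves bounded pointwise convergence of sequences, so L and
    N are given by kernels; and, for nu proportional to the sum of the measures
    Q^k(x_i, .) with k large, Q^l(x, A) <= a nu(A) + rho^l / 16 for every x and A,
    which gives (ii).

    For (iii), W = d nu / d (Q^l(x, .) + nu) is obtained, jointly measurably in
    (x, y), as an almost sure limit of quotients over finite partitions generating
    the sigma-algebra. Truncating (1 - W) / W at a large constant c gives alpha;
    what is left is at most Q^l(x, {W < 1 / (1 + c)}), where the nu-measure of
    the set is O(1 / c).

    The bound O(r^n) for the powers of an operator with spectral radius less than
    r is proved without holomorphic calculus: (1 - X^2)^-1 is the mean of
    (1 - X)^-1 and (1 + X)^-1, so averaging resolvents over 2^m-th roots of unity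
    bounds (1 - (T / lam)^(2^m))^-1 on an annulus uniformly in m. *)

From HB Require Import structures.
Require Import Defs.
From mathcomp Require Import all_boot all_order all_algebra.
From mathcomp Require Import complex ring lra.
From mathcomp Require Import all_classical all_reals all_analysis measurable_realfun.
Import Order.TTheory GRing.Theory Num.Theory.
Import numFieldNormedType.Exports.
Local Open Scope classical_set_scope.
Local Open Scope ring_scope.

Set Implicit Arguments.
Unset Strict Implicit.
Unset Printing Implicit Defensive.

Local Notation normc0 := ComplexField.Normc.normc0.
Local Notation normcM := ComplexField.Normc.normcM.
Local Notation normcV := ComplexField.Normc.normcV.

(** * Powers and resolvents of bounded operators *)

(** The hypothesis yields a splitting at some rho0 < rho, whose finite-dimensional part may still
    carry eigenvalues of modulus in [rho0, rho). A Bezout identity between coprime factors of an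
    annihilating polynomial moves them to the complement. The same polynomial calculus bounds the
    projection without an open mapping argument, and inverts T on its range.

    Two rates compete: r^k for Q^k (1 - P), and s^k from below for Q^k on the range of P. On that
    range Q^l is only bounded by the l-th power of a norm bound; r < s allows this factor to be paid
    for by (r / s)^k, with k chosen after l. This is why nu depends on l.

    The constant 16 is a budget. The error in Q^l(x, A) is rho^l / 32 from Q^l (1 - P) and rho^l /
    32 from the choice of k. Truncating the density costs another rho^l / 16, so S(x, A) <= rho^l /
    8; the norm of a positive kernel is bounded by four times a bound on its values, whence the norm
    of S is at most rho^l / 2. *)

Section complex_norm.
Context (R : realType).
Implicit Types (z w : R[i]).

Lemma normc_real (a : R) : normc (a%:C%C) = `|a|.
Proof. by rewrite /= expr0n addr0 sqrtr_sqr. Qed.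

Lemma normc1 : normc (1 : R[i]) = 1.
Proof. by rewrite -[1]/((1 : R)%:C%C) normc_real normr1. Qed.

Lemma normc_eq0 z : (normc z == 0) = (z == 0).
Proof.
apply/eqP/eqP => [/ComplexField.Normc.eq0_normc//|->].
exact: normc0.
Qed.

Lemma normc_gt0 z : (0 < normc z) = (z != 0).
Proof. by rewrite lt_neqAle normc_ge0 andbT eq_sym normc_eq0. Qed.

Lemma normcX z n : normc (z ^+ n) = normc z ^+ n.
Proof. by elim: n => [|n IHn]; rewrite ?normc1// !exprS normcM IHn. Qed.

Lemma normcD z w : normc (z + w) <= normc z + normc w.
Proof. exact: le_normcD. Qed.

End complex_norm.

Section real_norm.
Context (R : realType) (V : normedModType R[i]).
Implicit Types (u v : V) (c : R[i]).

Definition nrm v : R := complex.Re `|v|.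

Lemma nrmE v : `|v| = (nrm v)%:C%C.
Proof.
rewrite /nrm; have := normr_ge0 v; case: (`|v|) => a b.
by rewrite lecE /= => /andP[/eqP-> _].
Qed.

Lemma nrm_ge0 v : 0 <= nrm v.
Proof. by have := normr_ge0 v; rewrite nrmE -[0]/((0 : R)%:C%C) lecR. Qed.
Hint Resolve nrm_ge0 : core.

Lemma nrm0 : nrm 0 = 0.
Proof. by rewrite /nrm normr0. Qed.

Lemma nrm_eq0 v : nrm v = 0 -> v = 0.
Proof. by move=> v0; apply/normr0_eq0; rewrite nrmE v0. Qed.

Lemma nrmD u v : nrm (u + v) <= nrm u + nrm v.
Proof. by rewrite -lecR rmorphD /= -!nrmE ler_normD. Qed.

Lemma nrmN v : nrm (- v) = nrm v.
Proof. by rewrite /nrm normrN. Qed.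

Lemma nrmB u v : nrm (u - v) <= nrm u + nrm v.
Proof. by rewrite -(nrmN v) nrmD. Qed.

Lemma nrm_distC u v : nrm (u - v) = nrm (v - u).
Proof. by rewrite -opprB nrmN. Qed.

Lemma nrm_triangle w u v : nrm (u - v) <= nrm (u - w) + nrm (w - v).
Proof. by rewrite -[in leLHS](subrK w u) -addrA nrmD. Qed.

Lemma nrmZ c v : nrm (c *: v) = normc c * nrm v.
Proof. by apply: complexI; rewrite rmorphM /= -!nrmE normrZ normc_normr. Qed.

Lemma nrm_boundP (H : set V) (S : V -> V) (M : R[i]) :
  (forall v, H v -> `|S v| <= M * `|v|) ->
  forall v, H v -> nrm (S v) <= normc M * nrm v.
Proof.
move=> SM v Hv; have := SM v Hv; rewrite !nrmE.
case: M {SM} => a b; rewrite lecE => /andP[_ /=]; rewrite mulr0 subr0 => h.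
apply: le_trans h _; rewrite ler_wpM2r//.
exact: le_trans (ler_norm _) (Re_le_normc (a +i* b)%C).
Qed.

Lemma nrm_boundE (H : set V) (S : V -> V) (M : R) :
  (forall v, H v -> nrm (S v) <= M * nrm v) ->
  exists M' : R[i], forall v, H v -> `|S v| <= M' * `|v|.
Proof.
move=> SM; exists M%:C%C => v Hv; rewrite !nrmE -rmorphM lecR; exact: SM.
Qed.

End real_norm.
#[export] Hint Extern 0 (is_true (0 <= nrm _)) => solve [apply: nrm_ge0] : core.

Section resolvent_bounds.
Context (R : realType) (V : completeNormedModType R[i]).
Variable T : {linear V -> V}.
Implicit Types (u v w a : V) (lam mu : R[i]) (M K : R).

Lemma iter_linear n (c : R[i]) u v : iter n T (c *: u + v) = c *: iter n T u + iter n T v.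
Proof. by elim: n => //= n ->; rewrite linearP. Qed.

Lemma iterN n u : iter n T (- u) = - iter n T u.
Proof. by elim: n => //= n ->; rewrite linearN. Qed.

Lemma iterDlin n u v : iter n T (u + v) = iter n T u + iter n T v.
Proof. by have := iter_linear n 1 u v; rewrite !scale1r. Qed.

Lemma iterZ n c u : iter n T (c *: u) = c *: iter n T u.
Proof. by elim: n => //= n ->; rewrite linearZ. Qed.

Lemma iter_bound K n : 0 <= K -> (forall v, nrm (T v) <= K * nrm v) ->
  forall v, nrm (iter n T v) <= K ^+ n * nrm v.
Proof.
move=> K0 TK v; elim: n => [|n IHn]; first by rewrite expr0 mul1r.
by rewrite iterS exprS -mulrA (le_trans (TK _))// ler_wpM2l.
Qed.

(* A bound of the form |a| <= M |T a - lam a| is what is left of a bound on the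
   resolvent at lam once its argument is written as (T - lam) a. *)
Definition bounded_below M lam := forall a, nrm a <= M * nrm (T a - lam *: a).

(** Moving [lam] perturbs T - lam by a small multiple of the identity, which half of |a| absorbs.
    This local uniformity is what compactness needs. *)
Lemma bounded_below_near M lam0 lam : 0 <= M -> bounded_below M lam0 ->
  M * normc (lam - lam0) <= 1 / 2 -> bounded_below (2 * M) lam.
Proof.
move=> M0 bM sm a; have := bM a.
have -> : T a - lam0 *: a = (T a - lam *: a) + (lam - lam0) *: a.
  by rewrite scalerBl addrA subrK.
move=> h; have := le_trans h (ler_wpM2l M0 (nrmD _ _)); rewrite nrmZ mulrDr mulrA.
have := ler_wpM2r (nrm_ge0 a) sm; lra.
Qed.

(** Compactness turns pointwise resolvent bounds into one bound on an annulus. It is applied to a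
    square of R * R containing the annulus, with [rho1 <= normc lam] kept as a premise of the
    property. *)
Lemma bounded_below_annulus rho1 big :
  (forall lam, rho1 <= normc lam -> exists M, bounded_below M lam) ->
  exists M, 0 <= M /\
    forall lam, rho1 <= normc lam <= big -> bounded_below M lam.
Proof.
move=> loc.
have bbW M M' lam : M <= M' -> bounded_below M lam -> bounded_below M' lam.
  by move=> MM' b a; apply: le_trans (b a) _; rewrite ler_wpM2r.
have cK := compact_setX (@segment_compact R (- big) big) (@segment_compact R (- big) big).
have /compact_near_coveringP cov := cK.
(* The near-covering form of compactness, with the constant M tending to +oo as parameter: what
   holds near each point for all large M holds on the whole square for all large M. *)
have /= := cov R +oo%R (fun M z => rho1 <= normc (z.1 +i* z.2)%C ->
  bounded_below M (z.1 +i* z.2)%C).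
move=> /(_ _) [|M0].
  move=> [x y] _.
  suff [M1 [e [e0 He]]] : exists M1 e, 0 < e /\ forall x' y', normc ((x' +i* y') - (x +i* y))%C <= e ->
     rho1 <= normc (x' +i* y')%C -> bounded_below M1 (x' +i* y')%C.
    exists (ball (x, y) (e / 2), [set M | M1 <= M]).
      split; first by apply: nbhsx_ballx; rewrite divr_gt0.
      by exists M1; split; [exact: num_real|move=> z /ltW].
    move=> [[x' y'] M] /= [[/= b1 b2] M1M] r1; apply: bbW M1M _; apply: He => //.
    rewrite (le_trans (normc_le_ReIm _))//= [leRHS]splitr lerD//.
      by rewrite distrC ltW.
    by rewrite distrC ltW.
  have [r1|r1] := leP rho1 (normc (x +i* y)%C).
    have [M bM] := loc _ r1.
    pose M' := Num.max M 1; have M'1 : 1 <= M' by rewrite le_max lexx orbT.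
    have M'0 : 0 < M' by apply: lt_le_trans M'1.
    exists (2 * M'), (1 / 2 / M'); split; first by rewrite divr_gt0.
    move=> x' y' h _; apply: (bounded_below_near _ (bbW _ _ _ _ bM)); first exact: ltW.
      by rewrite le_max lexx.
    by rewrite mulrC -ler_pdivlMr.
  (* Strictly inside the inner circle, a small neighbourhood stays inside it and the implication is
     vacuous. *)
  exists 0, ((rho1 - normc (x +i* y)%C) / 2); split; first by rewrite divr_gt0// subr_gt0.
  move=> x' y' h h'.
  have := normcD ((x' +i* y') - (x +i* y))%C (x +i* y)%C; rewrite subrK => h2.
  exfalso; lra.
move=> [_ HM]; have HM' := HM (Num.max M0 0 + 1).
exists (Num.max M0 0 + 1); split; first by rewrite addr_ge0// le_max lexx orbT.
move=> [x y] /andP[r1 r2]; apply: (HM' _ (x, y)) => //.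
  by rewrite ltr_pwDr// le_max lexx.
have hx := le_trans (Re_le_normc (x +i* y)%C) r2.
have hy := le_trans (Im_le_normc (x +i* y)%C) r2.
by split; rewrite /= in_itv /= -ler_norml.
Qed.

Lemma resolvent_bounded_below lam : resolvent_on T setT lam ->
  exists M, bounded_below M lam.
Proof.
move=> [S [_ _ [M SM] ST _]]; exists (normc M) => a.
by rewrite -{1}(ST a)//; exact: (nrm_boundP SM).
Qed.

End resolvent_bounds.

Lemma expn_decay (R : realType) (q e : R) : 0 <= q < 1 -> 0 < e ->
  exists n0, forall n, (n0 <= n)%N -> q ^+ n <= e.
Proof.
move=> /andP[q0 q1] e0.
have /cvgrPdist_le/(_ _ e0)[n0 _ h] : (q ^+ n) @[n --> \oo] --> (0 : R).
  by apply: cvg_expr; rewrite ger0_norm.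
exists n0 => n nn; have := h n nn.
by rewrite sub0r normrN ger0_norm// exprn_ge0.
Qed.

(** * Growth of powers along dyadic exponents *)

Section gelfand.
Context (R : realType) (V : completeNormedModType R[i]).
Variable T : {linear V -> V}.
Variables (rho1 big Lip : R).
Hypotheses (rho1_gt0 : 0 < rho1) (Lip_ge0 : 0 <= Lip).
Implicit Types (u v w : V) (lam z : R[i]) (s t : R).

Definition dyadic_pow (m : nat) (lam : R[i]) (w : V) : V :=
  lam^-1 ^+ (2 ^ m) *: iter (2 ^ m) T w.

Local Notation X := dyadic_pow.

Lemma dyadic_powD m lam u v : X m lam (u + v) = X m lam u + X m lam v.
Proof. by rewrite /X iterDlin scalerDr. Qed.

Lemma dyadic_powN m lam u : X m lam (- u) = - X m lam u.
Proof. by rewrite /X iterN scalerN. Qed.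

Lemma dyadic_powZ m lam c u : X m lam (c *: u) = c *: X m lam u.
Proof. by rewrite /X iterZ !scalerA mulrC. Qed.

Lemma dyadic_powS m lam u : X m.+1 lam u = X m lam (X m lam u).
Proof.
by rewrite /X expnS mul2n -addnn exprD iterD iterZ scalerA.
Qed.

Lemma dyadic_pow_root m lam z u : z ^+ (2 ^ m) = -1 -> X m (z * lam) u = - X m lam u.
Proof.
by move=> z1; rewrite /X invfM exprMn [z^-1 ^+ _]exprVn z1 invrN invr1 mulN1r scaleNr.
Qed.

Definition in_annulus lam := rho1 <= normc lam <= big.

(** Only moduli vary, along a ray, uniformly over all rays. Averaging multiplies [lam] by numbers of
    modulus 1, which exchanges rays, so the constant survives every doubling of the exponent. *)
Definition radial_lipschitz (F : R[i] -> V -> V) :=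
  forall z s t v, normc z = 1 -> rho1 <= s <= big -> rho1 <= t <= big ->
    nrm (F (s%:C%C * z) v - F (t%:C%C * z) v) <= Lip * `|s - t| * nrm v.

Definition dyadic_inverse m (F : R[i] -> V -> V) :=
  (forall lam v, in_annulus lam -> F lam (v - X m lam v) = v /\
     F lam v - X m lam (F lam v) = v) /\ radial_lipschitz F.

(* (1 - X^2)^-1 = ((1 - X)^-1 + (1 + X)^-1) / 2, and X becomes - X when lam is
   multiplied by a 2^m-th root of -1; averaging keeps the Lipschitz constant. *)
Lemma dyadic_inverseS m F : dyadic_inverse m F -> exists F', dyadic_inverse m.+1 F'.
Proof.
move=> [FI FL].
have [z z1] : exists z : R[i], z ^+ (2 ^ m) = -1.
  by exists ((2 ^ m).-root (-1)); rewrite rootCK// expn_gt0.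
have nz : normc z = 1.
  apply: (@pexpIrn _ (2 ^ m)); rewrite ?nnegrE ?normc_ge0// ?expn_gt0//.
  by rewrite -normcX z1 normcN normc1 expr1n.
have h2 : (2 : R[i])^-1 + 2^-1 = 1 by rewrite [RHS]splitr mul1r.
exists (fun lam v => 2^-1 *: (F lam v + F (z * lam) v)); split.
  move=> lam v lamA.
  have zlamA : in_annulus (z * lam) by rewrite /in_annulus normcM nz mul1r.
  have FI' w : F (z * lam) (w + X m lam w) = w /\
      F (z * lam) w + X m lam (F (z * lam) w) = w.
    by have := FI _ w zlamA; rewrite !(dyadic_pow_root _ _ z1) !opprK.
  split.
  (* 1 - X^2 = (1 - X)(1 + X): inverting one factor leaves the other, and 1 + X and 1 - X average to
     1. *)
  - have -> : F lam (v - X m.+1 lam v) = v + X m lam v.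
      rewrite -[RHS](FI lam _ lamA).1 dyadic_powD -dyadic_powS.
      by congr (F lam _); rewrite opprD addrA addrK.
    have -> : F (z * lam) (v - X m.+1 lam v) = v - X m lam v.
      rewrite -[RHS](FI' _).1 dyadic_powD dyadic_powN -dyadic_powS.
      by congr (F _ _); rewrite addrA subrK.
    by rewrite addrACA subrr addr0 scalerDr -scalerDl h2 scale1r.
  - have := (FI lam v lamA).2; set p := F lam v => Hp.
    have := (FI' v).2; set q := F _ v => Hq.
    rewrite dyadic_powZ -scalerBr dyadic_powD.
    have -> : p + q - (X m.+1 lam p + X m.+1 lam q) =
        (p - X m lam p + X m lam (p - X m lam p)) +
        (q + X m lam q - X m lam (q + X m lam q)).
      rewrite !dyadic_powD !dyadic_powN -!dyadic_powS !opprD !addrA !subrK.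
      rewrite -!addrA; congr (_ + _); rewrite addrC -!addrA; congr (_ + _).
      by rewrite addNKr addrC.
    rewrite Hp Hq addrACA subrr addr0 scalerDr -scalerDl h2 scale1r.
    by [].
move=> y s t v y1 sr tr; rewrite -scalerBr nrmZ.
have zy : normc (z * y) = 1 by rewrite normcM nz y1 mulr1.
have e1 := FL _ s t v y1 sr tr; have e2 := FL _ s t v zy sr tr.
have n2 : normc (2 : R[i]) = 2 by rewrite -(rmorph_nat (real_complex R)) normc_real normr_nat.
rewrite opprD addrACA !(mulrCA z) normcV n2.
have := nrmD (F (s%:C * y)%C v - F (t%:C * y)%C v)
  (F (s%:C * (z * y))%C v - F (t%:C * (z * y))%C v).
move=> h; lra.
Qed.

Hypothesis base : exists F, dyadic_inverse 0 F.

Lemma dyadic_inverse_ex m : exists F, dyadic_inverse m F.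
Proof. by elim: m => // m [F]; exact: dyadic_inverseS. Qed.

(** The factor 3 is the same for every radius, so that lowering the radius finitely often does not
    degrade it; only the threshold m0 may grow. *)
Definition dyadic_bound s := exists m0, forall m, (m0 <= m)%N ->
  forall v, nrm (iter (2 ^ m) T v) <= 3 * s ^+ (2 ^ m) * nrm v.

(** At t > s the operator X is small for large m, so F at t is near the identity; the Lipschitz
    bound, independent of m, carries this down to s'. With w = v - X v taken at s', F maps w to v,
    hence |v - w| <= |w| / 2, and X v = v - w is bounded by 3 |v|. *)
Lemma dyadic_bound_step s s' t : rho1 <= s' -> s' <= s -> s < t <= big ->
  Lip * (t - s') <= 4^-1 -> dyadic_bound s -> dyadic_bound s'.
Proof.
move=> r1 ss /andP[st tb] Lt [m0 bs].
have s'0 : 0 < s' by apply: lt_le_trans r1.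
have s0 : 0 < s by apply: lt_le_trans ss.
have t0 : 0 < t by apply: lt_trans st.
have st1 : 0 <= s / t < 1.
  by rewrite divr_ge0 ?(ltW s0) ?(ltW t0)//= ltr_pdivrMr// mul1r.
(* 15 = 3 * 5: with the factor 3 of [dyadic_bound] this gives |X w| <= |w| / 5 at t, and then a = w
   + X a gives |a - w| <= |w| / 4. *)
have h15 : (0 : R) < 15^-1 by rewrite invr_gt0.
have [n0 hn] := expn_decay st1 h15.
exists (maxn m0 n0) => m; rewrite geq_max => /andP[m0m n0m] v.
have [F [FI FL]] := dyadic_inverse_ex m.
have real1 (r : R) : 0 < r -> normc r%:C%C = r by move=> r0; rewrite normc_real gtr0_norm.
have tA : in_annulus t%:C%C.
  by rewrite /in_annulus real1// tb andbT (le_trans r1)// (le_trans ss)// ltW.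
have sA : in_annulus s'%:C%C.
  by rewrite /in_annulus real1// r1/= (le_trans ss)// (le_trans (ltW st)).
have nX r w : 0 < r -> nrm (X m r%:C%C w) = r^-1 ^+ (2 ^ m) * nrm (iter (2 ^ m) T w).
  by move=> r0; rewrite nrmZ normcX normcV real1.
have Xt w : nrm (X m t%:C%C w) <= 5^-1 * nrm w.
  rewrite nX//; apply: (@le_trans _ _ (t^-1 ^+ (2 ^ m) * (3 * s ^+ (2 ^ m) * nrm w))).
    by rewrite ler_wpM2l// ?exprn_ge0 ?invr_ge0 ?(ltW t0)// bs.
  rewrite mulrA ler_wpM2r// mulrCA -exprMn [t^-1 * s]mulrC.
  have : (s / t) ^+ (2 ^ m) <= 15^-1.
    by apply: hn; rewrite (leq_trans n0m)// ltnW// ltn_expl.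
  lra.
have Ft w : nrm (F t%:C%C w - w) <= 4^-1 * nrm w.
  have := (FI _ w tA).2; set a := F _ w => aw.
  have e1 : a - w = X m t%:C%C a by rewrite -[in LHS]aw opprB addrC subrK.
  have := Xt a; have := nrmD (a - w) w; rewrite subrK -e1; lra.
set w := v - X m s'%:C%C v.
have Fw : F s'%:C%C w = v := (FI _ v sA).1.
have c1 : nrm (v - w) <= 2^-1 * nrm w.
  have := FL 1 s' t w (normc1 _); rewrite !mulr1.
  move: (sA) (tA); rewrite /in_annulus !real1// => sA' tA' /(_ sA' tA').
  rewrite Fw => h; have := nrm_triangle (F t%:C%C w) v w; have := Ft w.
  have : Lip * `|s' - t| * nrm w <= 4^-1 * nrm w.
    by rewrite ler_wpM2r// distrC ger0_norm// subr_ge0 (le_trans ss)// ltW.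
  lra.
have c2 : nrm (X m s'%:C%C v) <= 3 * nrm v.
  have -> : X m s'%:C%C v = v - w by rewrite /w opprB addrC subrK.
  have := nrmD v (w - v); have := nrm_ge0 v.
  rewrite (addrC v) subrK (nrm_distC w v); lra.
have sp : 0 < s' ^+ (2 ^ m) by rewrite exprn_gt0.
move: c2; rewrite nX// exprVn -ler_pdivlMl ?invr_gt0// invrK.
by rewrite mulrA [_ * 3]mulrC.
Qed.

(** The radius goes down from s' to s' - d, through the comparison point t = s' + d. Since d does
    not depend on the current radius, finitely many steps reach rho1. *)
Lemma dyadic_bound_chain s : rho1 <= s -> s < big -> dyadic_bound s -> dyadic_bound rho1.
Proof.
move=> r1 sb bs.
(* A step requires 2 d Lip <= 1 / 4, and s + d <= big keeps t in the annulus; the + 1 covers Lip =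
   0. *)
pose d := Num.min (8^-1 / (Lip + 1)) (big - s).
have d0 : 0 < d by rewrite lt_min subr_gt0 sb andbT divr_gt0// ltr_wpDl.
have Ld : Lip * (d + d) <= 4^-1.
  have : d <= 8^-1 / (Lip + 1) by rewrite ge_min lexx.
  rewrite ler_pdivlMr; last by rewrite ltr_wpDl.
  have := mulr_ge0 Lip_ge0 (ltW d0); nra.
have db : s + d <= big by rewrite -lerBrDl ge_min lexx orbT.
have step s' : rho1 <= s' -> s' <= s -> dyadic_bound s' -> dyadic_bound (Num.max rho1 (s' - d)).
  move=> r1' ss' bs'; apply: (@dyadic_bound_step s' _ (s' + d)) => //.
  - by rewrite le_max lexx.
  - by rewrite ge_max r1'/= lerBlDr lerDl ltW.
  - by rewrite ltrDl d0/= (le_trans _ db)// lerD2r.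
  - apply: le_trans Ld; apply: ler_wpM2l => //.
    have : s' - d <= Num.max rho1 (s' - d) by rewrite le_max lexx orbT.
    lra.
have chain k : dyadic_bound (Num.max rho1 (s - k%:R * d)).
  elim: k => [|k IHk]; first by rewrite mul0r subr0 max_r.
  have := step _ _ _ IHk.
  have -> : Num.max rho1 (Num.max rho1 (s - k%:R * d) - d) = Num.max rho1 (s - k.+1%:R * d).
    rewrite -natr1 mulrDl mul1r opprD addrA.
    have [h|h] := leP rho1 (s - k%:R * d) => //.
    rewrite !max_l//; lra.
  apply; first by rewrite le_max lexx.
  by rewrite ge_max r1/= lerBlDr lerDl mulr_ge0// ltW.
have := chain (Num.bound (s / d)); rewrite max_l//.
have sd : 0 <= s / d by rewrite divr_ge0 ?(ltW d0)// (le_trans (ltW rho1_gt0)).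
have := archi_boundP sd; rewrite ltr_pdivrMr// => h.
by rewrite lerBlDr (le_trans (ltW h))// lerDr ltW.
Qed.

End gelfand.

Section power_bound.
Context (R : realType) (V : completeNormedModType R[i]).
Variable T : {linear V -> V}.
Implicit Types (u v w : V) (lam z : R[i]) (s t : R).

(** For m = 0, (1 - T / lam)^-1 is - lam (T - lam)^-1. The Lipschitz constant comes from the
    resolvent identity S l - S m = (l - m) S l S m. *)
Lemma dyadic_inverse0 (rho1 big M : R) : 0 < rho1 -> rho1 <= big -> 0 <= M ->
  (forall lam, rho1 <= normc lam -> resolvent_on T setT lam) ->
  (forall lam, rho1 <= normc lam <= big -> bounded_below T M lam) ->
  exists F, dyadic_inverse T rho1 big (M + big * M ^+ 2) 0 F.
Proof.
move=> r0 rb M0 res bM.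
have [S SP] : exists S : R[i] -> V -> V, forall lam, rho1 <= normc lam ->
    forall v, S lam (T v - lam *: v) = v /\ T (S lam v) - lam *: S lam v = v.
  have : forall lam, exists S : V -> V, rho1 <= normc lam ->
    forall v, S (T v - lam *: v) = v /\ T (S v) - lam *: S v = v.
    move=> lam; have [h|] := boolP (rho1 <= normc lam); last by exists id.
    by have [S [_ _ _ S1 S2]] := res _ h; exists S => _ v; rewrite S1// S2.
  by move=> /choice[S HS]; exists S.
have Sb lam v : rho1 <= normc lam <= big -> nrm (S lam v) <= M * nrm v.
  move=> lamA; have /andP[la _] := lamA.
  by have := bM _ lamA (S lam v); rewrite (SP _ la v).2.
exists (fun lam v => - (lam *: S lam v)); split.
  move=> lam v /andP[la _]; rewrite /dyadic_pow expn0 !expr1 /=.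
  have lam0 : lam != 0 by rewrite -normc_gt0 (lt_le_trans r0).
  split.
    have := (SP _ la (- (lam^-1 *: v))).1.
    rewrite linearN linearZ /= scalerN scalerA divff// scale1r opprK addrC => ->.
    by rewrite scalerN opprK scalerA divff// scale1r.
  have -> : T (- (lam *: S lam v)) = lam *: (- T (S lam v)).
    by rewrite linearN linearZ scalerN.
  rewrite [lam^-1 *: _]scalerA mulVf// scale1r opprK addrC.
  exact: (SP _ la v).2.
move=> z s t v z1 sA tA.
have nsz (r : R) : rho1 <= r <= big -> rho1 <= normc (r%:C * z)%C <= big.
  move=> rA; rewrite normcM z1 mulr1 normc_real ger0_norm//.
  by case/andP: rA => h _; rewrite (le_trans (ltW r0)).
have sz := nsz _ sA; have tz := nsz _ tA; have /andP[sz1 sz2] := sz.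
have /andP[tz1 tz2] := tz.
set l := (s%:C * z)%C in sz sz1 sz2 *; set m := (t%:C * z)%C in tz tz1 tz2 *.
have lm : normc (l - m) = `|s - t|.
  by rewrite /l /m -mulrBl normcM z1 mulr1 -rmorphB normc_real.
have res_id : S l v - S m v = S l ((l - m) *: S m v).
  rewrite -[LHS](SP _ sz1 _).1; congr (S l _).
  rewrite linearB scalerBr opprB addrACA.
  rewrite -[X in _ + X + _]opprK.
  have e1 := (SP _ sz1 v).2; have e2 := (SP _ tz1 v).2.
  rewrite [T (S l v)](_ : _ = v + l *: S l v); last by rewrite -{2}e1 subrK.
  rewrite [T (S m v)](_ : _ = v + m *: S m v); last by rewrite -{2}e2 subrK.
  rewrite scalerBl !opprD !addrA !opprK.
  by rewrite -(addrA v) (addrC v) addrK addrAC (addrC (l *: S l v)) addrK.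
rewrite opprK addrC.
have -> : m *: S m v - l *: S l v = - ((l - m) *: S l v) - m *: (S l v - S m v).
  by rewrite scalerBl scalerBr !opprB [RHS]addrC addrA subrK.
apply: le_trans (nrmB _ _) _; rewrite nrmN !nrmZ lm.
have b1 := Sb _ v sz; have b2 := Sb _ ((l - m) *: S m v) sz.
have b3 := Sb _ v tz.
rewrite -res_id nrmZ lm in b2.
have b4 : nrm (S l v - S m v) <= M * (`|s - t| * (M * nrm v)).
  by apply: le_trans b2 _; rewrite ler_wpM2l// ler_wpM2l.
have b5 := ler_wpM2l (normc_ge0 m) b4.
have b6 : normc m * (M * (`|s - t| * (M * nrm v))) <= big * (M * (`|s - t| * (M * nrm v))).
  by rewrite ler_wpM2r// !mulr_ge0.
have b7 := ler_wpM2l (normr_ge0 (s - t)) b1.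
apply: le_trans (lerD b7 (le_trans b5 b6)) _.
by rewrite le_eqVlt; apply/orP; left; apply/eqP; ring.
Qed.

(** One exponent p = 2^m is taken so large that (rho1 / rho2)^p absorbs the factor 3. Then T^p is
    bounded by rho2^p with constant 1, a bound that iterates freely; C pays for the remainder modulo
    p. *)
Lemma power_bound (K rho1 rho2 : R) : 0 < rho1 < rho2 ->
  (forall v, nrm (T v) <= K * nrm v) ->
  (forall lam, rho1 <= normc lam -> resolvent_on T setT lam) ->
  exists2 C, 0 <= C & forall n v, nrm (iter n T v) <= C * rho2 ^+ n * nrm v.
Proof.
move=> /andP[r10 r12] TK0 res.
pose s := Num.max K rho1; pose big := s + 1.
have rs : rho1 <= s by rewrite le_max lexx orbT.
have s0 : 0 < s by apply: lt_le_trans rs.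
have TK v : nrm (T v) <= s * nrm v.
  by rewrite (le_trans (TK0 v))// ler_wpM2r// le_max lexx.
have [M [M0 bM]] := @bounded_below_annulus _ _ T rho1 big
  (fun lam h => resolvent_bounded_below (res lam h)).
have base := dyadic_inverse0 r10 _ M0 res bM.
have {}base := base (ltac:(by rewrite (le_trans rs)// lerDl)).
have L0 : 0 <= M + big * M ^+ 2.
  by rewrite addr_ge0// mulr_ge0 ?exprn_ge0// addr_ge0// ltW.
(* The descent starts from the norm bound itself. *)
have bs : dyadic_bound T s.
  exists 0%N => m _ v; rewrite (le_trans (iter_bound _ (ltW s0) TK _))//.
  rewrite ler_wpM2r//; have : 0 <= s ^+ (2 ^ m) by rewrite exprn_ge0// ltW.
  lra.
have [m0 bm] := dyadic_bound_chain r10 L0 base rs (ltac:(by rewrite ltrDl)) bs.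
have r20 : 0 < rho2 by apply: lt_trans r12.
have q1 : 0 <= rho1 / rho2 < 1.
  by rewrite divr_ge0 ?(ltW r10) ?(ltW r20)//= ltr_pdivrMr// mul1r.
have [n0 hn] := expn_decay q1 (ltac:(by rewrite invr_gt0) : 0 < 3^-1).
pose p := (2 ^ (maxn m0 n0))%N.
have p0 : (0 < p)%N by rewrite expn_gt0.
have pb v : nrm (iter p T v) <= rho2 ^+ p * nrm v.
  apply: le_trans (bm _ (leq_maxl _ _) v) _; rewrite ler_wpM2r//.
  have : (rho1 / rho2) ^+ p <= 3^-1.
    by apply: hn; rewrite (leq_trans (leq_maxr m0 n0))// ltnW// ltn_expl.
  rewrite exprMn exprVn ler_pdivrMr ?exprn_gt0//; lra.
pose C := \sum_(r < p) (s / rho2) ^+ r.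
have C0 : 0 <= C.
  by apply: sumr_ge0 => i _; rewrite exprn_ge0// divr_ge0 ?(ltW s0) ?(ltW r20).
exists C => // n.
elim/ltn_ind: n => n IHn v; have [np|pn] := ltnP n p.
  apply: le_trans (iter_bound _ (ltW s0) TK _) _; rewrite ler_wpM2r//.
  rewrite -ler_pdivrMr ?exprn_gt0// -exprVn -exprMn.
  rewrite /C (bigD1 (Ordinal np))//= lerDl.
  by apply: sumr_ge0 => i _; rewrite exprn_ge0// divr_ge0 ?(ltW s0) ?(ltW r20).
rewrite -(subnK pn) addnC iterD exprD.
have h1 := pb (iter (n - p) T v).
have h2 := IHn (n - p)%N (ltac:(by rewrite ltn_subrL p0 (leq_trans p0))) v.
apply: le_trans h1 _.
have h3 := ler_wpM2l (exprn_ge0 p (ltW r20)) h2.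
by apply: le_trans h3 _; rewrite le_eqVlt; apply/orP; left; apply/eqP; ring.
Qed.

End power_bound.

(** * Neumann series and resolvents on invariant subspaces *)

Section neumann.
Context (R : realType) (V : completeNormedModType R[i]).
Variable T : {linear V -> V}.
Implicit Types (u v w : V) (lam : R[i]) (H : set V).

Lemma complex_gt0 (e : R[i]) : 0 < e -> exists2 r : R, 0 < r & e = r%:C%C.
Proof.
by case: e => a b; rewrite ltcE/= => /andP[/eqP-> a0]; exists a.
Qed.

Lemma cvg_nrm (u_ : nat -> V) u :
  (u_ n @[n --> \oo] --> u) <->
  (forall e : R, 0 < e -> exists n0, forall n, (n0 <= n)%N -> nrm (u - u_ n) <= e).
Proof.
split=> [/cvgrPdist_le h e e0|h].
  have e0' : 0 < e%:C%C by rewrite -[0]/((0 : R)%:C%C) ltcR.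
  have [n0 _ hn] := h _ e0'; exists n0 => n nn.
  by have := hn n nn; rewrite nrmE lecR.
apply/cvgrPdist_le => e /complex_gt0[r r0 ->].
by have [n0 hn] := h r r0; exists n0 => // n nn; rewrite /= nrmE lecR; exact: hn.
Qed.

Lemma geometric_cvg (u_ : nat -> V) (q C : R) : 0 <= q < 1 ->
  (forall n, nrm (u_ n.+1 - u_ n) <= C * q ^+ n) ->
  exists u, u_ n @[n --> \oo] --> u.
Proof.
move=> /andP[q0 q1] hu.
have C0 : 0 <= C.
  by have := hu 0%N; rewrite expr0 mulr1; apply: le_trans.
have tail n k : (1 - q) * nrm (u_ (n + k)%N - u_ n) <= C * q ^+ n.
  suff : (1 - q) * nrm (u_ (n + k)%N - u_ n) <= C * q ^+ n - C * q ^+ (n + k).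
    by move=> h; apply: le_trans h _; rewrite lerBlDr lerDl mulr_ge0// exprn_ge0.
  elim: k => [|k IHk]; first by rewrite addn0 !subrr nrm0 mulr0.
  have h1 := nrm_triangle (u_ (n + k)%N) (u_ (n + k.+1)%N) (u_ n).
  have h2 := hu (n + k)%N; rewrite -addnS in h2.
  rewrite addnS exprS -addnS.
  have h3 : (1 - q) * nrm (u_ (n + k.+1)%N - u_ (n + k)%N) <= (1 - q) * (C * q ^+ (n + k)).
    by rewrite ler_wpM2l// subr_ge0 ltW.
  have h4 : (1 - q) * nrm (u_ (n + k.+1)%N - u_ n) <=
     (1 - q) * (nrm (u_ (n + k.+1)%N - u_ (n + k)%N) + nrm (u_ (n + k)%N - u_ n)).
    by rewrite ler_wpM2l// subr_ge0 ltW.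
  lra.
have q1' : 0 < 1 - q by rewrite subr_gt0.
have cv : cvg (u_ n @[n --> \oo]).
  apply: cauchy_cvg; apply: cauchy_exP => e /complex_gt0[r r0 ->].
  have h : 0 < r * (1 - q) / (C + 1) by rewrite divr_gt0 ?mulr_gt0// ltr_wpDl.
  have q01 : 0 <= q < 1 by rewrite q0.
  have h' : 0 < r * (1 - q) / (C + 1) / 2 by rewrite divr_gt0.
  have [n0 hn] := expn_decay q01 h'.
  exists (u_ n0), n0 => // n /= nn.
  rewrite -ball_normE /= nrmE ltcR nrm_distC -(subnKC nn).
  have := tail n0 (n - n0)%N; have := hn _ (leqnn n0).
  set y := nrm _; move=> h1 h2.
  have h3 : C * q ^+ n0 <= (C + 1) * (r * (1 - q) / (C + 1) / 2).
    by apply: (ler_pM C0 (exprn_ge0 _ q0) _ h1); rewrite lerDl.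
  have h4 : (C + 1) * (r * (1 - q) / (C + 1) / 2) = r * (1 - q) / 2.
    by field; rewrite gt_eqF// ltr_wpDl.
  have h5 : (1 - q) * y <= (1 - q) * (r / 2).
    rewrite (le_trans h2)// (le_trans h3)// h4; lra.
  move: h5; rewrite ler_pM2l// => h5; apply: le_lt_trans h5 _; lra.
by exists (limn u_).
Qed.

(** This bounds the spectrum, so that the [sup] in [spectral_radius_on] does bound its elements. The
    preimage of v is the fixed point of the contraction u |-> (T u - v) / lam; H being closed, the
    limit of the iterates stays in H. *)
Lemma resolvent_large (K : R) H lam : (forall v, nrm (T v) <= K * nrm v) ->
  linear_subspace H -> closed H -> Defs.invariant T H -> Num.max K 0 < normc lam ->
  resolvent_on T H lam.
Proof.
move=> TK0 [H0 HL] cH TH; set k := Num.max K 0 => kl.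
have k0 : 0 <= k by rewrite le_max lexx orbT.
have TK v : nrm (T v) <= k * nrm v.
  by rewrite (le_trans (TK0 v))// ler_wpM2r// le_max lexx.
have nl0 : 0 < normc lam by apply: le_lt_trans kl.
have l0 : lam != 0 by rewrite -normc_gt0.
have below v : (normc lam - k) * nrm v <= nrm (T v - lam *: v).
  have := nrm_triangle (T v) (lam *: v) 0; rewrite !subr0 nrmZ nrm_distC.
  have := TK v; lra.
have HB u v : H u -> H v -> H (u - v).
  by move=> Hu Hv; have := HL (-1) v u Hv Hu; rewrite scaleN1r addrC.
have HZ c u : H u -> H (c *: u).
  by move=> Hu; have := HL c u 0 Hu H0; rewrite addr0.
have ex v : exists u, H v -> H u /\ T u - lam *: u = v.
  have [Hv|] := pselect (H v); last by exists 0.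
  pose u_ n := iter n (fun u => lam^-1 *: (T u - v)) 0.
  have Hu n : H (u_ n) by elim: n => //= n Hn; apply: HZ; apply: HB => //; exact: TH.
  have step n : nrm (u_ n.+2 - u_ n.+1) <= k / normc lam * nrm (u_ n.+1 - u_ n).
    rewrite /= -scalerBr nrmZ opprB addrA subrK -linearB normcV.
    by rewrite [k / _]mulrC -mulrA ler_wpM2l// invr_ge0 ltW.
  have q1 : 0 <= k / normc lam < 1.
    by rewrite divr_ge0 ?(ltW nl0)//= ltr_pdivrMr// mul1r.
  have [u uu] : exists u, u_ n @[n --> \oo] --> u.
    apply: (@geometric_cvg u_ (k / normc lam) (nrm (u_ 1%N - u_ 0%N))) => //.
    elim=> [|n IHn]; first by rewrite expr0 mulr1.
    rewrite (le_trans (step n))// exprS mulrCA ler_wpM2l//.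
    by case/andP: q1.
  exists u => _; split; first by apply: (closed_cvg H cH _ _ uu); exact: nearW.
  apply/eqP; rewrite -subr_eq0; apply/eqP/nrm_eq0/eqP; rewrite eq_le nrm_ge0 andbT.
  apply/ler_addgt0Pr => e e0; rewrite add0r.
  have /cvg_nrm un := uu.
  have d0 : 0 < e / (k + normc lam) by rewrite divr_gt0// ltr_wpDl.
  have [n0 hn] := un _ d0.
  have -> : T u - lam *: u - v = T (u - u_ n0) - lam *: (u - u_ n0.+1).
    rewrite linearB scalerBr /= scalerA divff// scale1r opprB addrA.
    by rewrite (addrA (T u - _)) subrK addrAC.
  apply: le_trans (nrmB _ _) _; rewrite nrmZ.
  have h1 := ler_wpM2l k0 (hn n0 (leqnn _)).
  have h2 := ler_wpM2l (ltW nl0) (hn n0.+1 (leqnSn _)).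
  apply: le_trans (lerD (le_trans (TK _) h1) h2) _.
  by rewrite -mulrDl mulrCA divff ?mulr1// gt_eqF// ltr_wpDl.
have [S SP] := choice ex.
have uniqS u v : T u - lam *: u = T v - lam *: v -> u = v.
  move=> uv; apply/eqP; rewrite -subr_eq0; apply/eqP/nrm_eq0/eqP.
  rewrite eq_le nrm_ge0 andbT; have := below (u - v).
  rewrite linearB scalerBr !opprD !opprK addrACA -[- T v + _]opprK opprD opprK uv subrr.
  by rewrite nrm0 pmulr_rle0// subr_gt0.
exists S; split.
- by move=> v /SP[].
- move=> a u v Hu Hv; apply: uniqS.
  rewrite (SP _ (HL a u v Hu Hv)).2 linearP scalerDr scalerA [lam * a]mulrC -scalerA.
  by rewrite opprD addrACA -scalerBr (SP _ Hu).2 (SP _ Hv).2.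
- apply: (@nrm_boundE _ _ H S (normc lam - k)^-1) => v Hv.
  rewrite ler_pdivlMl ?subr_gt0//; apply: le_trans (below _) _.
  by rewrite (SP _ Hv).2.
- move=> v Hv; have Hw : H (T v - lam *: v) by apply: HB; [exact: TH|exact: HZ].
  by apply: uniqS; rewrite (SP _ Hw).2.
- by move=> v /SP[].
Qed.

Lemma resolvent_on_radius (K : R) H r lam : (forall v, nrm (T v) <= K * nrm v) ->
  linear_subspace H -> closed H -> Defs.invariant T H ->
  spectral_radius_on T H < r -> r <= normc lam -> resolvent_on T H lam.
Proof.
move=> TK LH cH TH sr rl; apply: contrapT => nres.
have : normc lam <= spectral_radius_on T H.
  apply: ub_le_sup; last by exists lam.
  exists (Num.max K 0) => _ [mu mus <-]; rewrite leNgt; apply/negP => h.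
  by apply: mus; exact: resolvent_large TK _ _ _ h.
by rewrite leNgt (lt_le_trans sr).
Qed.

Lemma spectral_radius_ge0 H : 0 <= spectral_radius_on T H.
Proof.
rewrite /spectral_radius_on; set A := [set normc _ | _ in _].
(* For an empty or unbounded set, [sup] takes its default value 0. *)
have [[[y Ay] Au]|nA] := pselect (has_sup A); last by rewrite sup_out.
have [z _ zy] := Ay.
by rewrite (le_trans _ (ub_le_sup Au Ay))// -zy normc_ge0.
Qed.

Lemma spectral_radius_le H r : 0 <= r ->
  (forall lam, r < normc lam -> resolvent_on T H lam) -> spectral_radius_on T H <= r.
Proof.
move=> r0 res; rewrite /spectral_radius_on; set A := [set normc _ | _ in _].
have [hA|nA] := pselect (has_sup A); last by rewrite sup_out.
apply: ge_sup; first by case: hA.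
move=> _ [lam lams <-]; rewrite leNgt; apply/negP => /res; exact: lams.
Qed.

(** Resolvents on two invariant pieces add up, through the projections a and b, to a resolvent on
    their sum; Ka and Kb bound it. C need not be the whole space: it is also used for the kernel of
    the spectral projection. *)
Lemma resolvent_on_split (N : {linear V -> V}) (C A B : set V) (a b : V -> V) Ka Kb lam :
  A `<=` C -> B `<=` C -> (forall (c : R[i]) u v, C u -> C v -> C (c *: u + v)) ->
  linear a -> linear b ->
  (forall v, nrm (a v) <= Ka * nrm v) -> (forall v, nrm (b v) <= Kb * nrm v) ->
  (forall v, C v -> [/\ C (N v), A (a v), B (b v) & a v + b v = v]) ->
  (forall v, C v -> N (a v) = a (N v)) -> (forall v, C v -> N (b v) = b (N v)) ->
  resolvent_on N A lam -> resolvent_on N B lam -> resolvent_on N C lam.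
Proof.
move=> AC BC CL al bl aK bK dec Na Nb [S [SA SL [M SM] S1 S2]] [U [UB UL [M' UM] U1 U2]].
have CZ c u : C u -> C (c *: u).
  move=> Cu; have := CL (c - 1) u u Cu Cu; by rewrite scalerBl scale1r subrK.
have aZ c u v : a (c *: u + v) = c *: a u + a v by exact: al.
have bZ c u v : b (c *: u + v) = c *: b u + b v by exact: bl.
exists (fun v => S (a v) + U (b v)); split.
- move=> v /dec[_ /SA/AC h1 /UB/BC h2 _].
  by have := CL 1 _ _ h1 h2; rewrite scale1r.
- move=> c u v /dec[_ Au Bu _] /dec[_ Av Bv _].
  by rewrite aZ bZ SL// UL// scalerDr addrACA.
- apply: (@nrm_boundE _ _ C _ (normc M * Ka + normc M' * Kb)) => v /dec[_ Av Bv _].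
  rewrite (le_trans (nrmD _ _))// mulrDl -!mulrA lerD//.
    by rewrite (le_trans (nrm_boundP SM Av))// ler_wpM2l// normc_ge0.
  by rewrite (le_trans (nrm_boundP UM Bv))// ler_wpM2l// normc_ge0.
- move=> v Cv; have [CNv Av Bv ab] := dec v Cv.
  rewrite -[T in _ = T]ab [N v - _]addrC -scaleNr aZ bZ -Na// -Nb//.
  rewrite !scaleNr ![- _ + _]addrC S1// U1//.
- move=> v Cv; have [CNv Av Bv ab] := dec v Cv.
  by rewrite linearD scalerDr opprD addrACA S2// U2.
Qed.

Lemma resolvent_on_eq (N : {linear V -> V}) (A : set V) lam :
  (forall v, A v -> N v = T v) -> (forall v, A v -> A (T v)) ->
  resolvent_on T A lam -> resolvent_on N A lam.
Proof.
move=> NT TA [S [SA SL SM S1 S2]]; exists S; split => // v Av.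
  by rewrite NT// S1.
by rewrite NT ?S2//; exact: SA.
Qed.

Lemma resolvent_on_zero (A : set V) lam : lam != 0 ->
  (forall c v, A v -> A (c *: v)) -> (forall v, A v -> T v = 0) ->
  resolvent_on T A lam.
Proof.
move=> l0 AZ T0; exists (fun v => - (lam^-1 *: v)); split.
- by move=> v Av; rewrite -scaleNr; exact: AZ.
- by move=> a u v _ _; rewrite scalerDr opprD scalerN !scalerA mulrC.
- apply: (@nrm_boundE _ _ A _ (normc lam^-1)) => v _.
  by rewrite nrmN nrmZ.
- by move=> v Av; rewrite T0// sub0r scalerN opprK scalerA mulVf// scale1r.
- move=> v Av; rewrite T0 -?scaleNr; last exact: AZ.
  by rewrite add0r scalerA mulrNN divff// scale1r.
Qed.

End neumann.

(** * Spectral splittings *)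

Section polynomial_action.
Context (R : realType) (V : completeNormedModType R[i]).
Variable T : {linear V -> V}.
Implicit Types (p q : {poly R[i]}) (u v w : V) (lam : R[i]) (H : set V).

(** This is p(T), kept as a map on vectors. It is multiplicative in p ([actM]), so that operators of
    this form commute with one another. *)
Definition act p v : V := \sum_(i < size p) p`_i *: iter i T v.

Lemma actE n p v : (size p <= n)%N -> act p v = \sum_(i < n) p`_i *: iter i T v.
Proof.
move=> pn; rewrite /act (big_ord_widen n (fun i => p`_i *: iter i T v))//.
rewrite big_mkcond; apply: eq_bigr => i _; case: ltnP => // h.
by rewrite nth_default// scale0r.
Qed.

Lemma act_linear p : linear (act p).
Proof.
move=> c u v; rewrite /act scaler_sumr -big_split; apply: eq_bigr => i _ /=.
by rewrite iter_linear scalerDr !scalerA mulrC.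
Qed.

HB.instance Definition _ p :=
  GRing.isLinear.Build R[i] V V *:%R (act p) (act_linear p).

Lemma act_poly0 v : act 0 v = 0.
Proof. by rewrite /act size_poly0 big_ord0. Qed.

Lemma actC c v : act c%:P v = c *: v.
Proof. by rewrite (@actE 1) ?size_polyC_leq1// big_ord1 coefC. Qed.

Lemma act1 v : act 1 v = v.
Proof. by rewrite actC scale1r. Qed.

Lemma actD p q v : act (p + q) v = act p v + act q v.
Proof.
pose n := maxn (size p) (size q).
rewrite (@actE n (p + q)) ?size_polyD// (@actE n p) ?leq_maxl// (@actE n q) ?leq_maxr//.
by rewrite -big_split; apply: eq_bigr => i _; rewrite coefD scalerDl.
Qed.

Lemma actZ c p v : act (c *: p) v = c *: act p v.
Proof.
rewrite (@actE (size p)) ?size_scale_leq// /act scaler_sumr.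
by apply: eq_bigr => i _; rewrite coefZ scalerA.
Qed.

Lemma actMX p v : act (p * 'X) v = T (act p v).
Proof.
have [->|p0] := eqVneq p 0; first by rewrite mul0r act_poly0 linear0.
rewrite (@actE (size p).+1) ?size_mulX// big_ord_recl coefMX eqxx scale0r add0r.
rewrite /act linear_sum; apply: eq_bigr => i _.
by rewrite coefMX/= linearZ.
Qed.

Lemma act_cons p c v : act (p * 'X + c%:P) v = T (act p v) + c *: v.
Proof. by rewrite actD actMX actC. Qed.

Lemma actM p q v : act (p * q) v = act p (act q v).
Proof.
elim/poly_ind: p => [|p c IHp]; first by rewrite mul0r !act_poly0.
by rewrite mulrDl actD mulrAC actMX IHp mul_polyC actZ act_cons.
Qed.

Lemma actXsubC lam v : act ('X - lam%:P) v = T v - lam *: v.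
Proof. by rewrite -[X in X - _]mul1r -polyCN act_cons act1 scaleNr. Qed.

Lemma act_subspace H p v : linear_subspace H -> Defs.invariant T H -> H v -> H (act p v).
Proof.
move=> [H0 HL] TH Hv; elim/poly_ind: p => [|p c IHp]; first by rewrite act_poly0.
by rewrite act_cons addrC; apply: HL => //; exact: TH.
Qed.

Lemma act_eigen p lam v : T v = lam *: v -> act p v = p.[lam] *: v.
Proof.
move=> Tv; elim/poly_ind: p => [|p c IHp]; first by rewrite act_poly0 horner0 scale0r.
by rewrite act_cons IHp linearZ /= Tv scalerA !hornerE scalerDl.
Qed.

Lemma act_commT p v : act p (T v) = T (act p v).
Proof.
have TX w : T w = act 'X w by rewrite -['X]mul1r actMX act1.
by rewrite !TX -!actM mulrC.
Qed.

Lemma act_bounded p (K : R) : (forall v, nrm (T v) <= K * nrm v) ->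
  exists C, forall v, nrm (act p v) <= C * nrm v.
Proof.
move=> TK0; have TK v : nrm (T v) <= Num.max K 0 * nrm v.
  by rewrite (le_trans (TK0 v))// ler_wpM2r// le_max lexx.
elim/poly_ind: p => [|p c [C IHp]]; first by exists 0 => v; rewrite act_poly0 nrm0 mul0r.
exists (Num.max K 0 * C + normc c) => v; rewrite act_cons (le_trans (nrmD _ _))//.
rewrite nrmZ mulrDl lerD2r (le_trans (TK _))// -mulrA ler_wpM2l//.
by rewrite le_max lexx orbT.
Qed.

(* q(X) - q(lam) = s(X) (X - lam), so - s(T) / q(lam) inverts T - lam where
   q(T) = 0. *)
Lemma resolvent_on_kernel (K : R) (A : set V) q lam : (forall v, nrm (T v) <= K * nrm v) ->
  linear_subspace A -> Defs.invariant T A -> (forall v, A v -> act q v = 0) ->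
  q.[lam] != 0 ->
  exists s, resolvent_on T A lam /\
    forall v, A v -> [/\ A (act s v), act s (T v - lam *: v) = v &
      T (act s v) - lam *: act s v = v].
Proof.
move=> TK LA TA Aq ql.
have /factor_theorem[t qt] : root (q - q.[lam]%:P) lam.
  by rewrite /root !hornerE subrr.
pose s := (- q.[lam]^-1) *: t.
have sP v : A v -> act (s * ('X - lam%:P)) v = v.
  move=> Av; rewrite -scalerAl actZ -qt actD -polyCN actC Aq// add0r.
  by rewrite scalerA mulrNN mulVf// scale1r.
have sP1 v : A v -> act s (T v - lam *: v) = v.
  by move=> Av; rewrite -actXsubC -actM sP.
have sP2 v : A v -> T (act s v) - lam *: act s v = v.
  by move=> Av; rewrite -actXsubC -actM mulrC sP.
have sA v : A v -> A (act s v) by exact: act_subspace.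
exists s; split=> [|v Av]; last by split; [exact: sA|exact: sP1|exact: sP2].
have [C sC] := act_bounded s TK.
exists (act s); split => //; first by move=> a u v _ _; rewrite linearP.
exact: (@nrm_boundE _ _ A _ C).
Qed.

(** Cayley-Hamilton for a matrix A of T in the spanning family, which may be dependent: only T e_i =
    sum_j A_ij e_j matters. The characteristic polynomial splits over R[i]. The empty family is
    treated apart, square matrices forming a ring in positive size. *)
Lemma annihilating_roots H : finite_dim H -> Defs.invariant T H ->
  exists s : seq R[i], forall v, H v -> act (\prod_(z <- s) ('X - z%:P)) v = 0.
Proof.
move=> [[|n] [e He]] TH.
  exists [::] => v; rewrite He big_nil act1 => -[c _ <-].
  by rewrite big_ord0.
have eH i : H (e i).
  rewrite He; exists (fun j => (j == i)%:R) => //.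
  rewrite (bigD1 i)//= eqxx scale1r big1 ?addr0// => j /negPf->.
  by rewrite scale0r.
have : forall i, exists c : 'I_n.+1 -> R[i], T (e i) = \sum_j c j *: e j.
  by move=> i; have := TH _ (eH i); rewrite {1}He => -[c _ <-]; exists c.
move=> /choice[a Ta]; pose A : 'M[R[i]]_n.+1 := \matrix_(i, j) a i j.
have actA p i : act p (e i) = \sum_j (horner_mx A p) i j *: e j.
  elim/poly_ind: p i => [|p c IHp] i.
    by rewrite act_poly0 big1// => j _; rewrite rmorph0 mxE scale0r.
  rewrite act_cons IHp linear_sum /=.
  rewrite rmorphD rmorphM /= horner_mx_X horner_mx_C.
  under eq_bigr do rewrite linearZ /= Ta scaler_sumr.
  rewrite exchange_big /=.
  have -> : c *: e i = \sum_j ((c%:M : 'M[R[i]]_n.+1) i j) *: e j.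
    rewrite (bigD1 i)//= mxE eqxx mulr1n big1 ?addr0// => j /negPf ji.
    by rewrite mxE eq_sym ji mulr0n scale0r.
  rewrite -big_split; apply: eq_bigr => j _ /=.
  rewrite -[(_ * A + _)%R]/((horner_mx A p *m A + c%:M)%R) [in RHS]mxE [in RHS]mxE scalerDl scaler_suml.
  congr (_ + _); apply: eq_bigr => k _.
  by rewrite scalerA mxE.
have [s ps] := closed_field_poly_normal (char_poly A).
have ms : char_poly A = \prod_(z <- s) ('X - z%:P).
  by rewrite [LHS]ps (eqP (char_poly_monic A)) scale1r.
exists s => v; rewrite He => -[c _ <-].
rewrite linear_sum big1// => i _; rewrite linearZ /= -ms actA big1 ?scaler0// => j _.
by rewrite Cayley_Hamilton mxE scale0r.
Qed.

(** When z is not an eigenvalue on H, T - z is injective there and its factor can be cancelled. *)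
Lemma annihilating_roots_eigen H (P : pred R[i]) (s : seq R[i]) :
  linear_subspace H -> Defs.invariant T H ->
  (forall lam, eigenvalue_on T H lam -> P lam) ->
  (forall v, H v -> act (\prod_(z <- s) ('X - z%:P)) v = 0) ->
  forall v, H v -> act (\prod_(z <- s | P z) ('X - z%:P)) v = 0.
Proof.
move=> LH TH HP.
(* The prefix p collects the factors already kept, which lets the induction run through the list. *)
suff : forall p, (forall v, H v -> act (p * \prod_(z <- s) ('X - z%:P)) v = 0) ->
  forall v, H v -> act (p * \prod_(z <- s | P z) ('X - z%:P)) v = 0.
  by move=> h h' v Hv; have := h 1; rewrite !mul1r; exact.
elim: s => [p h v Hv|z s IHs p h v Hv]; first by have := h v Hv; rewrite !big_nil.
rewrite big_cons; case: ifPn => Pz.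
  by rewrite mulrA; apply: IHs => // w Hw; rewrite -mulrA; have := h w Hw; rewrite big_cons.
apply: IHs => // w Hw; have hw := h w Hw.
rewrite big_cons mulrCA actM actXsubC in hw; move: hw.
set x := act _ w => /eqP; rewrite subr_eq0 => /eqP Tx.
apply/eqP/negPn/negP => x0; move/negP: Pz; apply; apply: HP.
by exists x; split => //; exact: act_subspace.
Qed.

(** The bounded inverses of the factors compose. The use is to recover the H-component of a vector
    from q(T) v when q(T) kills the other component, and so to bound the projections. *)
Lemma act_prod_inverse (H : set V) (s : seq R[i]) :
  linear_subspace H -> Defs.invariant T H ->
  (forall z, z \in s -> resolvent_on T H z) ->
  exists (S : V -> V) (M : R), [/\ forall v, H v -> H (S v),
    forall v, H v -> nrm (S v) <= M * nrm v &
    forall v, H v -> S (act (\prod_(z <- s) ('X - z%:P)) v) = v].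
Proof.
move=> LH TH; elim: s => [_|z s IHs hs].
  exists id, 1; split => // v _; first by rewrite mul1r.
  by rewrite big_nil act1.
have [|S [M [SH SM SP]]] := IHs; first by move=> y ys; apply: hs; rewrite inE ys orbT.
have [U [UH _ [M' UM] U1 _]] := hs z (mem_head _ _).
exists (U \o S), (normc M' * M); split=> [v Hv|v Hv|v Hv] /=.
- exact/UH/SH.
- rewrite (le_trans (nrm_boundP UM (SH _ Hv)))// -mulrA ler_wpM2l ?normc_ge0//.
  exact: SM.
rewrite big_cons mulrC actM SP.
  by rewrite actXsubC U1.
exact: act_subspace.
Qed.

End polynomial_action.

(** * Spectral projection and two-sided growth estimates *)

Section spectral_gap.
Context (R : realType) (V : completeNormedModType R[i]).
Variables (T : {linear V -> V}) (K rho : R).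
Hypothesis TK : forall v, nrm (T v) <= K * nrm v.
Implicit Types (p q : {poly R[i]}) (u v w : V) (lam : R[i]) (F H : set V).

Lemma linear_bundle (f : V -> V) : linear f -> exists g : {linear V -> V}, g =1 f.
Proof.
move=> fl; pose g : {linear V -> V} := HB.pack f (GRing.isLinear.Build R[i] V V *:%R f fl).
by exists g.
Qed.

(** The set under the [inf] also contains the spectral radius itself; rho < r(T) rules this element
    out. *)
Lemma ess_spectral_radius_splitting :
  ess_spectral_radius T < rho -> rho < spectral_radius T ->
  exists rho0, 0 <= rho0 < rho /\ spectral_splitting T rho0.
Proof.
move=> er rr; have [|x [->|[x0 Sx]] xr] := inf_lt _ er.
- by exists (spectral_radius T); left.
- by move: xr; rewrite ltNge ltW.
- by exists x; rewrite x0 xr.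
Qed.

Lemma coprime_prod_XsubC (s1 s2 : seq R[i]) : (forall z, z \in s1 -> z \notin s2) ->
  coprimep (\prod_(z <- s1) ('X - z%:P)) (\prod_(z <- s2) ('X - z%:P)).
Proof.
move=> h; have {h} : forall z, z \in s2 -> z \notin s1.
  by move=> z z2; apply/negP => /h; rewrite z2.
elim: s2 => [_|z s2 IHs h]; first by rewrite big_nil coprimep1.
rewrite big_cons coprimepMr coprimep_XsubC root_prod_XsubC h ?mem_head//=.
by apply: IHs => y ys; apply: h; rewrite inE ys orbT.
Qed.

Lemma normc_lt_seq (s : seq R[i]) r0 : r0 < rho -> (forall z, z \in s -> normc z < rho) ->
  exists r1, r0 < r1 < rho /\ forall z, z \in s -> normc z < r1.
Proof.
move=> r0r; elim: s => [_|z s IHs h].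
  by exists ((r0 + rho) / 2); split => //; lra.
have [|r1 [/andP[r01 r1r] Hs]] := IHs; first by move=> y ys; apply: h; rewrite inE ys orbT.
have zr := h z (mem_head _ _).
have mr : Num.max r1 (normc z) < rho by rewrite gt_max r1r zr.
exists ((Num.max r1 (normc z) + rho) / 2).
have m1 : r1 <= Num.max r1 (normc z) by rewrite le_max lexx.
have m2 : normc z <= Num.max r1 (normc z) by rewrite le_max lexx orbT.
split; first by apply/andP; split; lra.
move=> y; rewrite inE => /orP[/eqP->|/Hs]; lra.
Qed.

Definition bounded_projection (P : V -> V) :=
  [/\ forall v, P (P v) = P v, forall v, P (T v) = T (P v) &
    exists C, forall v, nrm (P v) <= C * nrm v].

(** On F the annihilating polynomial is q1 q2, with the roots of modulus at least rho in q1. P is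
    the Bezout idempotent (u2 q2)(T) after the projection onto F; its kernel is H plus the part of F
    killed by q2(T), where the resolvent exists outside a disc of radius r1 < rho. *)
Lemma splitting_projection rho0 : rho0 < rho -> spectral_splitting T rho0 ->
  exists P : {linear V -> V}, [/\ bounded_projection P,
    finite_dim (range (T \o P)),
    exists n (e : 'I_n -> V), forall v, exists c, P v = \sum_i c i *: e i,
    exists q, (forall v, act T q (P v) = 0) /\ (forall z, root q z -> rho <= normc z) &
    exists2 r1, 0 < r1 < rho & forall lam, r1 <= normc lam ->
      resolvent_on T [set v | P v = 0] lam].
Proof.
move=> r0r [F [H [[LF LH [dec FH]] [TF TH] [cH sH] fF Feig]]].
have rho0_gt0 : 0 < rho0 by apply: le_lt_trans sH; exact: spectral_radius_ge0.
have [F0 FL] := LF; have [H0 HL] := LH.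
have FB f f' : F f -> F f' -> F (f - f').
  by move=> h h'; have := FL (-1) f' f h' h; rewrite scaleN1r addrC.
have HB f f' : H f -> H f' -> H (f - f').
  by move=> h h'; have := HL (-1) f' f h' h; rewrite scaleN1r addrC.
have uniq f f' h h' : F f -> F f' -> H h -> H h' -> f + h = f' + h' -> f = f' /\ h = h'.
  move=> Ff Ff' Hh Hh' e.
  have e1 : f - f' = h' - h.
    by rewrite -[f](addrK h) e (addrAC _ (- h)) (addrC f') addrK.
  have z : f - f' = 0.
    have : (F `&` H) (f - f') by split; [exact: FB|rewrite e1; exact: HB].
    by rewrite FH.
  by split; apply/eqP; rewrite -subr_eq0 ?z// -opprB -e1 z oppr0.
have : forall v, exists fh : V * V, [/\ F fh.1, H fh.2 & v = fh.1 + fh.2].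
  by move=> v; have [f [h [? ? ?]]] := dec v; exists (f, h).
move=> /choice[g Hg].
have pE v f h : F f -> H h -> v = f + h -> (g v).1 = f /\ (g v).2 = h.
  by move=> Ff Hh e; have [? ? e'] := Hg v; apply: uniq => //; rewrite -e' e.
have gL c u v : (g (c *: u + v)).1 = c *: (g u).1 + (g v).1 /\
    (g (c *: u + v)).2 = c *: (g u).2 + (g v).2.
  have [Fu Hu eu] := Hg u; have [Fv Hv ev] := Hg v.
  apply: pE; [exact: FL|exact: HL|].
  by rewrite [in LHS]eu [in LHS]ev scalerDr addrACA.
pose pF v := (g v).1; pose pH v := (g v).2.
have pFL : linear pF by move=> c u v; exact: (gL c u v).1.
have pFl c u v : pF (c *: u + v) = c *: pF u + pF v by exact: pFL.
have pHl : linear pH by move=> c u v; exact: (gL c u v).2.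
have gT v : pF (T v) = T (pF v) /\ pH (T v) = T (pH v).
  have [Fv Hv ev] := Hg v; apply: pE; [exact: TF|exact: TH|].
  by rewrite [in LHS]ev linearD.
have FpF v : F (pF v) by have [] := Hg v.
have HpH v : H (pH v) by have [] := Hg v.
have decE v : v = pF v + pH v by have [] := Hg v.
have pF_F f : F f -> pF f = f.
  by move=> Ff; apply: (pE f f 0 Ff H0 _).1; rewrite addr0.
have pF_H h : H h -> pF h = 0.
  by move=> Hh; apply: (pE h 0 h F0 Hh _).1; rewrite add0r.
have pH_H h : H h -> pH h = h.
  by move=> Hh; apply: (pE h 0 h F0 Hh _).2; rewrite add0r.
have [s sF] := annihilating_roots fF TF.
have := annihilating_roots_eigen (P := fun z => rho0 <= normc z) LF TF Feig sF.
pose s0 := [seq z <- s | rho0 <= normc z]; rewrite -big_filter -/s0 => s0F.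
have s0r z : z \in s0 -> rho0 <= normc z by rewrite mem_filter => /andP[].
have resH lam : rho0 <= normc lam -> resolvent_on T H lam.
  by move=> h; exact: resolvent_on_radius TK LH cH TH sH h.
have [S [M [SH SM SP]]] := act_prod_inverse LH TH (fun z hz => resH z (s0r z hz)).
have [C0 q0b] := act_bounded (\prod_(z <- s0) ('X - z%:P)) TK.
(* The polynomial with roots s0 kills the F-component, and S undoes its action on H: pH v is thus a
   bounded function of v. *)
have pHE v : pH v = S (act T (\prod_(z <- s0) ('X - z%:P)) (pH v)) by rewrite SP.
have pHb v : nrm (pH v) <= `|M| * C0 * nrm v.
  have e : act T (\prod_(z <- s0) ('X - z%:P)) (pH v) =
           act T (\prod_(z <- s0) ('X - z%:P)) v.
    by rewrite [in RHS](decE v) linearD /= (s0F _ (FpF v)) add0r.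
  rewrite pHE -mulrA; apply: le_trans (SM _ _) _; first exact: act_subspace.
  apply: (@le_trans _ _ (`|M| * nrm (act T (\prod_(z <- s0) ('X - z%:P)) (pH v)))).
    by rewrite ler_wpM2r// ler_norm.
  by rewrite ler_wpM2l// e.
have pFb v : nrm (pF v) <= (1 + `|M| * C0) * nrm v.
  have -> : pF v = v - pH v by apply/eqP; rewrite eq_sym subr_eq; exact/eqP.
  by rewrite (le_trans (nrmB _ _))// mulrDl mul1r lerD2l.
pose s1 := [seq z <- s0 | rho <= normc z].
pose s2 := [seq z <- s0 | ~~ (rho <= normc z)].
pose q1 : {poly R[i]} := \prod_(z <- s1) ('X - z%:P).
pose q2 : {poly R[i]} := \prod_(z <- s2) ('X - z%:P).
have q12 f : F f -> act T q1 (act T q2 f) = 0.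
  rewrite -actM.
  have -> : q1 * q2 = \prod_(z <- s0) ('X - z%:P).
    rewrite [RHS](bigID (fun z => rho <= normc z)) /= /q1 /q2.
    by congr (_ * _); rewrite big_filter.
  exact: s0F.
have : coprimep q1 q2.
  by apply: coprime_prod_XsubC => z; rewrite !mem_filter => /andP[-> _].
move=> /Bezout_eq1_coprimepP[[u1 u2] /= bez].
have bezE v : act T (u1 * q1) v + act T (u2 * q2) v = v by rewrite -actD bez act1.
pose P0 v := act T (u2 * q2) (pF v).
have P0L : linear P0 by move=> c u v; rewrite /P0 pFL linearP.
have [P PE] := linear_bundle P0L; rewrite /P0 in PE.
have FP v : F (P v) by rewrite PE; exact: act_subspace.
have q1P v : act T q1 (P v) = 0.
  by rewrite PE -actM mulrCA actM actM q12// linear0.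
have Pq1 f : F f -> act T q1 f = 0 -> P f = f.
  move=> Ff q1f; have e : act T (u1 * q1) f = 0 by rewrite actM q1f linear0.
  by rewrite PE pF_F// -[RHS]bezE e add0r.
have PT v : P (T v) = T (P v) by rewrite !PE (gT v).1 act_commT.
have [C2 qb] := act_bounded (u2 * q2) TK.
have Pb : exists C, forall v, nrm (P v) <= C * nrm v.
  exists (`|C2| * (1 + `|M| * C0)) => v; rewrite PE (le_trans (qb _))//.
  rewrite -mulrA (@le_trans _ _ (`|C2| * nrm (pF v)))//.
    by rewrite ler_wpM2r// ler_norm.
  by rewrite ler_wpM2l.
have [n [e eE]] := fF.
have span f : F f -> exists c, f = \sum_i c i *: e i.
  by rewrite eE => -[c _ <-]; exists c.
exists P; split.
- by split => // v; rewrite Pq1.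
- exists n, (fun i => T (P (e i))); apply/seteqP; split=> [_ [v _ <-]|_ [c _ <-]].
    have [c Hc] := span _ (FpF v).
    exists c => //=; have -> : P v = P (pF v) by rewrite !PE (pF_F (pF v)).
    rewrite Hc !linear_sum; apply: eq_bigr => i _.
    by rewrite !linearZ.
  exists (\sum_(i < n) c i *: e i) => //=; rewrite !linear_sum.
  by apply: eq_bigr => i _; rewrite !linearZ.
- by exists n, e => v; exact: span.
- exists q1; split => // z; rewrite root_prod_XsubC mem_filter.
  by case/andP.
(* q2 has finitely many roots, all of modulus below rho, so one r1 < rho dominates them together
   with rho0. *)
have [r1 [/andP[r01 r1r] Hr1]] : exists r1, rho0 < r1 < rho /\ forall z, z \in s2 -> normc z < r1.
  by apply: normc_lt_seq => // z; rewrite mem_filter -ltNge => /andP[].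
exists r1; first by rewrite r1r (lt_trans rho0_gt0).
move=> lam rlam.
pose A := [set v | F v /\ act T q2 v = 0].
have LA : linear_subspace A.
  split; first by split => //=; rewrite linear0.
  move=> c u v [Fu qu] [Fv qv]; split; first exact: FL.
  by rewrite [LHS]linearP /= qu qv scaler0 addr0.
have TA : Defs.invariant T A.
  by move=> v [Fv qv]; split; [exact: TF|rewrite act_commT qv linear0].
have q2l : q2.[lam] != 0.
  rewrite -[_ == _]/(root q2 lam) root_prod_XsubC; apply/negP => /Hr1.
  by rewrite ltNge rlam.
have resA : resolvent_on T A lam.
  by have [s' []] := resolvent_on_kernel TK LA TA (fun v h => h.2) q2l.
apply: (@resolvent_on_split _ _ T [set v | P v = 0] A H pF pH) resA _ => //.
- by move=> v [Fv qv] /=; rewrite PE pF_F// actM qv linear0.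
- by move=> v Hv /=; rewrite PE pF_H// linear0.
- by move=> c u v /= Pu Pv; rewrite linearP Pu Pv scaler0 addr0.
- move=> v /= Pv; split => //; first by rewrite PT Pv linear0.
  (* P v = 0 leaves pF v = (u1 q1)(T) (pF v), which q2(T) kills because q1 q2 annihilates F. *)
  split => //; rewrite -[pF v]bezE -[X in _ + X]PE Pv addr0 [u1 * _]mulrC.
  by rewrite -actM mulrCA mulrA actM -[act T u1 _]/(act T u1 (pF v)) actM q12//; exact: act_subspace.
- by move=> v _; rewrite (gT v).1.
- by move=> v _; rewrite (gT v).2.
- by apply: resH; rewrite (le_trans (ltW r01)).
Qed.

(* On the range of P the inverse of T is a polynomial in T, whose powers decay
   like rho^-n; this is the lower bound on T^n there. *)
Lemma spectral_gap : ess_spectral_radius T < rho -> rho < spectral_radius T ->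
  exists P : {linear V -> V}, [/\ bounded_projection P,
    finite_dim (range (T \o P)),
    exists n (e : 'I_n -> V), forall v, exists c, P v = \sum_i c i *: e i,
    forall lam, lam != 0 -> eigenvalue_on (T \o P) setT lam -> rho <= normc lam &
    (forall N : {linear V -> V}, (forall v, N v = T v - T (P v)) ->
        spectral_radius N < rho) /\
    exists r s C, [/\ 0 < r, r < s, s < rho, 0 <= C & forall n v,
      nrm (iter n T (v - P v)) <= C * r ^+ n * nrm v /\
      s ^+ n * nrm (P v) <= C * nrm (iter n T (P v))]].
Proof.
move=> er rr; have [rho0 [/andP[r00 r0r] spl]] := ess_spectral_radius_splitting er rr.
have rho_gt0 : 0 < rho by apply: le_lt_trans r0r.
have [P [[PP PT [CP Pb]] fP sP [q [qP qr]] [r1 /andP[r10 r1r] res]]] :=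
  splitting_projection r0r spl.
exists P; split => //; first by split => //; exists CP.
  move=> lam l0 [v [_ v0 /= Tv]].
  have Pv : P v = v.
    have e1 : v = lam^-1 *: T (P v) by rewrite Tv scalerA mulVf// scale1r.
    by rewrite [in LHS]e1 linearZ /= PT PP -e1.
  have Tv' : T v = lam *: v by rewrite -{1}Pv.
  apply: qr; apply/eqP; have := qP v; rewrite Pv (act_eigen q Tv').
  by move/eqP; rewrite scaler_eq0 (negPf v0) orbF => /eqP.
pose A := [set v | P v = v]; pose B := [set v | P v = 0].
have BL (c : R[i]) u v : B u -> B v -> B (c *: u + v).
  by move=> /= Pu Pv; rewrite /B/= linearP Pu Pv scaler0 addr0.
have AL (c : R[i]) u v : A u -> A v -> A (c *: u + v).
  by move=> /= Pu Pv; rewrite /A/= linearP Pu Pv.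
have LA : linear_subspace A by split => //; rewrite /A/= linear0.
have TA : Defs.invariant T A by move=> v Av; rewrite /A/= PT Av.
have TB v : B v -> B (T v) by move=> Bv; rewrite /B/= PT Bv linear0.
have AP v : A (P v) by exact: PP.
have BP v : B (v - P v) by rewrite /B/= linearB /= PP subrr.
have qA v : A v -> act T q v = 0 by move=> Av; rewrite -Av qP.
have IPL : linear (fun v => v - P v).
  by move=> c u v; rewrite linearP opprD addrACA scalerBr.
have IPb v : nrm (v - P v) <= (1 + CP) * nrm v.
  by rewrite (le_trans (nrmB _ _))// mulrDl mul1r lerD2l.
have AZ (c : R[i]) v : A v -> A (c *: v).
  by move=> Av; rewrite /A/= linearZ /= Av.
have BZ (c : R[i]) v : B v -> B (c *: v).
  by move=> Bv; rewrite /B/= linearZ /= Bv scaler0.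
(* N is 0 on the range of P and agrees with T on its kernel. *)
have resN (N : {linear V -> V}) : (forall v, N v = T v - T (P v)) ->
    forall lam, r1 <= normc lam -> resolvent_on N setT lam.
  move=> NE lam rlam; have l0 : lam != 0 by rewrite -normc_gt0 (lt_le_trans r10).
  apply: (@resolvent_on_split _ _ N setT A B P (fun v => v - P v) CP (1 + CP)) => //.
  - exact: linearP.
  - by move=> v _; split => //; rewrite addrC subrK.
  - by move=> v _; rewrite !NE linearB /= !PT PP.
  - by move=> v _; rewrite !NE !linearB /= !PT !PP.
  - by apply: resolvent_on_zero => // v Av; rewrite NE Av subrr.
  - apply: (@resolvent_on_eq _ _ T) => //; last exact: res.
    by move=> v Bv; rewrite NE Bv linear0 subr0.
split.
  move=> N NE; apply: le_lt_trans r1r; apply: spectral_radius_le; first exact: ltW.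
  by move=> lam /ltW; exact: resN.
pose N0 v := T (v - P v).
have N0L : linear N0 by move=> c u v; rewrite /N0 IPL linearP.
have [N NE0] := linear_bundle N0L; rewrite /N0 in NE0.
have NE v : N v = T v - T (P v) by rewrite NE0 linearB.
have K0 : forall v, nrm (T v) <= `|K| * nrm v.
  by move=> v; rewrite (le_trans (TK v))// ler_wpM2r// ler_norm.
have Nb v : nrm (N v) <= `|K| * (1 + CP) * nrm v.
  by rewrite NE0 -mulrA (le_trans (K0 _))// ler_wpM2l.
(* [power_bound] needs strict room twice: r1 < r for the decay on the kernel of P, and s < t < rho
   for the growth on its range. *)
pose r := r1 + (rho - r1) / 4; pose s := r1 + (rho - r1) / 2.
pose t := r1 + (rho - r1) * (3 / 4).
have [r1r' rs st tr] : [/\ r1 < r, r < s, s < t & t < rho].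
  by rewrite /r /s /t; split; lra.
have r0 : 0 < r by apply: lt_trans r1r'.
have s0 : 0 < s by apply: lt_trans rs.
have t0 : 0 < t by apply: lt_trans st.
have [C1 C10 HC1] := power_bound (ltac:(by rewrite r10) : 0 < r1 < r) Nb (resN N NE).
have iterN' n v : iter n N (v - P v) = iter n T (v - P v).
  elim: n => //= n ->.
  suff : P (iter n T (v - P v)) = 0 by move=> e; rewrite NE0 e subr0.
  by elim: n => [|n IHn]; [exact: BP|rewrite iterS PT IHn linear0].
(* The roots of q have modulus at least rho > 0, so T is invertible on the range of P; M below is
   this inverse, extended by 0 on the kernel. *)
have q0 : q.[0] != 0.
  apply/negP => q0; have := qr 0 q0; rewrite normc0; lra.
have [y [_ yP]] := resolvent_on_kernel TK LA TA qA q0.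
pose M0 v := act T y (P v).
have M0L : linear M0 by move=> c u v; rewrite /M0 !linearP.
have [M ME] := linear_bundle M0L; rewrite /M0 in ME.
have [Cy yb] := act_bounded y TK.
have Mb v : nrm (M v) <= `|Cy| * CP * nrm v.
  rewrite ME -mulrA (@le_trans _ _ (`|Cy| * nrm (P v)))//.
    by rewrite (le_trans (yb _))// ler_wpM2r// ler_norm.
  by rewrite ler_wpM2l.
have MA v : A v -> A (M v) by move=> Av; rewrite ME Av; have [] := yP v Av.
have MT v : A v -> M (T v) = v.
  move=> Av; rewrite ME TA//; have [_ h _] := yP v Av.
  by rewrite -[in RHS]h scale0r subr0.
have TM v : A v -> T (M v) = v.
  move=> Av; rewrite ME Av; have [_ _ h] := yP v Av.
  by rewrite -[in RHS]h scale0r subr0.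
have PM v : P (M v) = M v by by rewrite ME; have [] := yP _ (AP v).
have resM mu : t^-1 <= normc mu -> resolvent_on M setT mu.
  move=> tmu; have nm0 : 0 < normc mu by rewrite (lt_le_trans _ tmu)// invr_gt0.
  have m0 : mu != 0 by rewrite -normc_gt0.
  apply: (@resolvent_on_split _ _ M setT A B P (fun v => v - P v) CP (1 + CP)) => //.
  - exact: linearP.
  - by move=> v _; split => //; rewrite addrC subrK.
  - by move=> v _; rewrite PM !ME PP.
  - move=> v _; have MP : M (P v) = M v by rewrite !ME PP.
    by rewrite [LHS]linearB MP PM.
  (* On the range of P, M - mu = - mu M (T - mu^-1). As mu^-1 has modulus at most t < rho, it is not
     a root of q, and the inverse is - mu^-1 (T - mu^-1)^-1 T. *)
  - have qm : q.[mu^-1] != 0.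
      apply/negP => /qr; rewrite normcV => h.
      have : (normc mu)^-1 <= t by rewrite -[t]invrK lef_pV2// posrE invr_gt0.
      lra.
    have [z [_ zP]] := resolvent_on_kernel TK LA TA qA qm.
    have [Cz zb] := act_bounded z TK.
    exists (fun v => - (mu^-1 *: act T z (T v))); split.
    + by move=> v Av; rewrite -scaleNr; apply: AZ; have [] := zP _ (TA _ Av).
    + by move=> c u v _ _; rewrite [T _]linearP [act T z _]linearP scalerDr opprD scalerN !scalerA [mu^-1 * c]mulrC.
    + apply: (@nrm_boundE _ _ A _ (normc mu^-1 * (`|Cz| * `|K|))) => v _.
      rewrite nrmN nrmZ -!mulrA ler_wpM2l ?normc_ge0//.
      rewrite (@le_trans _ _ (`|Cz| * nrm (T v)))//.
        by rewrite (le_trans (zb _))// ler_wpM2r// ler_norm.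
      by rewrite ler_wpM2l.
    + move=> v Av; have [_ h _] := zP v Av.
      have -> : T (M v - mu *: v) = (- mu) *: (T v - mu^-1 *: v).
        rewrite [LHS]linearB TM// [T (_ *: _)]linearZ scaleNr scalerBr scalerA.
        by rewrite divff// scale1r opprB.
      by rewrite [act T z _]linearZ /= h scalerA mulrN mulVf// scaleN1r opprK.
    + move=> v Av; have [h1 _ h2] := zP _ (TA _ Av).
      set w := act T z (T v) in h1 h2 *.
      have wE : w = v + mu^-1 *: M w.
        rewrite -[LHS](MT _ h1) -[T w](subrK (mu^-1 *: w)) h2 [LHS]linearD.
        by rewrite [X in _ + X]linearZ (MT _ Av).
      by rewrite linearN linearZ /= scalerN opprK scalerA divff// scale1r {2}wE addrC addrK.
  - apply: resolvent_on_zero => // v Bv; rewrite ME Bv linear0//.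
have st' : 0 < t^-1 < s^-1 by rewrite invr_gt0 t0/= ltf_pV2// posrE.
have [C2 C20 HC2] := power_bound st' Mb resM.
have Aiter n v : A (iter n T (P v)) by elim: n => [|n IHn]; [exact: AP|exact: TA].
have MTn n v : iter n M (iter n T (P v)) = P v.
  by elim: n => // n IHn; rewrite (iterS n T) (iterSr n M) MT.
exists r, s, (C1 * `|1 + CP| + C2); split => //; first by rewrite (lt_trans st).
  by rewrite addr_ge0// mulr_ge0.
move=> n v; split.
  rewrite -iterN' (le_trans (HC1 _ _))//.
  have h : nrm (v - P v) <= `|1 + CP| * nrm v.
    by rewrite (le_trans (IPb _))// ler_wpM2r// ler_norm.
  have rn : 0 <= r ^+ n by rewrite exprn_ge0// ltW.
  have := ler_wpM2l (mulr_ge0 C10 rn) h.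
  have := mulr_ge0 (mulr_ge0 C20 rn) (nrm_ge0 v); lra.
(* M^n undoes T^n on the range of P: the bound s^-n on M^n becomes the lower bound on T^n. *)
have := HC2 n (iter n T (P v)); rewrite MTn exprVn => h.
have sn : 0 < s ^+ n by rewrite exprn_gt0.
have {}h : s ^+ n * nrm (P v) <= C2 * nrm (iter n T (P v)).
  by rewrite -ler_pdivlMl// (le_trans h)// mulrA [_^-1 * _]mulrC.
rewrite (le_trans h)// mulrDl lerDr mulr_ge0// mulr_ge0//.
Qed.

End spectral_gap.

(** * Kernels of operators on bounded functions *)

Section disjoint_unions.
Context (E : Type) (R : realType).

Lemma indic_disjointU (A B : set E) (y : E) : A `&` B = set0 ->
  \1_(A `|` B) y = \1_A y + \1_B y :> R.
Proof.
move=> AB; rewrite !indicE in_setU.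
have : ~~ ((y \in A) && (y \in B)).
  apply/negP => /andP[/set_mem yA /set_mem yB].
  by have : (A `&` B) y by []; rewrite AB.
by case: (y \in A) (y \in B) => [] [] //= _; rewrite ?addr0 ?add0r.
Qed.

Lemma bigsetU_disjoint_next (F : nat -> set E) n : trivIset setT F ->
  (\big[setU/set0]_(i < n) F i) `&` F n = set0.
Proof.
move=> tF; apply/seteqP; split=> // y [+ Fny]; rewrite -bigcup_mkord => -[i /= im Fiy].
have e := tF i n I I (ex_intro _ y (conj Fiy Fny)).
by rewrite e ltnn in im.
Qed.

Lemma indic_bigsetU_cvg (F : nat -> set E) (x : E) :
  (\1_(\big[setU/set0]_(i < n) F i) x : R) @[n --> \oo] --> (\1_(\bigcup_n F n) x : R).
Proof.
have [[m _ Fx]|nU] := pselect ((\bigcup_n F n) x).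
  apply: cvg_near_cst; exists m.+1 => // n /= mn.
  rewrite !indicE !mem_set//; first by exists m.
  by rewrite -bigcup_mkord; exists m.
rewrite (_ : (fun n => _) = (fun=> 0)).
  by rewrite indicE memNset//; exact: cvg_cst.
apply/funext => n; rewrite indicE memNset// -bigcup_mkord => -[i _ Fx].
by apply: nU; exists i.
Qed.

End disjoint_unions.

Definition countably_additive (d : measure_display) (E : measurableType d) (R : realType)
    (m : set E -> R) := forall F : nat -> set E,
  (forall n, measurable (F n)) -> trivIset setT F ->
  (\sum_(i < n) m (F i)) @[n --> \oo] --> m (\bigcup_n F n).

Section bounded_functions.
Context (d : measure_display) (E : measurableType d) (R : realType).
Local Notation V := (bmfun E R).
Implicit Types (f g : V) (x : E).

Lemma normc_le_nrm f x : normc (f x) <= nrm f.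
Proof. exact: normc_le_supnorm. Qed.

Lemma nrm_le f (M : R) : (forall x, normc (f x) <= M) -> nrm f <= M.
Proof. exact: supnorm_le. Qed.

Lemma bmfunD f g x : (f + g) x = f x + g x. Proof. by []. Qed.
Lemma bmfunB f g x : (f - g) x = f x - g x. Proof. by []. Qed.
Lemma bmfunZ c f x : (c *: f) x = c * f x. Proof. by []. Qed.

Lemma bmfun_sum (I : Type) (s : seq I) (h : I -> V) x :
  (\sum_(i <- s) h i) x = \sum_(i <- s) h i x.
Proof. by elim: s => [|i s IHs]; rewrite ?big_nil// !big_cons bmfunD IHs. Qed.

(* Gaussian elimination on the values of the spanning functions. *)
Lemma interpolation n (e : 'I_n -> V) : exists s : seq (E * V),
  forall f, (exists c, f = \sum_i c i *: e i) ->
    f = \sum_(p <- s) f p.1 *: p.2.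
Proof.
elim: n e => [|n IHn] e.
  by exists [::] => f [c ->]; rewrite big_ord0 big_nil.
have [e0|] := pselect (forall i x, e i x = 0).
  exists [::] => f [c ->]; rewrite big_nil big1// => i _.
  by apply: bmfunE => x; rewrite bmfunZ e0 mulr0.
move=> /existsNP[i /existsNP[x /eqP eix]].
(* Each f in the span differs by (f x / e i x) e i from a combination of the e', to which the
   induction applies. *)
pose e' j := e (lift i j) - (e (lift i j) x / e i x) *: e i.
have [s hs] := IHn e'.
(* The function attached to x is the part of e i that the points of s fail to reproduce, divided by
   e i x. *)
exists ((x, (e i x)^-1 *: (e i - \sum_(p <- s) e i p.1 *: p.2)) :: s) => f [c fE].
pose h := f - (f x / e i x) *: e i.
have hE : h = \sum_j c (lift i j) *: e' j.
  rewrite /h [X in X - _]fE (bigD1_ord i)//= {1}fE.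
  have -> : (\sum_j c j *: e j) x = c i * e i x + \sum_j c (lift i j) * e (lift i j) x.
    by rewrite bmfun_sum (bigD1_ord i).
  rewrite mulrDl mulfK// scalerDl opprD addrACA subrr add0r.
  rewrite mulr_suml scaler_suml -sumrB; apply: eq_bigr => j _.
  by rewrite /e' scalerBr scalerA mulrA.
have := hs h (ex_intro _ _ hE).
move=> hE'; rewrite big_cons /= scalerA scalerBr.
have -> : \sum_(p <- s) f p.1 *: p.2 = h + (f x / e i x) *: \sum_(p <- s) e i p.1 *: p.2.
  rewrite {1}hE' scaler_sumr -big_split /=; apply: eq_bigr => p _.
  transitivity ((f p.1 - (f x / e i x) * e i p.1) *: p.2 +
    (f x / e i x) *: (e i p.1 *: p.2)); last by [].
  by rewrite scalerA -scalerDl subrK.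
by rewrite addrC -addrA [X in _ + X]addrC subrK /h subrK.
Qed.

Lemma kernel_op_nrm (K : bounded_kernel E R) : exists2 C, 0 <= C &
  forall f, nrm (kernel_op K f) <= C * nrm f.
Proof.
have [C C0 KC] := kernel_op_bounded K; exists C => // f.
by have := KC f; rewrite !nrmE -rmorphM lecR.
Qed.

Lemma bmreal_subproof (f : E -> R) : bounded_measurable f ->
  (fun x => (f x)%:C%C) \in @bmfun_pred _ E R.
Proof.
move=> [mf [M fM]]; apply: mem_set; split => //.
by exists M => x; rewrite normc_real.
Qed.

(** Total, with default 0, so that indicators can be written as elements of V without carrying a
    proof. *)
Definition bmreal (f : E -> R) : V :=
  if pselect (bounded_measurable f) is left bf then BMFun (bmreal_subproof bf) else 0.

Lemma bmrealE (f : E -> R) x : bounded_measurable f -> bmreal f x = (f x)%:C%C.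
Proof. by rewrite /bmreal; case: pselect. Qed.

Lemma bmreal_decomp f :
  f = bmreal (fun x => complex.Re (f x)) + 'i%C *: bmreal (fun x => complex.Im (f x)).
Proof.
apply: bmfunE => x; rewrite bmfunD bmfunZ !bmrealE; [|exact: bmfun_Im|exact: bmfun_Re].
by case: (f x) => a b; apply/eqP; rewrite eq_complex /=; apply/andP; split; apply/eqP; ring.
Qed.

Lemma charge_integral0 (nu : {charge set E -> \bar R}) : charge_integral nu (fun=> 0) = 0.
Proof.
have b0 : bounded_measurable (fun _ : E => 0 : R).
  by split; [exact: measurable_cst|exists 0 => ?; rewrite normr0].
have := charge_integral_lin nu (- 1) b0 b0; rewrite mulr0 addr0.
by move=> h; rewrite [LHS]h mulN1r addNr.
Qed.

Lemma kernel_op_indic (K : bounded_kernel E R) x A : measurable A ->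
  kernel_op K (bmreal \1_A) x = K x A.
Proof.
move=> mA; have bA := @bounded_measurable_indic _ E R _ mA.
rewrite /= /kernel_integral.
have -> : (fun y => complex.Im (bmreal \1_A y)) = (fun=> 0).
  by apply/funext => y; rewrite bmrealE.
have -> : (fun y => complex.Re (bmreal \1_A y)) = \1_A.
  by apply/funext => y; rewrite bmrealE.
by rewrite !charge_integral0 !charge_integral_indic// subr0 add0r.
Qed.

(** Sequential continuity for bounded pointwise convergence, stated at 0, which is enough for linear
    A. Norm continuity would not give sigma-additivity of A \mapsto the values on indicators; this
    property does. *)
Definition bounded_pointwise_continuous (A : V -> V) := forall (f_ : nat -> V) (M : R),
  (forall n x, normc (f_ n x) <= M) ->
  (forall x, normc (f_ n x) @[n --> \oo] --> (0 : R)) ->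
  forall x, normc (A (f_ n) x) @[n --> \oo] --> (0 : R).

Local Notation bpc := bounded_pointwise_continuous.

Lemma cvg0_dominated (u v : nat -> R) : (forall n, 0 <= u n <= v n) ->
  v n @[n --> \oo] --> (0 : R) -> u n @[n --> \oo] --> (0 : R).
Proof.
move=> uv v0; apply: (squeeze_cvgr _ (@cvg_cst _ _ _ _ _) v0) => //.
exact: nearW.
Qed.

Lemma cvg_dominated (u v : nat -> R) l : (forall n, `|u n - l| <= v n) ->
  v n @[n --> \oo] --> (0 : R) -> u n @[n --> \oo] --> l.
Proof.
move=> uv /cvgrPdist_le v0; apply/cvgrPdist_le => e e0; apply: filterS (v0 e e0) => n.
rewrite sub0r normrN distrC => h; apply: le_trans (uv n) _.
exact: le_trans (ler_norm _) h.
Qed.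

Lemma cvg0D (u v : nat -> R) : u n @[n --> \oo] --> (0 : R) ->
  v n @[n --> \oo] --> (0 : R) -> u n + v n @[n --> \oo] --> (0 : R).
Proof. by move=> u0 v0; rewrite -[0]addr0; exact: cvgD. Qed.

Lemma bpc_kernel_op (K : bounded_kernel E R) : bpc (kernel_op K).
Proof.
move=> f_ M fM f0 x.
have b0 : bounded_measurable (fun _ : E => 0 : R).
  by split; [exact: measurable_cst|exists 0 => ?; rewrite normr0].
have cr nu (p : R[i] -> R) : (forall g : V, bounded_measurable (fun y => p (g y))) ->
    (forall z, `|p z| <= normc z) ->
    charge_integral nu (fun y => p (f_ n y)) @[n --> \oo] --> (0 : R).
  move=> pb pn; rewrite -(charge_integral0 nu).
  apply: (@charge_integral_cvg _ _ _ _ (fun n y => p (f_ n y)) (fun=> 0) M) => //.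
    by move=> n y; rewrite (le_trans (pn _)).
  move=> y; apply: norm_cvg0; apply: cvg0_dominated (f0 y) => n.
  by rewrite normr_ge0 pn.
have c1 := cr (kernel_re K x) _ (@bmfun_Re _ _ _) (@Re_le_normc _).
have c2 := cr (kernel_im K x) _ (@bmfun_Im _ _ _) (@Im_le_normc _).
have c3 := cr (kernel_re K x) _ (@bmfun_Im _ _ _) (@Im_le_normc _).
have c4 := cr (kernel_im K x) _ (@bmfun_Re _ _ _) (@Re_le_normc _).
have cn (u : nat -> R) : u n @[n --> \oo] --> (0 : R) -> `|u n| @[n --> \oo] --> (0 : R).
  by move=> u0; rewrite -(normr0 R); exact: cvg_norm.
have cc := cvg0D (cvg0D (cn _ c1) (cn _ c2)) (cvg0D (cn _ c3) (cn _ c4)).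
apply: cvg0_dominated cc => n; rewrite normc_ge0 (le_trans (normc_le_ReIm _))//=.
by rewrite lerD// ?ler_normB// ler_normD.
Qed.

(** The norm bound on B keeps the images uniformly bounded, as the continuity of A requires. *)
Lemma bpc_comp (A B : V -> V) C : (forall f, nrm (B f) <= C * nrm f) ->
  bpc A -> bpc B -> bpc (A \o B).
Proof.
move=> BC bA bB f_ M fM f0; apply: (bA _ (`|C| * M)); last exact: bB fM f0.
move=> n x; rewrite (le_trans (normc_le_nrm _ _))// (le_trans (BC _))//.
apply: (@le_trans _ _ (`|C| * nrm (f_ n))); first by rewrite ler_wpM2r// ler_norm.
by rewrite ler_wpM2l// nrm_le.
Qed.

Lemma bpc_sub (A B : V -> V) : bpc A -> bpc B -> bpc (fun f => A f - B f).
Proof.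
move=> bA bB f_ M fM f0 x.
apply: cvg0_dominated (cvg0D (bA _ _ fM f0 x) (bB _ _ fM f0 x)) => n.
 rewrite normc_ge0 bmfunB (le_trans (normcD _ _))//.
by rewrite normcN.
Qed.

Lemma bpc_iter (A : V -> V) C n : 0 <= C -> (forall f, nrm (A f) <= C * nrm f) ->
  bpc A -> bpc (iter n A).
Proof.
move=> C0 AC bA; elim: n => [|n IHn]; first by move=> f_ M _ f0.
have e : iter n.+1 A = iter n A \o A by apply/funext => f; rewrite iterSr.
by rewrite e; apply: bpc_comp AC IHn bA.
Qed.

End bounded_functions.
Arguments bounded_pointwise_continuous {d E R}.
Local Notation bpc := bounded_pointwise_continuous.

(** * Kernel representation of operators *)

Section kernel_of_operator.
Context (d : measure_display) (E : measurableType d) (R : realType).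
Local Notation V := (bmfun E R).

Section charge_of.
Variables (m : set E -> R) (m0 : m set0 = 0) (madd : countably_additive m).

Definition charge_of (A : set E) : \bar R := if `[< measurable A >] then (m A)%:E else 0%E.

Let charge_of0 : charge_of set0 = 0%E.
Proof. by rewrite /charge_of m0; case: ifP. Qed.

Let charge_of_fin A : measurable A -> charge_of A \is a fin_num.
Proof. by rewrite /charge_of; case: ifP. Qed.

Let charge_of_sigma : semi_sigma_additive charge_of.
Proof.
move=> F mF tF mU; rewrite {2}/charge_of asboolT//.
rewrite (_ : (fun n => _) = EFin \o (fun n => \sum_(i < n) m (F i))).
  by apply: cvg_EFin; [exact: nearW|exact: madd].
apply/funext => n /=; rewrite -sumEFin big_mkord; apply: eq_bigr => i _.
by rewrite /charge_of asboolT.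
Qed.

HB.instance Definition _ :=
  isCharge.Build _ _ _ charge_of charge_of0 charge_of_fin charge_of_sigma.

Lemma charge_of_ex : exists c : {charge set E -> \bar R},
  forall A, measurable A -> c A = (m A)%:E.
Proof. by exists charge_of => A mA; rewrite /= /charge_of asboolT. Qed.

End charge_of.

Lemma kernel_of_setfun (k : E -> set E -> R[i]) :
  (forall A, measurable A -> measurable_fun setT (fun x => complex.Re (k x A))) ->
  (forall A, measurable A -> measurable_fun setT (fun x => complex.Im (k x A))) ->
  (exists M : R, forall x A, measurable A -> normc (k x A) <= M) ->
  (forall x, k x set0 = 0) ->
  (forall x, countably_additive (fun A => complex.Re (k x A))) ->
  (forall x, countably_additive (fun A => complex.Im (k x A))) ->
  exists K : bounded_kernel E R, forall x A, measurable A -> K x A = k x A.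
Proof.
move=> mre mim [M kM] k0 are aim.
have /choice[cr Hr] : forall x, exists c : {charge set E -> \bar R},
    forall A, measurable A -> c A = (complex.Re (k x A))%:E.
  by move=> x; apply: charge_of_ex => //; rewrite k0.
have /choice[ci Hi] : forall x, exists c : {charge set E -> \bar R},
    forall A, measurable A -> c A = (complex.Im (k x A))%:E.
  by move=> x; apply: charge_of_ex => //; rewrite k0.
have val x A : measurable A -> (fine (cr x A) +i* fine (ci x A))%C = k x A.
  by move=> mA; rewrite Hr// Hi//=; case: (k x A).
have H1 A : measurable A ->
    measurable_fun setT (fun x => complex.Re (fine (cr x A) +i* fine (ci x A))%C).
  by move=> mA; under eq_fun do rewrite val//; exact: mre.
have H2 A : measurable A ->
    measurable_fun setT (fun x => complex.Im (fine (cr x A) +i* fine (ci x A))%C).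
  by move=> mA; under eq_fun do rewrite val//; exact: mim.
have H3 : exists M : R, forall x A, measurable A ->
    normc (fine (cr x A) +i* fine (ci x A))%C <= M.
  by exists M => x A mA; rewrite val//; exact: kM.
by exists (@BoundedKernel _ E R cr ci H1 H2 H3) => x A mA; exact: val.
Qed.

(** The kernel is (x, D) |-> A 1_D (x). Its sigma-additivity is the continuity of A along indicators
    of partial unions, and induction on bounded measurable functions extends the identity from
    indicators to all of V. *)
Lemma kernel_of_operator (A : {linear V -> V}) C : (forall f, nrm (A f) <= C * nrm f) ->
  bpc A -> exists K : bounded_kernel E R, forall f, kernel_op K f = A f.
Proof.
move=> AC bA.
have bi D : measurable D -> bounded_measurable (\1_D : E -> R).
  exact: bounded_measurable_indic.
pose k x D := A (bmreal \1_D) x.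
(* Continuity at 0 is applied to the differences f_n - f, bounded by M + Mf. *)
have Alim f_ f M : (forall n, bounded_measurable (f_ n)) -> bounded_measurable f ->
    (forall n x, `|f_ n x| <= M) -> (forall x, f_ n x @[n --> \oo] --> f x) ->
    forall x, normc (A (bmreal (f_ n)) x - A (bmreal f) x) @[n --> \oo] --> (0 : R).
  move=> bf_ bf fM f_f x; have [_ [Mf fMf]] := bf.
  rewrite (_ : (fun n => _) = (fun n => normc (A (bmreal (f_ n) - bmreal f) x))); last first.
    by apply/funext => n; rewrite linearB.
  apply: (bA _ (M + Mf)) => [n y|y].
    rewrite bmfunB !bmrealE// -rmorphB normc_real (le_trans (ler_normB _ _))//.
    by rewrite lerD.
  rewrite (_ : (fun n => _) = (fun n => `|f_ n y - f y|)); last first.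
    by apply/funext => n; rewrite bmfunB !bmrealE// -rmorphB normc_real.
  rewrite -(normr0 R); apply: cvg_norm; rewrite -(subrr (f y)).
  by apply: cvgB => //; exact: cvg_cst.
have reim (z_ : nat -> R[i]) z : normc (z_ n - z) @[n --> \oo] --> (0 : R) ->
    complex.Re (z_ n) @[n --> \oo] --> complex.Re z /\
    complex.Im (z_ n) @[n --> \oo] --> complex.Im z.
  have reB (a b : R[i]) : complex.Re (a - b) = complex.Re a - complex.Re b.
    by case: a b => ? ? [].
  have imB (a b : R[i]) : complex.Im (a - b) = complex.Im a - complex.Im b.
    by case: a b => ? ? [].
  move=> h; split; apply: cvg_dominated h => n.
    by rewrite -reB Re_le_normc.
  by rewrite -imB Im_le_normc.
have bmD (c : R) f g : bounded_measurable f -> bounded_measurable g ->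
    bmreal (fun x => c * f x + g x) = c%:C%C *: bmreal f + bmreal g :> V.
  move=> bf bg; apply: bmfunE => x; rewrite bmfunD bmfunZ !bmrealE//.
    by rewrite rmorphD rmorphM.
  by apply: bounded_measurableD => //; exact: bounded_measurableZ.
have bm0 : bmreal \1_(set0 : set E) = 0 :> V.
  apply: bmfunE => y; rewrite bmrealE; first by rewrite indic0.
  exact: bi measurable0.
have ksum x (F : nat -> set E) n : (forall n, measurable (F n)) -> trivIset setT F ->
    \sum_(i < n) k x (F i) = A (bmreal \1_(\big[setU/set0]_(i < n) F i)) x.
  move=> mF tF; elim: n => [|n IHn].
    by rewrite !big_ord0 bm0 linear0.
  rewrite !big_ord_recr /= IHn -bmfunD -linearD; congr (A _ x).
  have mU : measurable (\big[setU/set0]_(i < n) F i) by exact: bigsetU_measurable.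
  apply: bmfunE => y; rewrite bmfunD !bmrealE; try exact/bi; last first.
    by apply: bi; exact: measurableU.
  by rewrite -rmorphD indic_disjointU//; exact: bigsetU_disjoint_next.
have kadd x (F : nat -> set E) : (forall n, measurable (F n)) -> trivIset setT F ->
    normc ((\sum_(i < n) k x (F i)) - k x (\bigcup_n F n)) @[n --> \oo] --> (0 : R).
  move=> mF tF; under eq_fun do rewrite ksum//.
  apply: (Alim _ _ 1) => [n||n y|y].
  - by apply: bi; exact: bigsetU_measurable.
  - by apply: bi; exact: bigcup_measurable.
  - by rewrite indicE ger0_norm//; case: (_ \in _).
  - exact: indic_bigsetU_cvg.
have [K KE] : exists K : bounded_kernel E R, forall x D, measurable D -> K x D = k x D.
  apply: kernel_of_setfun.
  - by move=> D mD; have [] := bmfunP (A (bmreal \1_D)).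
  - by move=> D mD; have [] := bmfunP (A (bmreal \1_D)).
  - exists (`|C| * 1) => x D mD; rewrite (le_trans (normc_le_nrm _ _))// (le_trans (AC _))//.
    apply: (@le_trans _ _ (`|C| * nrm (bmreal \1_D : V))); first by rewrite ler_wpM2r// ler_norm.
    rewrite ler_wpM2l//; apply: nrm_le => y; rewrite bmrealE//; last exact: bi.
    by rewrite normc_real indicE ger0_norm//; case: (_ \in _).
  - by move=> x; rewrite /k bm0 linear0.
  - move=> x F mF tF; have [h _] := reim _ _ (kadd x F mF tF).
    rewrite (_ : (fun n => _) = (fun n => complex.Re (\sum_(i < n) k x (F i))))//.
    by apply/funext => n; rewrite (raddf_sum (@complex.Re R)).
  - move=> x F mF tF; have [_ h] := reim _ _ (kadd x F mF tF).
    rewrite (_ : (fun n => _) = (fun n => complex.Im (\sum_(i < n) k x (F i))))//.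
    by apply/funext => n; rewrite (raddf_sum (@complex.Im R)).
exists K => f.
have KA g : bounded_measurable g -> forall x, A (bmreal g) x =
    (charge_integral (kernel_re K x) g +i* charge_integral (kernel_im K x) g)%C.
  move: g; apply: bounded_measurable_ind.
  - by move=> D mD x; rewrite !charge_integral_indic// -/(K x D) KE.
  - move=> a g h bg bh gE hE x; rewrite bmD// linearP bmfunD bmfunZ gE hE.
    rewrite !charge_integral_lin//; apply/eqP; rewrite eq_complex /=.
    by rewrite !mul0r subr0 addr0 !eqxx.
  - move=> f_ g M bf_ bg fM f_g fE x.
    have [c1 c2] := reim _ _ (Alim _ _ _ bf_ bg fM f_g x).
    have c3 := charge_integral_cvg (nu := kernel_re K x) bf_ bg fM f_g.
    have c4 := charge_integral_cvg (nu := kernel_im K x) bf_ bg fM f_g.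
    rewrite (_ : (fun n => _) = (fun n => charge_integral (kernel_re K x) (f_ n))) in c1; last first.
      by apply/funext => n; rewrite fE.
    rewrite (_ : (fun n => _) = (fun n => charge_integral (kernel_im K x) (f_ n))) in c2; last first.
      by apply/funext => n; rewrite fE.
    have e1 := cvg_unique _ c1 c3; have e2 := cvg_unique _ c2 c4.
    by rewrite -e1// -e2//; case: (A _ x).
have AfE : A f = A (bmreal (fun x => complex.Re (f x))) +
    'i%C *: A (bmreal (fun x => complex.Im (f x))).
  by rewrite [in LHS](bmreal_decomp f) linearD linearZ.
apply: bmfunE => x; transitivity (A (bmreal (fun x => complex.Re (f x))) x +
    'i%C * A (bmreal (fun x => complex.Im (f x))) x); last by rewrite AfE.
rewrite !KA; [|exact: bmfun_Im|exact: bmfun_Re].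
apply/eqP; rewrite eq_complex /= /kernel_integral.
by apply/andP; split; apply/eqP; ring.
Qed.

End kernel_of_operator.

(** * Quasi-compact kernels *)

Section quasi_compact_kernel.
Context (d : measure_display) (E : measurableType d) (R : realType).
Local Notation V := (bmfun E R).
Implicit Types (rho : R).

(* The values of T^n f at finitely many points, together with the spectral gap,
   control the projection P f. *)
Lemma spectral_gap_points (K : bounded_kernel E R) rho :
  ess_spectral_radius (kernel_op K) < rho -> rho < spectral_radius (kernel_op K) ->
  exists P : {linear V -> V}, [/\ bounded_projection (kernel_op K) P,
    finite_dim (range (kernel_op K \o P)),
    forall lam, lam != 0 -> eigenvalue_on (kernel_op K \o P) setT lam -> rho <= normc lam,
    forall N : {linear V -> V}, (forall v, N v = kernel_op K v - kernel_op K (P v)) ->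
        spectral_radius N < rho &
    exists r s C xs, [/\ 0 < r, r < s, s < rho, 0 <= C & forall n f,
      nrm (iter n (kernel_op K) (f - P f)) <= C * r ^+ n * nrm f /\
      s ^+ n * nrm (P f) <=
        C * (\sum_(x <- xs) normc (iter n (kernel_op K) f x) + r ^+ n * nrm f)]].
Proof.
move=> er rr; set T : {linear V -> V} := kernel_op K.
have [CT CT0 TC] := kernel_op_nrm K.
have [P [[PP PT Pb] fP [k [e eP]] Peig [PN [r [s [C [r0 rs sr C0 HC]]]]]]] := spectral_gap TC er rr.
exists P; split => //.
have [ps psE] := interpolation e.
pose G := \sum_(p <- ps) nrm p.2.
have G0 : 0 <= G by apply: sumr_ge0.
pose C' := C + C * G * (1 + (size ps)%:R * C).
have CG : 0 <= C * G * (1 + (size ps)%:R * C).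
  by rewrite mulr_ge0 ?mulr_ge0// addr_ge0// mulr_ge0.
exists r, s, C', (map fst ps); split => //; first by rewrite addr_ge0.
move=> n f; have [h1 h2] := HC n f; split.
  rewrite (le_trans h1)// ler_wpM2r// ler_wpM2r ?exprn_ge0 ?(ltW r0)//.
  by rewrite lerDl.
set S := \sum_(x <- _) _; set b := r ^+ n * nrm f.
have b0 : 0 <= b by rewrite mulr_ge0// exprn_ge0// ltW.
have S0 : 0 <= S by apply: sumr_ge0 => x _; exact: normc_ge0.
have iterP : iter n T (P f) = P (iter n T f).
  by elim: n {h1 h2 S S0 b b0} => //= n ->; rewrite PT.
(* T^n (P f) differs from T^n f by T^n (f - P f), which is of size r^n. *)
have pt x : normc (iter n T (P f) x) <= normc (iter n T f x) + C * b.
  have -> : iter n T (P f) = iter n T f - iter n T (f - P f).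
    by rewrite iterDlin iterN opprD opprK addNKr.
  rewrite bmfunB (le_trans (normcD _ _))// lerD2l normcN.
  by rewrite (le_trans (normc_le_nrm _ _))// mulrA.
have nb : nrm (iter n T (P f)) <= G * (S + (size ps)%:R * (C * b)).
  rewrite [X in nrm X](psE (iter n T (P f))); last by rewrite iterP; exact: eP.
  apply: nrm_le => y; rewrite bmfun_sum.
  apply: (@le_trans _ _ (\sum_(p <- ps) (normc (iter n T f p.1) + C * b) * G)).
    have : forall p, p \in ps -> nrm p.2 <= G.
      rewrite /G; elim: (ps) => // q qs IHq p; rewrite inE big_cons => /orP[/eqP->|/IHq h].
        by rewrite lerDl sumr_ge0.
      by rewrite (le_trans h)// lerDr.
    elim: (ps) => [_|p qs IHq h]; first by rewrite !big_nil normc0.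
    rewrite !big_cons (le_trans (normcD _ _))// lerD//; last first.
      by apply: IHq => q qq; apply: h; rewrite inE qq orbT.
    rewrite bmfunZ [leLHS]normcM ler_pM ?normc_ge0//.
    by rewrite (le_trans (normc_le_nrm _ _))// h// mem_head.
  rewrite -mulr_suml mulrC ler_wpM2l// big_split /= lerD//.
    by rewrite /S big_map.
  by rewrite [leRHS]mulr_natl big_const_seq count_predT iter_addr addr0.
rewrite (le_trans h2)//.
have := ler_wpM2l C0 nb; have := mulr_ge0 (mulr_ge0 C0 G0) S0.
have := mulr_ge0 (mulr_ge0 C0 G0) b0; have := mulr_ge0 C0 S0; have := mulr_ge0 C0 b0.
have sz : 0 <= (size ps)%:R * C by rewrite mulr_ge0.
have := mulr_ge0 sz (mulr_ge0 (mulr_ge0 C0 G0) S0).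
rewrite /C'; set z := (size ps)%:R in sz *; move=> *.
apply: (@le_trans _ _ (C * (G * (S + z * (C * b))))) => //.
rewrite -subr_ge0 (_ : _ - _ = C * S + C * b + C * G * b + z * C * (C * G * S)).
  by rewrite !addr_ge0.
ring.
Qed.

Lemma kernel_splitting (K : bounded_kernel E R) rho :
  ess_spectral_radius (kernel_op K) < rho -> rho < spectral_radius (kernel_op K) ->
  exists L N : bounded_kernel E R,
    [/\ forall x A, measurable A -> K x A = L x A + N x A,
        (forall f, kernel_op L (kernel_op N f) = 0) /\
        (forall f, kernel_op N (kernel_op L f) = 0),
        spectral_radius (kernel_op N) < rho,
        finite_dim (range (kernel_op L)) &
        forall lam : R[i], lam != 0 -> eigenvalue_on (kernel_op L) setT lam ->
          rho <= normc lam].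
Proof.
move=> er rr; set T : {linear V -> V} := kernel_op K.
have [P [[PP PT [CP Pb]] fP Peig PN [r [s [C [xs [r0 rs sr C0 HC]]]]]]] := spectral_gap_points er rr.
have [CT CT0 TC] := kernel_op_nrm K.
have s0 : 0 < s by apply: lt_trans rs.
have bT : bpc T by exact: bpc_kernel_op.
have bP : bpc P.
  move=> f_ M fM f0 x.
  have M0 : 0 <= M by apply: le_trans (normc_ge0 _) (fM 0%N x).
  (* n is fixed before k: (r / s)^n makes the error at most eps / 2 for all k, and for this n the
     finitely many values of T^n f_k tend to 0. *)
  apply/cvgrPdist_le => eps e0.
  have q1 : 0 <= r / s < 1 by rewrite divr_ge0 ?(ltW r0) ?(ltW s0)//= ltr_pdivrMr// mul1r.
  have e1 : 0 < eps / (2 * (C * M + 1)).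
    by rewrite divr_gt0// mulr_gt0// ltr_wpDl// mulr_ge0.
  have [n hn] := expn_decay q1 e1; have {}hn := hn n (leqnn n).
  have cS : \sum_(y <- xs) normc (iter n T (f_ k) y) @[k --> \oo] --> (0 : R).
    elim: xs {HC} => [|y xs IHxs].
      by under eq_fun do rewrite big_nil; exact: cvg_cst.
    under eq_fun do rewrite big_cons; apply: cvg0D => //.
    exact: (bpc_iter n CT0 TC bT fM f0).
  have e2 : 0 < eps * s ^+ n / (2 * (C + 1)).
    by rewrite divr_gt0 ?mulr_gt0 ?exprn_gt0// ltr_wpDl.
  move/cvgrPdist_le : cS => /(_ _ e2); apply: filterS => k.
  rewrite sub0r normrN sub0r normrN !ger0_norm ?normc_ge0//; last first.
    by apply: sumr_ge0 => y _; exact: normc_ge0.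
  set S := \sum_(y <- _) _ => Sk; apply: le_trans (normc_le_nrm _ _) _.
  have := (HC n (f_ k)).2; rewrite -/S => h.
  have sn : 0 < s ^+ n by rewrite exprn_gt0.
  rewrite -(ler_pM2l sn) (le_trans h)// mulrDr.
  have h3 : C * S <= s ^+ n * (eps / 2).
    apply: (@le_trans _ _ ((C + 1) * (eps * s ^+ n / (2 * (C + 1))))).
      by apply: ler_pM => //; [apply: sumr_ge0 => y _; exact: normc_ge0|rewrite lerDl].
    rewrite le_eqVlt; apply/orP; left; apply/eqP; field.
    by rewrite gt_eqF// ltr_wpDl.
  have h4 : C * (r ^+ n * nrm (f_ k)) <= s ^+ n * (eps / 2).
    have rE : r ^+ n = s ^+ n * (r / s) ^+ n.
      by rewrite exprMn exprVn mulrCA divff ?mulr1// gt_eqF.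
    rewrite rE -mulrA mulrCA ler_pM2l// mulrCA.
    apply: (@le_trans _ _ ((eps / (2 * (C * M + 1))) * (C * M + 1))).
      apply: ler_pM => //; first by rewrite exprn_ge0//; case/andP: q1.
        by rewrite mulr_ge0.
      apply: (@le_trans _ _ (C * M)); last by rewrite lerDl.
      by rewrite ler_wpM2l// nrm_le.
    rewrite le_eqVlt; apply/orP; left; apply/eqP; field.
    by rewrite gt_eqF// ltr_wpDl// mulr_ge0.
  by apply: le_trans (lerD h3 h4) _; rewrite -mulrDr -splitr.
have TPb f : nrm (T (P f)) <= CT * CP * nrm f.
  by rewrite (le_trans (TC _))// -mulrA ler_wpM2l.
have [L LE] : exists L : bounded_kernel E R, forall f, kernel_op L f = T (P f).
  apply: (kernel_of_operator (A := T \o P)) TPb _.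
  exact: bpc_comp Pb bT bP.
have NL : linear (fun f => T f - T (P f)).
  have PL := linearP P; have TL := linearP T.
  by move=> c u v; rewrite PL !TL opprD addrACA scalerBr.
have [N0 N0E] := linear_bundle NL.
have [N NE'] : exists N : bounded_kernel E R, forall f, kernel_op N f = N0 f.
  apply: (kernel_of_operator (C := CT + CT * CP)) => [f|].
    by rewrite N0E (le_trans (nrmB _ _))// mulrDl; exact: lerD (TC _) (TPb _).
  rewrite (_ : (N0 : V -> V) = (fun f => T f - T (P f))); last exact/funext.
  by apply: bpc_sub => //; exact: bpc_comp Pb bT bP.
have NE f : kernel_op N f = T f - T (P f) by rewrite NE' N0E.
exists L, N; split.
- move=> x A mA; rewrite -!kernel_op_indic// LE NE bmfunB addrCA subrr addr0.
  by [].
- split=> f.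
    by rewrite LE NE linearB /= !PT PP subrr linear0.
  by rewrite NE LE !PT PP subrr.
- exact: PN.
- rewrite (_ : range (kernel_op L) = range (T \o P))//.
  by congr (_ @` _); apply/funext => f; rewrite LE.
- move=> lam l0 [v [_ v0 e]]; apply: Peig => //; exists v; split => //.
  exact: etrans (esym (LE v)) e.
Qed.

(** T^l 1_A is split by P. The threshold l0 only serves to make T^l (1 - P) small against rho^l; the
    term T^l P is controlled for each l by taking k large. *)
Lemma fker_power_absolutely_continuous (Q : R.-fker E ~> E) rho :
  ess_spectral_radius (kernel_op (complex_kernel Q)) < rho ->
  rho < spectral_radius (kernel_op (complex_kernel Q)) ->
  exists l0 : nat, (0 < l0)%N /\ forall l, (l0 <= l)%N ->
    exists (nu : probability E R) (a : R), 0 <= a /\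
    forall x A, measurable A ->
      fine (kernel_pow Q l x A) <= a * fine (nu A) + rho ^+ l / 16.
Proof.
move=> er rr; set T : {linear V -> V} := kernel_op (complex_kernel Q).
have [P [[PP PT [CP Pb]] fP Peig PN [r [s [C [xs [r0 rs sr C0 HC]]]]]]] := spectral_gap_points er rr.
have [CT CT0 TC] := kernel_op_nrm (complex_kernel Q).
have s0 : 0 < s by apply: lt_trans rs.
have rho0 : 0 < rho by apply: lt_trans sr.
have powE n x A : measurable A ->
    iter n T (bmreal \1_A) x = (fine (kernel_pow Q n x A))%:C%C.
  by move=> mA; rewrite -kernel_op_pow kernel_op_indic// complex_kernelE.
have n1 A : measurable A -> nrm (bmreal \1_A : V) <= 1.
  move=> mA; apply: nrm_le => x; rewrite bmrealE; last exact: bounded_measurable_indic.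
  by rewrite normc_real indicE ger0_norm//; case: (_ \in _).
have q1 : 0 <= r / rho < 1.
  by rewrite divr_ge0 ?(ltW r0) ?(ltW rho0)//= ltr_pdivrMr// mul1r (lt_trans rs).
(* Half of the budget rho^l / 16; the other half goes to the choice of k. The + 1 avoids a division
   by 0. *)
have e1 : 0 < (32 * (C + 1))^-1 by rewrite invr_gt0 mulr_gt0// ltr_wpDl.
have [l0 hl0] := expn_decay q1 e1.
(* The successor keeps l positive, for the exponent 1 / l of the norm estimate. *)
exists l0.+1; split => // l /ltnW ll.
have rl : 0 < rho ^+ l by rewrite exprn_gt0.
have Crl : C * r ^+ l <= rho ^+ l / 32.
  have := hl0 l ll; rewrite exprMn exprVn ler_pdivrMr// => h.
  apply: (@le_trans _ _ ((C + 1) * ((32 * (C + 1))^-1 * rho ^+ l))).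
    by apply: ler_pM => //; [rewrite exprn_ge0// ltW|rewrite lerDl].
  rewrite le_eqVlt; apply/orP; left; apply/eqP; field.
  by rewrite gt_eqF// ltr_wpDl.
have q2 : 0 <= r / s < 1 by rewrite divr_ge0 ?(ltW r0) ?(ltW s0)//= ltr_pdivrMr// mul1r.
(* CT^l is the crude bound of T^l on the range of P, which (r / s)^k has to offset. *)
pose D := CT ^+ l * C.
have D0 : 0 <= D by rewrite mulr_ge0// exprn_ge0.
have e2 : 0 < rho ^+ l / (32 * (D + 1)) by rewrite divr_gt0// mulr_gt0// ltr_wpDl.
have [k hk] := expn_decay q2 e2; have {}hk := hk k (leqnn k).
have sk : 0 < s ^+ k by rewrite exprn_gt0.
(* The Dirac mass makes the total mass at least 1, so that normalisation is possible even if all the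
   measures at the points vanish. *)
have [m mE] : exists m : {measure set E -> \bar R}, forall A,
    m A = (\sum_(x <- xs) kernel_pow Q k x A + \d_(point : E) A)%E.
  elim: (xs) => [|y ys [m IHys]].
    by exists (dirac (point : E)) => A; rewrite big_nil add0e.
  exists (measure_add (kernel_pow Q k y) m) => A.
  by apply: etrans (measure_addE (kernel_pow Q k y) m A) _; rewrite IHys big_cons addeA.
have mfin A : measurable A -> m A \is a fin_num.
  move=> mA; rewrite mE fin_numD fin_num_measure// andbT.
  elim: (xs) => [|y ys IHys]; first by rewrite big_nil.
  by rewrite big_cons fin_numD IHys andbT (kernel_finite_transition (s := kernel_pow Q k) y).
pose Z := fine (m setT).
have Z1 : (1 <= m setT)%E.
  rewrite mE [\d_ _ _]diracT leeDr// sume_ge0//.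
have Z1' : 1 <= Z by rewrite -lee_fin fineK// mfin.
have Z0 : 0 < Z by apply: lt_le_trans Z1'.
pose nu : probability E R := mnormalize m (dirac point : probability E R).
have nuE A : measurable A -> fine (m A) = Z * fine (nu A).
  move=> mA; rewrite /nu /= /mnormalize -[m setT]fineK ?mfin// -/Z.
  rewrite eqe gt_eqF//= fineM ?mfin//= mulrCA divff ?mulr1// gt_eqF//.
have mge A : measurable A -> \sum_(x <- xs) fine (kernel_pow Q k x A) <= Z * fine (nu A).
  move=> mA; rewrite -nuE// -lee_fin fineK ?mfin// mE -sumEFin.
  rewrite (eq_bigr (fun x => kernel_pow Q k x A)); first by rewrite leeDl.
  by move=> x _; rewrite fineK// (kernel_finite_transition (s := kernel_pow Q k) x).
exists nu, (D / s ^+ k * Z); split.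
  by rewrite mulr_ge0 ?(ltW Z0)// divr_ge0// ltW.
move=> x A mA; set f : V := bmreal \1_A.
have -> : fine (kernel_pow Q l x A) = normc (iter l T f x).
  by rewrite powE// normc_real ger0_norm// fine_ge0.
have f1 : nrm f <= 1 by exact: n1.
have fE : iter l T f = iter l T (P f) + iter l T (f - P f).
  by rewrite -iterDlin addrC subrK.
have h1 := iter_bound (T := T) l CT0 TC (P f).
have [h2 _] := HC l f; have [_ h3] := HC k f.
have h4 : nrm (iter l T (f - P f)) <= rho ^+ l / 32.
  by rewrite (le_trans h2)// (le_trans _ Crl)// ler_piMr// mulr_ge0// exprn_ge0// ltW.
have h5 : \sum_(y <- xs) normc (iter k T f y) <= Z * fine (nu A).
  rewrite (le_trans _ (mge A mA))// le_eqVlt; apply/orP; left; apply/eqP.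
  by apply: eq_bigr => y _; rewrite powE// normc_real ger0_norm// fine_ge0.
have h6 : nrm (P f) <= C / s ^+ k * (Z * fine (nu A) + r ^+ k).
  rewrite mulrAC ler_pdivlMr// mulrC (le_trans h3)// ler_wpM2l// lerD//.
  by rewrite ler_piMr// exprn_ge0// ltW.
have h7 : CT ^+ l * nrm (P f) <= D / s ^+ k * (Z * fine (nu A) + r ^+ k).
  by rewrite /D -!mulrA ler_wpM2l ?exprn_ge0// mulrA.
have h8 : D / s ^+ k * r ^+ k <= rho ^+ l / 32.
  rewrite -mulrA [_^-1 * _]mulrC -exprVn -exprMn.
  apply: (@le_trans _ _ ((D + 1) * (rho ^+ l / (32 * (D + 1))))).
    apply: ler_pM => //; last by rewrite lerDl.
    by rewrite exprn_ge0//; case/andP: q2.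
  rewrite le_eqVlt; apply/orP; left; apply/eqP; field.
  by rewrite gt_eqF// ltr_wpDl.
rewrite (le_trans (normc_le_nrm _ _))// fE (le_trans (nrmD _ _))//.
have := le_trans h1 h7; rewrite mulrDr mulrA => h9.
lra.
Qed.

End quasi_compact_kernel.

(** * Measurable families of densities *)

Section bounded_integrals.
Context (d : measure_display) (E : measurableType d) (R : realType).
Variable m : {finite_measure set E -> \bar R}.
Implicit Types (f g : E -> R).

Lemma Rintegral_lin a f g : bounded_measurable f -> bounded_measurable g ->
  \int[m]_y (a * f y + g y) = a * \int[m]_y f y + \int[m]_y g y.
Proof.
move=> bf bg; rewrite RintegralD ?RintegralZl//; try exact: bounded_measurable_integrable.
exact/bounded_measurable_integrable/bounded_measurableZ.
Qed.

Lemma Rintegral_indicT A : measurable A -> \int[m]_y \1_A y = fine (m A).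
Proof. by move=> mA; rewrite /Rintegral integral_indic// setIT. Qed.

Lemma Rintegral_le f g : bounded_measurable f -> bounded_measurable g ->
  (forall y, f y <= g y) -> \int[m]_y f y <= \int[m]_y g y.
Proof.
by move=> bf bg fg; apply: le_Rintegral => //; exact: bounded_measurable_integrable.
Qed.

Lemma bounded_measurable_cst (c : R) : bounded_measurable (fun _ : E => c).
Proof. by split; [exact: measurable_cst|exists `|c|]. Qed.

Lemma Rintegral0T : \int[m]_y (0 : R) = 0.
Proof.
have b0 := bounded_measurable_cst 0.
have := Rintegral_lin (- 1) b0 b0; rewrite mulr0 addr0.
by move=> h; rewrite [LHS]h mulN1r addNr.
Qed.

Lemma Rintegral_ge0T f : bounded_measurable f -> (forall y, 0 <= f y) -> 0 <= \int[m]_y f y.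
Proof.
by move=> bf f0; rewrite -Rintegral0T; apply: Rintegral_le => //; exact: bounded_measurable_cst.
Qed.

Lemma bounded_measurableM f g : bounded_measurable f -> bounded_measurable g ->
  bounded_measurable (fun y => f y * g y).
Proof.
move=> [mf [M fM]] [mg [M' gM]]; split; first exact: measurable_funM.
by exists (M * M') => y; rewrite normrM ler_pM.
Qed.

Lemma bounded_measurableB f g : bounded_measurable f -> bounded_measurable g ->
  bounded_measurable (fun y => f y - g y).
Proof.
move=> [mf [M fM]] [mg [M' gM]]; split; first exact: measurable_funB.
by exists (M + M') => y; rewrite (le_trans (ler_normB _ _))// lerD.
Qed.

Lemma Rintegral_sum_indic (I : Type) (s : seq I) (c : I -> R) (D : I -> set E) :
  (forall i, measurable (D i)) ->
  bounded_measurable (fun y => \sum_(i <- s) c i * \1_(D i) y) /\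
  \int[m]_y (\sum_(i <- s) c i * \1_(D i) y) = \sum_(i <- s) c i * fine (m (D i)).
Proof.
move=> mD; elim: s => [|i s [bs IHs]].
  under eq_fun do rewrite big_nil; rewrite big_nil; split.
    exact: bounded_measurable_cst.
  exact: Rintegral0T.
have bi := bounded_measurable_indic R (mD i).
under eq_fun do rewrite big_cons.
split; first by apply: bounded_measurableD => //; exact: bounded_measurableZ.
by rewrite Rintegral_lin// IHs Rintegral_indicT// big_cons.
Qed.

Lemma Rintegral_null D f : measurable D -> m D = 0%E -> bounded_measurable f ->
  \int[m]_y (\1_D y * f y) = 0.
Proof.
move=> mD D0 [mf [M fM]].
have bD := bounded_measurable_indic R mD.
have bf : bounded_measurable f by split=> //; exists M.
have M0 : 0 <= M by apply: le_trans (normr_ge0 _) (fM point).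
have int0 c : \int[m]_y (c * \1_D y) = 0.
  have := Rintegral_lin c bD (bounded_measurable_cst 0).
  under eq_Rintegral do rewrite addr0.
  by rewrite Rintegral_indicT// D0 mulr0 Rintegral0T addr0.
have bDf := bounded_measurableM bD bf.
have ind01 y : (\1_D y = 0 :> R) \/ (\1_D y = 1 :> R).
  by rewrite indicE; case: (_ \in _); [right|left].
apply/eqP; rewrite eq_le; apply/andP; split.
  rewrite -(int0 M); apply: Rintegral_le => //; first exact: bounded_measurableZ.
  move=> y; case: (ind01 y) => ->; rewrite ?mul0r ?mulr0// mul1r mulr1.
  by rewrite (le_trans (ler_norm _)).
rewrite -(int0 (- M)); apply: Rintegral_le => //; first exact: bounded_measurableZ.
move=> y; case: (ind01 y) => ->; rewrite ?mul0r ?mulr0// mul1r mulr1.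
by rewrite lerNl (le_trans (ler_norm _))// normrN.
Qed.

Lemma Rintegral_countably_additive f : bounded_measurable f ->
  countably_additive (fun D => \int[m]_y (\1_D y * f y)).
Proof.
move=> bf F mF tF; have [_ [M fM]] := bf.
have mn n : measurable (\big[setU/set0]_(i < n) F i) by exact: bigsetU_measurable.
have bn n := bounded_measurableM (bounded_measurable_indic R (mn n)) bf.
have -> : (fun n => \sum_(i < n) \int[m]_y (\1_(F i) y * f y)) =
    (fun n => \int[m]_y (\1_(\big[setU/set0]_(i < n) F i) y * f y)).
  apply/funext; elim=> [|n IHn].
    rewrite !big_ord0 -Rintegral0T; apply: eq_Rintegral => y _.
    by rewrite indic0 mul0r.
  rewrite !big_ord_recr /= IHn.
  have bF := bounded_measurableM (bounded_measurable_indic R (mF n)) bf.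
  rewrite -[X in X + _]mul1r -Rintegral_lin//; apply: eq_Rintegral => y _.
  by rewrite mul1r -mulrDl indic_disjointU//; exact: bigsetU_disjoint_next.
apply: (@Rintegral_bounded_cvg _ _ _ _ _ _ M) => //.
- apply: bounded_measurableM => //; apply: bounded_measurable_indic.
  exact: bigcupT_measurable.
- move=> n y; have M0 : 0 <= M by apply: le_trans (normr_ge0 _) (fM y).
  by rewrite normrM indicE normr_nat; case: (_ \in _); rewrite ?mul1r ?mul0r.
- by move=> y; apply: cvgM; [exact: indic_bigsetU_cvg|exact: cvg_cst].
Qed.

Lemma finite_measure_countably_additive : countably_additive (fun D => fine (m D)).
Proof.
move=> F mF tF; have := Rintegral_countably_additive (bounded_measurable_cst 1) mF tF.
have e D : measurable D -> \int[m]_y (\1_D y * 1) = fine (m D).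
  by move=> mD; under eq_Rintegral do rewrite mulr1; exact: Rintegral_indicT.
rewrite e; last exact: bigcupT_measurable.
rewrite (_ : (fun n => \sum_(i < n) \int[m]_y (\1_(F i) y * 1)) =
  (fun n => \sum_(i < n) fine (m (F i))))//.
by apply/funext => n; apply: eq_bigr => i _; exact: e.
Qed.

End bounded_integrals.

(** * Finite partitions and the martingale of quotients *)

Section cells.
Context (d : measure_display) (E : measurableType d) (R : realType).
Variables (A : nat -> set E) (mA : forall i, measurable (A i)).

Definition code n (y : E) : {ffun 'I_n -> bool} := [ffun i : 'I_n => y \in A i].

(** The nonempty cells are the atoms of the algebra generated by the first n sets. *)
Definition cell n (b : {ffun 'I_n -> bool}) := [set y | code n y = b].

Lemma measurable_cell n b : measurable (@cell n b).
Proof.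
have -> : @cell n b = \bigcap_(i in [set: nat])
    [set y | forall h : (i < n)%N, (y \in A i) = b (Ordinal h)].
  apply/seteqP; split=> [y yb i _ h|y yb].
    by rewrite -[b]yb ffunE.
  by apply/ffunP => -[i h]; rewrite ffunE; exact: yb.
apply: bigcapT_measurable => i.
have [h|h] := pselect (i < n)%N; last first.
  rewrite (_ : [set y | _] = setT)//; apply/seteqP; split=> // y _ h'.
  by case: (h h').
have [bi|bi] := boolP (b (Ordinal h)).
  rewrite (_ : [set y | _] = A i)//; apply/seteqP; split=> [y /(_ h)|y yA h'].
    by rewrite bi => /set_mem.
  by rewrite mem_set// (bool_irrelevance h' h) bi.
rewrite (_ : [set y | _] = ~` A i); first exact: measurableC.
apply/seteqP; split=> [y /(_ h) yb yA|y yA h'].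
  by move: bi; rewrite -yb mem_set.
by rewrite memNset// (bool_irrelevance h' h) (negPf bi).
Qed.

Lemma level_funE n (h : {ffun 'I_n -> bool} -> R) y :
  h (code n y) = \sum_(b <- index_enum {ffun 'I_n -> bool}) h b * \1_(cell b) y.
Proof.
rewrite (bigD1 (code n y))//= indicE mem_set// mulr1 big1 ?addr0// => b bc.
rewrite indicE memNset ?mulr0// => yb; move: bc; rewrite -yb.
by rewrite eqxx.
Qed.

Lemma level_fun_bm n (h : {ffun 'I_n -> bool} -> R) : bounded_measurable (fun y => h (code n y)).
Proof.
under eq_fun do rewrite level_funE.
(* The lemma speaks of some finite measure; any one, such as a Dirac mass, gives the
   measurability. *)
have [mf [M fM]] := (Rintegral_sum_indic (dirac (point : E)) (index_enum {ffun 'I_n -> bool}) h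
  (@measurable_cell n)).1.
by split => //; exists M.
Qed.

Lemma level_integral (m : {finite_measure set E -> \bar R}) n (h : {ffun 'I_n -> bool} -> R) :
  \int[m]_y h (code n y) = \sum_b h b * fine (m (cell b)).
Proof.
under eq_Rintegral do rewrite level_funE.
exact: (Rintegral_sum_indic _ _ _ (@measurable_cell n)).2.
Qed.

Lemma code_restrict n k : (n <= k)%N -> exists r : {ffun 'I_k -> bool} -> {ffun 'I_n -> bool},
  forall y, code n y = r (code k y).
Proof.
move=> nk; exists (fun b => [ffun i => b (widen_ord nk i)]) => y.
by apply/ffunP => i; rewrite !ffunE.
Qed.

End cells.

Section density_approximation.
Context (d : measure_display) (E : measurableType d) (R : realType).
Variables (A : nat -> set E) (mA : forall i, measurable (A i)).
Variables (lam nu : {finite_measure set E -> \bar R}).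
Hypothesis nulam : forall D, measurable D -> (nu D <= lam D)%E.

Let nulam' D : measurable D -> fine (nu D) <= fine (lam D).
Proof. by move=> mD; rewrite fine_le ?fin_num_measure// nulam. Qed.

(** On a cell with lam-mass 0 the quotient is 0 by the convention on division; since nu <= lam, nu
    vanishes there too and [ratioM] still holds. *)
Definition ratio n (b : {ffun 'I_n -> bool}) : R :=
  fine (nu (cell A b)) / fine (lam (cell A b)).

Lemma ratio01 n (b : {ffun 'I_n -> bool}) : 0 <= ratio b <= 1.
Proof.
have mc := measurable_cell mA b.
rewrite /ratio divr_ge0 ?fine_ge0//=.
have [->|l0] := eqVneq (fine (lam (cell A b))) 0; first by rewrite invr0 mulr0.
rewrite ler_pdivrMr ?mul1r ?nulam'//.
by rewrite lt_neqAle eq_sym l0 fine_ge0.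
Qed.

Lemma ratioM n (b : {ffun 'I_n -> bool}) :
  ratio b * fine (lam (cell A b)) = fine (nu (cell A b)).
Proof.
have mc := measurable_cell mA b.
have [l0|l0] := eqVneq (fine (lam (cell A b))) 0; last by rewrite divfK.
rewrite l0 mulr0; apply/eqP; rewrite eq_le fine_ge0//=.
by rewrite -l0 nulam'.
Qed.

Definition approx n y : R := ratio (code A n y).

Lemma approx01 n y : 0 <= approx n y <= 1.
Proof. exact: ratio01. Qed.

Lemma approx_bm n : bounded_measurable (approx n).
Proof. exact: level_fun_bm. Qed.

(** The martingale identity: level k refines level n, so both sides are sums over the cells of level
    k, compared term by term with [ratioM]. *)
Lemma approx_level n k (h : {ffun 'I_n -> bool} -> R) : (n <= k)%N ->
  \int[lam]_y (h (code A n y) * approx k y) = \int[nu]_y h (code A n y).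
Proof.
move=> nk; have [r rE] := code_restrict A nk.
under eq_Rintegral do rewrite rE.
under [RHS]eq_Rintegral do rewrite rE.
rewrite (level_integral mA lam (fun b => h (r b) * ratio b)).
rewrite (level_integral mA nu (fun b => h (r b))).
by apply: eq_bigr => b _; rewrite -mulrA ratioM.
Qed.

(* approx is a martingale for lam, with squared L^2 norm energy. *)
Definition energy n : R := \int[nu]_y approx n y.

(** Orthogonality of martingale increments: by [approx_level], the cross term integrates to energy
    n. *)
Lemma energyE n k : (n <= k)%N -> \int[lam]_y ((approx k y - approx n y) ^+ 2) = energy k - energy n.
Proof.
move=> nk.
have bk := approx_bm k; have bn := approx_bm n.
have bkk := bounded_measurableM bk bk; have bnk := bounded_measurableM bn bk.
have bnn := bounded_measurableM bn bn.
have bL := bounded_measurableD (bounded_measurableZ (- 2) bnk) bnn.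
have -> : \int[lam]_y ((approx k y - approx n y) ^+ 2) =
    \int[lam]_y (1 * (approx k y * approx k y) + (- 2 * (approx n y * approx k y) + approx n y * approx n y)).
  by apply: eq_Rintegral => y _; ring.
rewrite !Rintegral_lin//.
rewrite (approx_level (fun b => ratio b) (leqnn k)) (approx_level (fun b => ratio b) nk).
rewrite (approx_level (fun b => ratio b) (leqnn n)) -!/(energy _); ring.
Qed.

Lemma energy_nondecreasing n k : (n <= k)%N -> energy n <= energy k.
Proof.
move=> nk; rewrite -subr_ge0 -energyE//; apply: Rintegral_ge0T.
  apply: (@bounded_measurableM _ _ _ (fun y => approx k y - approx n y)
    (fun y => approx k y - approx n y)); apply: bounded_measurableB; exact: approx_bm.
by move=> y; exact: sqr_ge0.
Qed.

(** The energies increase and are bounded by the mass of nu. Asking for j <= n makes the selected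
    levels tend to infinity. *)
Lemma energy_cauchy (e : R) j : 0 < e ->
  exists n, (j <= n)%N /\ forall k, (n <= k)%N -> energy k - energy n <= e.
Proof.
move=> e0.
have nd : {homo energy : n m / (n <= m)%N >-> n <= m} by exact: energy_nondecreasing.
have cv : cvgn energy.
  apply: nondecreasing_is_cvgn => //; exists (fine (nu setT)) => _ [n _ <-].
  rewrite -Rintegral_indicT//; apply: Rintegral_le; first exact: approx_bm.
    exact: bounded_measurable_indic.
  by move=> y; rewrite indicT; case/andP: (approx01 n y).
have /cvgrPdist_le/(_ _ e0)[n0 _ hn] := cv.
exists (maxn j n0); split; first exact: leq_maxl.
move=> k _; have := hn (maxn j n0) (leq_maxr _ _) => /= h.
have := nondecreasing_cvgn_le nd cv k; have := ler_norm (limn energy - energy (maxn j n0)).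
lra.
Qed.

Variable N : nat -> nat.
Hypotheses (N_ge : forall j, (j <= N j)%N) (N_homo : forall j, (N j <= N j.+1)%N).
Hypothesis N_energy : forall j k, (N j <= k)%N -> energy k - energy (N j) <= 8^-1 ^+ j.

Definition jump j := [set y | 2^-1 ^+ j < `|approx (N j.+1) y - approx (N j) y|].

Lemma measurable_jump j : measurable (jump j).
Proof.
have [m1 _] := approx_bm (N j.+1); have [m2 _] := approx_bm (N j).
have m : measurable_fun setT (fun y => `|approx (N j.+1) y - approx (N j) y|).
  by apply: measurableT_comp => //; exact: measurable_funB.
rewrite -[jump j]setTI (_ : jump j = (fun y => `|approx (N j.+1) y - approx (N j) y|) @^-1`
  [set` `](2^-1 ^+ j : R), +oo[]).
  exact: m.
by apply/seteqP; split=> y; rewrite /jump /= in_itv /= andbT.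
Qed.

(** Chebyshev's inequality, with 8^-j = (2^-j)^2 2^-j. *)
Lemma lam_jump j : fine (lam (jump j)) <= 2^-1 ^+ j.
Proof.
have mJ := measurable_jump j.
have bJ := bounded_measurable_indic R mJ.
have bs : bounded_measurable (fun y => (approx (N j.+1) y - approx (N j) y) ^+ 2).
  apply: (@bounded_measurableM _ _ _ (fun y => approx (N j.+1) y - approx (N j) y)
    (fun y => approx (N j.+1) y - approx (N j) y)); apply: bounded_measurableB; exact: approx_bm.
have h0 : 0 < (2^-1 : R) ^+ j by rewrite exprn_gt0.
have h : ((2^-1 : R) ^+ j) ^+ 2 * fine (lam (jump j)) <= 8^-1 ^+ j.
  apply: le_trans (N_energy (N_homo j)).
  rewrite -energyE// -Rintegral_indicT//.
  rewrite -[leLHS]addr0 -(Rintegral0T lam) -Rintegral_lin//; last exact: bounded_measurable_cst.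
  apply: Rintegral_le => //.
    by apply: bounded_measurableD; [exact: bounded_measurableZ|exact: bounded_measurable_cst].
  move=> y; rewrite addr0 indicE; have [|_] := boolP (y \in jump j); last first.
    by rewrite mulr0 sqr_ge0.
  move=> /set_mem /= yJ; rewrite mulr1 -[leRHS]real_normK ?num_real//.
  by rewrite ler_sqr ?nnegrE ?normr_ge0 ?(ltW h0)// ltW.
have e8 : (8^-1 : R) ^+ j = 2^-1 ^+ j ^+ 2 * 2^-1 ^+ j.
  rewrite -exprSr -exprM mulnC exprM; congr (_ ^+ j).
  by rewrite !exprS expr0; field.
by move: h; rewrite e8 ler_pM2l// exprn_gt0.
Qed.

(** Borel-Cantelli: the masses 2^-j add up to 2. *)
Lemma lam_lim_sup_jump : lam (lim_sup_set jump) = 0%E.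
Proof.
apply: lim_sup_set_cvg0; first exact: measurable_jump.
apply: (@le_lt_trans _ _ (2 : R)%:E); last exact: ltry.
apply: le_trans (epsilon_trick0 xpredT (ler0n R 2)).
apply: lee_nneseries => // j _.
have lj : lam (jump j) \is a fin_num by rewrite fin_num_measure//; exact: measurable_jump.
apply: (@le_trans _ _ (fine (lam (jump j)))%:E); first by rewrite fineK.
rewrite lee_fin (le_trans (lam_jump j))// natrX exprS invfM mulrA divff// mul1r exprVn.
by [].
Qed.

Lemma approx_cvg y : ~ lim_sup_set jump y -> cvg (approx (N j) y @[j --> \oo]).
Proof.
move=> ny.
have [J HJ] : exists J, forall j, (J <= j)%N -> `|approx (N j.+1) y - approx (N j) y| <= 2^-1 ^+ j.
  apply: contrapT => h; apply: ny => n _.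
  apply: contrapT => h'; apply: h; exists n => j nj; rewrite leNgt; apply/negP => lt.
  by apply: h'; exists j.
(* Adding the tail 2 * 2^-j of the allowed jumps makes the sequence nonincreasing; it is bounded
   below by 0, hence converges. *)
pose v j := approx (N (j + J)%N) y + 2 * 2^-1 ^+ (j + J).
have cv : cvgn v.
  apply: nonincreasing_is_cvgn.
    apply/nonincreasing_seqP => j; rewrite /v addSn exprS.
    have := HJ (j + J)%N (leq_addl _ _).
    have := ler_norm (approx (N (j + J).+1) y - approx (N (j + J)%N) y).
    lra.
  exists 0 => _ [j _ <-]; rewrite addr_ge0//; first by case/andP: (approx01 (N (j + J)%N) y).
have c2 : 2 * 2^-1 ^+ (j + J) @[j --> \oo] --> (0 : R).
  rewrite -[0](mulr0 2); apply: cvgM; first exact: cvg_cst.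
  have := @cvg_expr R (2^-1) (ltac:(by rewrite ger0_norm// invf_lt1// ltr1n)).
  by rewrite -(cvg_shiftn J).
apply/cvg_ex; exists (limn v); rewrite -(cvg_shiftn J).
rewrite -[limn v]subr0 (_ : (fun n => _) = (fun j => v j - 2 * 2^-1 ^+ (j + J))).
  exact: cvgB.
by apply/funext => j; rewrite /v addrK.
Qed.

(** Setting the approximations to 0 on the exceptional null set makes them converge everywhere, so
    that the limit is measurable as a pointwise limit. *)
Definition good_approx j y : R := \1_(~` lim_sup_set jump) y * approx (N j) y.

Lemma measurable_lim_sup_jump : measurable (lim_sup_set jump).
Proof.
by apply: bigcapT_measurable => n; apply: bigcup_measurable => j _; exact: measurable_jump.
Qed.

Lemma good_approx_cvg y : cvg (good_approx j y @[j --> \oo]).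
Proof.
have [yl|yl] := pselect (lim_sup_set jump y).
  apply/cvg_ex; exists 0; rewrite (_ : (fun j => _) = (fun=> 0)); first exact: cvg_cst.
  by apply/funext => j; rewrite /good_approx indicE memNset ?mul0r//= => /(_ yl).
rewrite (_ : (fun j => _) = (fun j => approx (N j) y)); first exact: approx_cvg.
by apply/funext => j; rewrite /good_approx indicE mem_set ?mul1r.
Qed.

Definition density y : R := limn (fun j => good_approx j y).

Lemma good_approx01 j y : 0 <= good_approx j y <= 1.
Proof.
have /andP[a0 a1] := approx01 (N j) y.
rewrite /good_approx indicE; case: (_ \in _); first by rewrite mul1r a0.
by rewrite mul0r lexx ler01.
Qed.

Lemma density01 y : 0 <= density y <= 1.
Proof.
apply/andP; split.
  apply: limr_ge; first exact: good_approx_cvg.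
  by apply: nearW => j; case/andP: (good_approx01 j y).
apply: limr_le; first exact: good_approx_cvg.
by apply: nearW => j; case/andP: (good_approx01 j y).
Qed.

Lemma good_approx_bm j : bounded_measurable (good_approx j).
Proof.
apply: bounded_measurableM; last exact: approx_bm.
by apply: bounded_measurable_indic; apply: measurableC; exact: measurable_lim_sup_jump.
Qed.

Lemma density_bm : bounded_measurable density.
Proof.
split; last by exists 1 => y; have /andP[a0 a1] := density01 y; rewrite ger0_norm.
apply: (@measurable_fun_cvg _ _ _ setT good_approx).
  by move=> j; have [] := good_approx_bm j.
by move=> y _; exact: good_approx_cvg.
Qed.

Hypothesis generated : @measurable _ E = <<s range A >>.

(** Sets read off from finitely many A i form a generating pi-system. The identity holds there
    because the approximating integrals are eventually constant, and Dynkin's lemma extends it. *)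
Lemma density_integral D : measurable D -> \int[lam]_y (\1_D y * density y) = fine (nu D).
Proof.
pose G := [set D | exists n (S : {ffun 'I_n -> bool} -> bool), D = [set y | S (code A n y)]].
have lev n (S : {ffun 'I_n -> bool} -> bool) D0 : D0 = [set y | S (code A n y)] ->
    forall y, (\1_D0 y = (S (code A n y))%:R :> R).
  move=> -> y; rewrite indicE.
  suff -> : (y \in [set y | S (code A n y)]) = S (code A n y) by [].
  by apply/idP/idP => [/set_mem|/mem_set].
have Gm D' : G D' -> measurable D'.
  move=> [n [S DE]].
  have : measurable_fun setT (fun y => (S (code A n y))%:R : R).
    by have [] := level_fun_bm mA (fun b => (S b)%:R : R).
  move=> /(_ measurableT [set 1]); rewrite setTI => /(_ _)h.
  rewrite (_ : D' = (fun y => (S (code A n y))%:R : R) @^-1` [set 1]); first exact: h.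
  rewrite DE; apply/seteqP; split=> y /=; first by move=> ->.
  by case: (S _) => // /eqP; rewrite eq_sym oner_eq0.
have gen : @measurable _ E = <<s G >>.
  apply/seteqP; split.
    rewrite generated; apply: smallest_sub; first exact: smallest_sigma_algebra.
    move=> _ [i _ <-]; apply: sub_sigma_algebra; exists i.+1, (fun b => b ord_max).
    apply/seteqP; split=> y /=; first by move=> yA; rewrite ffunE mem_set.
    by rewrite ffunE => /set_mem.
  apply: smallest_sub; first exact: sigma_algebra_measurable.
  exact: Gm.
have GI : setI_closed G.
  move=> D1 D2 [n [S DE]] [k [S' DE']].
  have [r rE] := code_restrict A (leq_maxl n k).
  have [r' rE'] := code_restrict A (leq_maxr n k).
  exists (maxn n k), (fun b => S (r b) && S' (r' b)).
  rewrite DE DE'; apply/seteqP; split=> y /=.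
    by rewrite rE rE' => -[-> ->].
  by rewrite rE rE' => /andP.
have bd := density_bm.
have PG D' : G D' -> \int[lam]_y (\1_D' y * density y) = fine (nu D').
  move=> GD; have mD := Gm _ GD; case: GD => n [S DE].
  have bD := bounded_measurable_indic R mD.
  have c1 : \int[lam]_y (\1_D' y * good_approx j y) @[j --> \oo] -->
      \int[lam]_y (\1_D' y * density y).
    apply: (@Rintegral_bounded_cvg _ _ _ _ _ _ 1).
    - by move=> j; apply: bounded_measurableM => //; exact: good_approx_bm.
    - exact: bounded_measurableM.
    - move=> j y; have /andP[a0 a1] := good_approx01 j y.
      rewrite normrM (ger0_norm a0) indicE normr_nat.
      by case: (_ \in _); rewrite ?mul1r ?mul0r.
    - by move=> y; apply: cvgM; [exact: cvg_cst|exact: good_approx_cvg].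
  (* As soon as N j >= j >= n, the integral equals nu D' exactly, by the martingale identity; the
     exceptional set is null. *)
  apply: cvg_unique c1 _ => //; apply: cvg_near_cst; exists n => // j /= nj.
  have bnull := Rintegral_null measurable_lim_sup_jump lam_lim_sup_jump
    (bounded_measurableM bD (approx_bm (N j))).
  have bb := bounded_measurableM bD (approx_bm (N j)).
  have bl : bounded_measurable (fun y => \1_(lim_sup_set jump) y * (\1_D' y * approx (N j) y)).
    apply: bounded_measurableM => //.
    by apply: bounded_measurable_indic; exact: measurable_lim_sup_jump.
  have -> : \int[lam]_y (\1_D' y * good_approx j y) =
      \int[lam]_y (-1 * (\1_(lim_sup_set jump) y * (\1_D' y * approx (N j) y)) +
        \1_D' y * approx (N j) y).
    apply: eq_Rintegral => y _; rewrite /good_approx !indicE in_setC.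
    by case: (y \in lim_sup_set jump) => /=; ring.
  rewrite Rintegral_lin// bnull mulr0 add0r.
  under eq_Rintegral do rewrite (lev _ _ _ DE).
  rewrite (approx_level (fun b => (S b)%:R)); last by rewrite (leq_trans nj).
  rewrite -Rintegral_indicT//; apply: eq_Rintegral => y _.
  by rewrite (lev _ _ _ DE).
have PT : \int[lam]_y (\1_(setT : set E) y * density y) = fine (nu setT).
  apply: PG; exists 0%N, (fun=> true).
  by apply/seteqP; split.
rewrite gen; move: D; apply: (dynkin_induction gen GI) => //.
- move=> S mS PS.
  have bS := bounded_measurable_indic R mS.
  have -> : \int[lam]_y (\1_(~` S) y * density y) =
     \int[lam]_y (-1 * (\1_S y * density y) + \1_(setT : set E) y * density y).
    apply: eq_Rintegral => y _; rewrite indicT !indicE in_setC.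
    by case: (y \in S) => /=; ring.
  have b1 := bounded_measurableM bS bd.
  have b2 := bounded_measurableM (bounded_measurable_indic R (@measurableT _ E)) bd.
  rewrite Rintegral_lin// PS PT mulN1r addrC.
  rewrite -fineB ?fin_num_measure//; congr fine.
  have e : nu setT = (nu S + nu (~` S))%E.
    by rewrite -(setUv S) measureU//; [exact: measurableC|exact: setICr].
  by rewrite e [X in (X - _)%E]addeC addeK ?fin_num_measure.
- move=> F mF tF PF.
  have c1 := Rintegral_countably_additive (m := lam) bd mF tF.
  have c2 := finite_measure_countably_additive (m := nu) mF tF.
  have e : (fun n => \sum_(i < n) \int[lam]_y (\1_(F i) y * density y)) =
      (fun n => \sum_(i < n) fine (nu (F i))).
    by apply/funext => n; apply: eq_bigr => i _; exact: PF.
  by rewrite e in c1; exact: cvg_unique c1 c2.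
Qed.

End density_approximation.

(** * Truncation of the density *)

Section truncation.
Context (d : measure_display) (E : measurableType d) (R : realType).
Variables (q nu lam : {finite_measure set E -> \bar R}).
Hypothesis lamE : forall D, measurable D -> lam D = (q D + nu D)%E.

Lemma Rintegral_add f : bounded_measurable f ->
  \int[lam]_y f y = \int[q]_y f y + \int[nu]_y f y.
Proof.
move: f; apply: bounded_measurable_ind.
- by move=> D mD; rewrite !Rintegral_indicT// lamE// fineD ?fin_num_measure.
- by move=> a f g bf bg fE gE; rewrite !Rintegral_lin// fE gE; ring.
- move=> f_ f M bf_ bf fM f_f fE.
  have c1 := Rintegral_bounded_cvg (m := lam) bf_ bf fM f_f.
  have c2 := Rintegral_bounded_cvg (m := q) bf_ bf fM f_f.
  have c3 := Rintegral_bounded_cvg (m := nu) bf_ bf fM f_f.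
  have c4 : \int[q]_y f_ n y + \int[nu]_y f_ n y @[n --> \oo] -->
      \int[q]_y f y + \int[nu]_y f y by exact: cvgD c2 c3.
  have e : (fun n => \int[lam]_y f_ n y) = (fun n => \int[q]_y f_ n y + \int[nu]_y f_ n y).
    by apply/funext => n; exact: fE.
  by rewrite e in c1; exact: cvg_unique c1 c4.
Qed.

Variables (W : E -> R) (c : R).
Hypotheses (W01 : forall y, 0 <= W y <= 1) (bW : bounded_measurable W) (c0 : 0 < c).
Hypothesis WE : forall D, measurable D -> \int[lam]_y (\1_D y * W y) = fine (nu D).

Lemma density_change f : bounded_measurable f ->
  \int[lam]_y (f y * W y) = \int[nu]_y f y.
Proof.
move: f; apply: bounded_measurable_ind.
- by move=> D mD; rewrite WE// Rintegral_indicT.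
- move=> a f g bf bg fE gE.
  under eq_Rintegral do rewrite mulrDl -mulrA.
  rewrite [LHS]Rintegral_lin//; try exact: bounded_measurableM.
  by rewrite fE gE [RHS]Rintegral_lin.
- move=> f_ f M bf_ bf fM f_f fE.
  have c1 := Rintegral_bounded_cvg (m := nu) bf_ bf fM f_f.
  have c2 : \int[lam]_y (f_ n y * W y) @[n --> \oo] --> \int[lam]_y (f y * W y).
    apply: (@Rintegral_bounded_cvg _ _ _ _ _ _ M).
    - by move=> n; exact: bounded_measurableM.
    - exact: bounded_measurableM.
    - move=> n y; have /andP[w0 w1] := W01 y; rewrite normrM (ger0_norm w0).
      by rewrite -[M]mulr1 ler_pM.
    - by move=> y; apply: cvgM; [exact: f_f|exact: cvg_cst].
  have e : (fun n => \int[lam]_y (f_ n y * W y)) = (fun n => \int[nu]_y f_ n y).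
    by apply/funext => n; exact: fE.
  by rewrite e in c2; exact: cvg_unique c2 c1.
Qed.

(** The increasing and the decreasing term meet at w = 1 / (1 + c), which is therefore the minimum.
    Below that point the second term prevails and the truncation takes effect. *)
Definition floor_density (w : R) := Num.max w ((1 - w) / c).

Lemma floor_density_ge w : 0 <= w <= 1 -> (1 + c)^-1 <= floor_density w.
Proof.
move=> /andP[w0 w1]; have c1 : 0 < 1 + c by rewrite addr_gt0.
rewrite le_max; have [h|h] := leP (1 + c)^-1 w; first by [].
rewrite /= ler_pdivlMr//.
have : w * (1 + c) < 1 by rewrite -ltr_pdivlMr// mul1r.
have : (1 + c)^-1 * (1 + c) = 1 by rewrite mulVf// gt_eqF.
nra.
Qed.

Lemma floor_density_gt0 w : 0 <= w <= 1 -> 0 < floor_density w.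
Proof.
by move=> w01; apply: lt_le_trans (floor_density_ge w01); rewrite invr_gt0 addr_gt0.
Qed.

(* With W = d nu / d (q + nu), the density of q with respect to nu is
   (1 - W) / W; its truncation at c is (1 - W) / max (W, (1 - W) / c). *)
Definition truncated (w : R) := (1 - w) * (floor_density w)^-1.

Lemma truncated_bound w : 0 <= w <= 1 -> 0 <= truncated w <= c.
Proof.
move=> w01; have h := floor_density_gt0 w01; have /andP[w0 w1] := w01.
rewrite /truncated; apply/andP; split.
  by rewrite mulr_ge0 ?subr_ge0// invr_ge0 ltW.
by rewrite ler_pdivrMr// mulrC -ler_pdivrMr// le_max lexx orbT.
Qed.

Lemma measurable_inv_ge0 d' (T : measurableType d') (f : T -> R) : (forall t, 0 <= f t) ->
  measurable_fun setT f -> measurable_fun setT (fun t => (f t)^-1).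
Proof.
move=> f0 mf; rewrite (_ : (fun t => _) = (fun t => f t `^ (-1))).
  exact: (measurableT_comp (measurable_powR (-1)) mf).
by apply/funext => t; rewrite powR_inv1.
Qed.

Lemma measurable_floor d' (T : measurableType d') (f : T -> R) :
  measurable_fun setT f -> measurable_fun setT (fun t => floor_density (f t)).
Proof.
move=> mf; apply: measurable_maxr => //.
apply: measurable_funM; last exact: measurable_cst.
by apply: measurable_funB => //; exact: measurable_cst.
Qed.

Lemma measurable_truncated d' (T : measurableType d') (f : T -> R) :
  (forall t, 0 <= f t <= 1) ->
  measurable_fun setT f -> measurable_fun setT (fun t => truncated (f t)).
Proof.
move=> f01 mf; apply: measurable_funM.
  by apply: measurable_funB => //; exact: measurable_cst.
apply: measurable_inv_ge0; first by move=> t; apply/ltW/floor_density_gt0.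
exact: measurable_floor.
Qed.

Let g y := (floor_density (W y))^-1.

Let g0 y : 0 <= g y.
Proof. by rewrite invr_ge0; apply/ltW/floor_density_gt0. Qed.

Let bg : bounded_measurable g.
Proof.
split.
  apply: measurable_inv_ge0; first by move=> t; apply/ltW/floor_density_gt0.
  by apply: measurable_floor; case: bW.
exists (1 + c) => y; rewrite ger0_norm ?g0// -[leRHS]invrK lef_pV2 ?posrE ?invr_gt0 ?addr_gt0//.
  exact: floor_density_ge.
exact: floor_density_gt0.
Qed.

Let gW1 y : g y * W y <= 1.
Proof.
by rewrite mulrC ler_pdivrMr ?mul1r ?floor_density_gt0// le_max lexx.
Qed.

(** Since lam = q + nu and W d lam = d nu, integrating g W over D against q gives the integral of g
    - g W against nu, that is of g (1 - W). The comparison with q then reduces to g W <= 1. *)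
Lemma truncated_integral D : measurable D ->
  \int[nu]_y (\1_D y * truncated (W y)) = \int[q]_y (\1_D y * (g y * W y)).
Proof.
move=> mD; have bD := bounded_measurable_indic R mD.
have bgW := bounded_measurableM bD (bounded_measurableM bg bW).
have bDg := bounded_measurableM bD bg.
have := density_change bDg.
have -> : \int[lam]_y (\1_D y * g y * W y) = \int[lam]_y (\1_D y * (g y * W y)).
  by apply: eq_Rintegral => y _; rewrite mulrA.
rewrite Rintegral_add// => e.
have -> : \int[nu]_y (\1_D y * truncated (W y)) =
    \int[nu]_y (-1 * (\1_D y * (g y * W y)) + \1_D y * g y).
  by apply: eq_Rintegral => y _; rewrite /truncated -/(g y); ring.
by rewrite Rintegral_lin// -e; ring.
Qed.

Lemma truncated_le D : measurable D ->
  \int[nu]_y (\1_D y * truncated (W y)) <= fine (q D).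
Proof.
move=> mD; rewrite truncated_integral// -Rintegral_indicT//.
have bD := bounded_measurable_indic R mD.
apply: Rintegral_le => //.
  exact: (bounded_measurableM bD (bounded_measurableM bg bW)).
by move=> y; rewrite ler_piMr.
Qed.

(** B is {W < 1 / (1 + c)}. Off B, g W = 1 and no mass of q is lost; on B, nu has density W < 1 / (1
    + c) with respect to lam. *)
Lemma truncated_defect : exists B, [/\ measurable B,
  fine (q setT) - \int[nu]_y truncated (W y) <= fine (q B) &
  fine (nu B) <= fine (lam setT) / (1 + c)].
Proof.
pose B := [set y | W y < (1 + c)^-1].
have c1 : 0 < 1 + c by rewrite addr_gt0.
have mB : measurable B.
  have [mW _] := bW.
  rewrite -[B]setTI (_ : B = W @^-1` [set` `]-oo, (1 + c)^-1[]); first exact: mW.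
  by apply/seteqP; split=> y; rewrite /B /= in_itv.
have bB := bounded_measurable_indic R mB.
have bT := bounded_measurable_indic R (@measurableT _ E).
have bgW := bounded_measurableM bg bW.
exists B; split => //.
  have -> : \int[nu]_y truncated (W y) = \int[nu]_y (\1_(setT : set E) y * truncated (W y)).
    by apply: eq_Rintegral => y _; rewrite indicT mul1r.
  rewrite truncated_integral// -!Rintegral_indicT// lerBlDr.
  rewrite -[X in _ <= X + _]mul1r -Rintegral_lin//; last exact: bounded_measurableM.
  apply: Rintegral_le => //.
    by apply: bounded_measurableD; [exact: bounded_measurableZ|exact: bounded_measurableM].
  move=> y; rewrite indicT !mul1r indicE.
  have [_|yB] := boolP (y \in B); first by rewrite lerDl mulr_ge0//; case/andP: (W01 y).
  rewrite add0r /g mulrC ler_pdivlMr ?floor_density_gt0// mul1r ge_max lexx /=.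
  have : ~~ (W y < (1 + c)^-1) by apply/negP => h; move: yB; rewrite mem_set.
  rewrite -leNgt => h; rewrite ler_pdivrMr//.
  have : 1 <= W y * (1 + c) by rewrite -ler_pdivrMr// mul1r.
  lra.
rewrite -WE// ler_pdivlMr// mulrC -Rintegral_indicT//.
have bBW := bounded_measurableM bB bW.
rewrite -[leLHS]addr0 -(Rintegral0T lam) -Rintegral_lin//; last exact: bounded_measurable_cst.
apply: Rintegral_le => //.
  by apply: bounded_measurableD; [exact: bounded_measurableZ|exact: bounded_measurable_cst].
move=> y; rewrite addr0 indicT indicE; have [yB|_] := boolP (y \in B); last first.
  by rewrite mul0r mulr0 ler01.
rewrite mul1r mulrC -ler_pdivlMr// mul1r; apply: ltW.
exact: set_mem yB.
Qed.

End truncation.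

(** * Joint measurability in the starting point *)

Section joint_density.
Context (d : measure_display) (E : measurableType d) (R : realType).
Variables (Q : R.-fker E ~> E) (nu : {finite_measure set E -> \bar R}).
Variables (A : nat -> set E) (mA : forall i, measurable (A i)).

Lemma measurable_fun_glue d' (T : measurableType d') (N : T -> nat) (f : nat -> T -> R) :
  (forall n, measurable [set t | N t = n]) ->
  (forall n, measurable_fun setT (f n)) ->
  measurable_fun setT (fun t => f (N t) t).
Proof.
move=> mN mf.
have -> : [set: T] = \bigcup_n [set t | N t = n].
  by apply/seteqP; split=> // t _; exists (N t).
apply/measurable_fun_bigcup => // n.
apply: (@eq_measurable_fun _ _ _ _ _ (f n)); last exact: measurable_funTS.
by move=> t /set_mem /= ->.
Qed.

Lemma finite_measure_of (m : {measure set E -> \bar R}) : (m setT < +oo)%E ->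
  exists m' : {finite_measure set E -> \bar R}, forall D, m' D = m D.
Proof.
move=> mT.
have mfin : fin_num_fun m.
  move=> U mU; rewrite ge0_fin_numE//; apply: le_lt_trans mT.
  by apply: le_measure; rewrite ?inE.
have sfin : sigma_finite setT m.
  by apply: fin_num_fun_sigma_finite => //; rewrite measure0.
pose H1 := isFinite.Build _ _ _ _ mfin.
pose H2 := isSFinite.Build _ _ _ _ (sfinite_measure_sigma_finite sfin).
pose H3 := isSigmaFinite.Build _ _ _ _ sfin.
by exists (HB.pack_for (FiniteMeasure.type E R) (Measure.sort m) H1 H2 H3).
Qed.

Lemma fker_finite_measure x : exists q : {finite_measure set E -> \bar R},
  forall D, q D = Q x D.
Proof.
apply: finite_measure_of; have [M QM] := measure_uub Q.
by apply: lt_trans (QM x) _; rewrite ltry.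
Qed.

Lemma fker_dominating x : exists l : {finite_measure set E -> \bar R},
  forall D, l D = (Q x D + nu D)%E.
Proof.
have [|l lE] := @finite_measure_of (measure_add (Q x) nu).
  apply: (@le_lt_trans _ _ (Q x setT + nu setT)%E).
    by rewrite le_eqVlt; apply/orP; left; apply/eqP; exact: measure_addE.
  rewrite lte_add_pinfty ?ltey_eq ?fin_num_measure//.
  by rewrite (kernel_finite_transition (s := Q) x).
by exists l => D; rewrite lE; exact: measure_addE.
Qed.

Let lam_ex : exists l : E -> {finite_measure set E -> \bar R},
  forall x D, l x D = (Q x D + nu D)%E.
Proof. by have /choice[l lE] := fker_dominating; exists l. Qed.

Definition dominating : E -> {finite_measure set E -> \bar R} := projT1 (cid lam_ex).

Let lam := dominating.

Lemma dominatingE x D : lam x D = (Q x D + nu D)%E.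
Proof. exact: (projT2 (cid lam_ex)). Qed.

Lemma nu_le_dominating x D : measurable D -> (nu D <= lam x D)%E.
Proof. by move=> mD; rewrite dominatingE leeDr. Qed.

Lemma measurable_dominating D : measurable D -> measurable_fun setT (fun x => fine (lam x D)).
Proof.
move=> mD; rewrite (_ : (fun x => _) = (fun x => fine (Q x D) + fine (nu D))).
  apply: measurable_funD; last exact: measurable_cst.
  apply: (measurableT_comp _ (measurable_kernel Q D mD)).
  exact: fine_measurable.
apply/funext => x; rewrite dominatingE fineD ?fin_num_measure//.
exact: (kernel_finite_transition (s := Q) x).
Qed.

Lemma measurable_ratio n (b : {ffun 'I_n -> bool}) :
  measurable_fun setT (fun x => ratio A (lam x) nu b).
Proof.
apply: measurable_funM; first exact: measurable_cst.
apply: measurable_inv_ge0; first by move=> x; rewrite fine_ge0.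
by apply: measurable_dominating; exact: measurable_cell.
Qed.

Lemma measurable_bigsum (I : Type) d' (T : measurableType d') (s : seq I) (h : I -> T -> R) :
  (forall i, measurable_fun setT (h i)) ->
  measurable_fun setT (fun t => \sum_(i <- s) h i t).
Proof.
move=> mh; elim: s => [|i s IHs].
  by under eq_fun do rewrite big_nil; exact: measurable_cst.
by under eq_fun do rewrite big_cons; exact: measurable_funD.
Qed.

Lemma measurable_energy n : measurable_fun setT (fun x => energy A (lam x) nu n).
Proof.
rewrite (_ : (fun x => _) = (fun x => \sum_(b : {ffun 'I_n -> bool}) ratio A (lam x) nu b * fine (nu (cell A b)))).
  apply: measurable_bigsum => b; apply: measurable_funM; last exact: measurable_cst.
  exact: measurable_ratio.
by apply/funext => x; rewrite /energy (level_integral mA nu (fun b => ratio A (lam x) nu b)).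
Qed.

Lemma measurable_approx n :
  measurable_fun setT (fun z : E * E => approx A (lam z.1) nu n z.2).
Proof.
rewrite (_ : (fun z => _) = (fun z : E * E => \sum_(b <- index_enum {ffun 'I_n -> bool})
    ratio A (lam z.1) nu b * \1_(cell A b) z.2)).
  apply: measurable_bigsum => b; apply: measurable_funM.
    exact: (measurableT_comp (measurable_ratio b) measurable_fst).
  apply: (measurableT_comp _ measurable_snd).
  by apply: measurable_indic; exact: measurable_cell.
by apply/funext => z; rewrite /approx level_funE.
Qed.

(* The increments after the stage have squared L^2 norm at most 8^-j, hence exceed
   2^-j only on a set of measure at most 2^-j: a subsequence converges almost
   surely, and it is chosen measurably in x. *)
Let late x j n := (j <= n)%N /\ forall k, (n <= k)%N ->
  energy A (lam x) nu k - energy A (lam x) nu n <= 8^-1 ^+ j.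

Let late_ex x j : exists n, `[< late x j n >].
Proof.
have e0 : (0 : R) < 8^-1 ^+ j by rewrite exprn_gt0.
have [n hn] := energy_cauchy mA (@nu_le_dominating x) j e0.
by exists n; apply/asboolP.
Qed.

Definition stage x j := ex_minn (late_ex x j).

Let stageP x j : late x j (stage x j).
Proof. by rewrite /stage; case: ex_minnP => n /asboolP. Qed.

Let stage_le x j n : late x j n -> (stage x j <= n)%N.
Proof. by move=> /asboolP h; rewrite /stage; case: ex_minnP => m _; apply. Qed.

Lemma stage_homo x j : (stage x j <= stage x j.+1)%N.
Proof.
have [h1 h2] := stageP x j.+1; apply: stage_le; split; first exact: ltnW.
move=> k hk; apply: le_trans (h2 k hk) _.
by rewrite exprS ler_piMl ?exprn_ge0// invf_le1// ler1n.
Qed.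

(** Taking the least admissible level is what makes the choice measurable: [late] is a countable
    intersection of conditions on the energies, and the stage is n when it holds at n and at no
    smaller level. *)
Lemma measurable_stage j n : measurable [set x | stage x j = n].
Proof.
have mlate k : measurable [set x | late x j k].
  have [jk|kj] := leqP j k; last first.
    rewrite (_ : [set x | _] = set0)//; apply/seteqP; split=> // x [jk _].
    by rewrite leqNgt kj in jk.
  rewrite (_ : [set x | _] = \bigcap_(i in [set i | (k <= i)%N])
    [set x | energy A (lam x) nu i - energy A (lam x) nu k <= 8^-1 ^+ j]).
    apply: bigcap_measurable => [|i _]; first by exists k => /=.
    have m := measurable_funB (measurable_energy i) (measurable_energy k).
    rewrite -[X in measurable X]setTI (_ : [set x | _] = (fun x => energy A (lam x) nu i - energy A (lam x) nu k) @^-1`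
      [set` `]-oo, (8^-1 ^+ j : R)]]); first exact: m.
    by apply/seteqP; split=> x; rewrite /= in_itv.
  by apply/seteqP; split=> [x [_ h] i ki|x h]; [exact: h|split].
rewrite (_ : [set x | _] = [set x | late x j n] `&`
  \bigcap_(i in [set i | (i < n)%N]) ~` [set x | late x j i]).
  (* At n = 0 the intersection is over an empty family, which the lemma on countable intersections
     does not cover. *)
  apply: measurableI => //; have [->|n0] := eqVneq n 0%N.
    by rewrite (_ : \bigcap_(i in _) _ = setT) //; apply/seteqP; split=> // x _ i.
  apply: bigcap_measurable => [|i _]; first by exists 0%N; rewrite /= lt0n.
  exact: measurableC.
apply/seteqP; split=> [x /= <-|x [h1 h2]].
  split; first exact: stageP.
  by move=> i /= ilt h; move: ilt; rewrite ltnNge (stage_le h).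
apply/eqP; rewrite eqn_leq (stage_le h1)/= leqNgt; apply/negP => h.
exact: (h2 _ h (stageP x j)).
Qed.

Lemma measurable_approx_stage j :
  measurable_fun setT (fun z : E * E => approx A (lam z.1) nu (stage z.1 j) z.2).
Proof.
apply: (measurable_fun_glue (N := fun z : E * E => stage z.1 j)
  (f := fun n z => approx A (lam z.1) nu n z.2)) => n; last exact: measurable_approx.
rewrite -[X in measurable X]setTI.
exact: (@measurable_fst _ _ E E measurableT _ (measurable_stage j n)).
Qed.

Definition joint_density (z : E * E) : R := density A (lam z.1) nu (stage z.1) z.2.

(** The sections of the limsup of the joint jump sets are the exceptional sets of each x, so the
    corrected approximations are jointly measurable; they converge at every point. *)
Lemma measurable_joint_density : measurable_fun setT joint_density.
Proof.
pose J j := [set z : E * E | jump A (lam z.1) nu (stage z.1) j z.2].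
have mJ j : measurable (J j).
  have m : measurable_fun setT (fun z : E * E => `|approx A (lam z.1) nu (stage z.1 j.+1) z.2 -
      approx A (lam z.1) nu (stage z.1 j) z.2|).
    apply: measurableT_comp => //; apply: measurable_funB.
      exact: (measurable_approx_stage j.+1).
    exact: (measurable_approx_stage j).
  rewrite -[J j]setTI (_ : J j = (fun z : E * E => `|approx A (lam z.1) nu (stage z.1 j.+1) z.2 -
      approx A (lam z.1) nu (stage z.1 j) z.2|) @^-1` [set` `](2^-1 ^+ j : R), +oo[]).
    exact: m.
  by apply/seteqP; split=> z; rewrite /J /jump /= in_itv /= andbT.
have mL : measurable (lim_sup_set J).
  by apply: bigcapT_measurable => n; apply: bigcup_measurable => j _; exact: mJ.
apply: (@measurable_fun_cvg _ _ _ setT (fun j (z : E * E) =>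
  good_approx A (lam z.1) nu (stage z.1) j z.2)) => [j|z _].
  apply: measurable_funM; last exact: (measurable_approx_stage j).
  rewrite (_ : (fun z => _) = (\1_(~` lim_sup_set J) : E * E -> R)).
    by apply: measurable_indic; exact: measurableC.
  apply/funext => z; rewrite !indicE !in_setC.
  have -> // : (z.2 \in lim_sup_set (jump A (lam z.1) nu (stage z.1))) = (z \in lim_sup_set J).
  apply/idP/idP => /set_mem h; apply/mem_set => n _.
    by have [i ni Ji] := h n I; exists i.
  by have [i ni Ji] := h n I; exists i.
exact: (good_approx_cvg mA (@nu_le_dominating z.1)).
Qed.

Hypothesis generated : @measurable _ E = <<s range A >>.

Lemma kernel_truncated_density (c : R) : 0 < c ->
  exists alpha : E * E -> R, [/\ measurable_fun setT alpha,
    forall z, 0 <= alpha z <= c,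
    forall x D, measurable D ->
      \int[nu]_y (\1_D y * alpha (x, y)) <= fine (Q x D) &
    forall x, exists B, [/\ measurable B,
      fine (Q x setT) - \int[nu]_y alpha (x, y) <= fine (Q x B) &
      fine (nu B) <= (fine (Q x setT) + fine (nu setT)) / (1 + c)]].
Proof.
move=> c0.
have jd01 z : 0 <= joint_density z <= 1 by exact: (density01 mA (@nu_le_dominating z.1)).
have bx x : bounded_measurable (fun y => joint_density (x, y)).
  have := density_bm mA (@nu_le_dominating x) (stage x).
  by rewrite [X in bounded_measurable X](_ : _ = (fun y => joint_density (x, y))).
have jdE x D : measurable D ->
    \int[lam x]_y (\1_D y * joint_density (x, y)) = fine (nu D).
  move=> mD; rewrite -(density_integral mA (@nu_le_dominating x)
    (fun j => (stageP x j).1) (stage_homo x) (fun j => (stageP x j).2) generated mD).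
  by apply: eq_Rintegral => y _.
exists (fun z => truncated c (joint_density z)); split.
- by apply: measurable_truncated => //; exact: measurable_joint_density.
- by move=> z; exact: truncated_bound.
- move=> x D mD; have [q qE] := fker_finite_measure x; rewrite -qE.
  have lE D' : measurable D' -> lam x D' = (q D' + nu D')%E.
    by move=> _; rewrite dominatingE qE.
  exact: (truncated_le lE (fun y => jd01 (x, y)) (bx x) c0 (jdE x)).
- move=> x; have [q qE] := fker_finite_measure x.
  have lE D' : measurable D' -> lam x D' = (q D' + nu D')%E.
    by move=> _; rewrite dominatingE qE.
  have [B [mB h1 h2]] := truncated_defect lE (fun y => jd01 (x, y)) (bx x) c0 (jdE x).
  exists B; split => //; first by rewrite -!qE.
  move: h2; rewrite dominatingE fineD// ?fin_num_measure//.
  exact: (kernel_finite_transition (s := Q) x).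
Qed.

End joint_density.

(** * The absolutely continuous part *)

Section generating_sequence.
Context (d : measure_display) (E : measurableType d).

(** The generators are listed through an injection f into nat; indices outside its image receive the
    default [set0], which is measurable. *)
Lemma generating_sequence : countably_generated E ->
  exists A : nat -> set E, (forall i, measurable (A i)) /\ @measurable _ E = <<s range A >>.
Proof.
move=> [G /countable_injP[f finj] GE].
pose A n := xget set0 [set D | G D /\ f D = n].
have mG D : G D -> measurable D by move=> GD; rewrite GE; exact: sub_sigma_algebra.
have mA n : measurable (A n).
  by rewrite /A; case: xgetP => [D -> [/mG]|].
have AG D : G D -> A (f D) = D.
  move=> GD; rewrite /A; case: xgetP => [B BE [GB fB]|/(_ D)/not_andP[]//].
  by apply: finj; rewrite ?inE.
exists A; split => //; apply/seteqP; split.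
  rewrite GE; apply: smallest_sub; first exact: smallest_sigma_algebra.
  by move=> D GD; apply: sub_sigma_algebra; exists (f D) => //; exact: AG.
apply: smallest_sub; first exact: sigma_algebra_measurable.
by move=> _ [n _ <-].
Qed.

End generating_sequence.

Section majorized_kernel.
Context (d : measure_display) (E : measurableType d) (R : realType).
Variables (P : R.-fker E ~> E).

Lemma Delta_le (nu : probability E R) (a e t : R) : 0 <= a -> e < t ->
  (forall x A, measurable A -> fine (P x A) <= a * fine (nu A) + e) ->
  (Delta nu P <= t%:E)%E.
Proof.
move=> a0 et PA; rewrite /Delta; apply: lime_le.
  apply: nondecreasing_at_right_is_cvge; apply: nearW => b eta eta' _ _ ee.
  apply: ereal_sup_le => _ [x _] [A [mA nuA]] <-; exists x => //; exists A => //.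
  by split=> //; rewrite (le_trans nuA)// lee_fin.
(* For nu A below this threshold, a nu(A) + e <= t; the + 1 covers a = 0. *)
have b0 : 0 < (t - e) / (a + 1) by rewrite divr_gt0 ?subr_gt0// ltr_wpDl.
near=> eta; apply: ge_ereal_sup => _ [x _] [A [mA nuA]] <-.
rewrite -[P x A]fineK ?(kernel_finite_transition (s := P) x)// lee_fin.
rewrite (le_trans (PA x A mA))// -lerBrDr.
have h : fine (nu A) <= (t - e) / (a + 1).
  rewrite -lee_fin fineK ?fin_num_measure// (le_trans nuA)// lee_fin.
  by near: eta; exact: nbhs_right_le.
apply: (@le_trans _ _ ((a + 1) * ((t - e) / (a + 1)))).
  by rewrite ler_pM ?fine_ge0// lerDl.
by rewrite mulrC divfK// gt_eqF// ltr_wpDl.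
Unshelve. all: by end_near. Qed.

End majorized_kernel.

Section defect.
Context (d : measure_display) (E : measurableType d) (R : realType).
Variables (P : R.-fker E ~> E) (nu : probability E R).
Variables (alpha : E * E -> R) (c : R).
Hypotheses (malpha : measurable_fun setT alpha) (alpha_bound : forall z, 0 <= alpha z <= c).

Lemma bounded_measurable_section x : bounded_measurable (fun y => alpha (x, y)).
Proof.
split; first exact: (measurableT_comp malpha (pair1_measurable x)).
by exists c => y; have /andP[h1 h2] := alpha_bound (x, y); rewrite ger0_norm.
Qed.

Lemma bounded_unif_integrable : unif_integrable_density nu alpha.
Proof.
split => //; first by move=> z; case/andP: (alpha_bound z).
apply: cvg_near_cst; near=> m.
have cm : c < m by near: m; apply: nbhs_pinfty_gt; exact: num_real.
have e0 x : [set y | (m <= alpha (x, y))%R] = set0.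
  apply/seteqP; split=> // y /= h; have /andP[_ h'] := alpha_bound (x, y).
  by have := le_lt_trans (le_trans h h') cm; rewrite ltxx.
rewrite (_ : [set _ | _ in _] = [set 0%E]) ?ereal_sup1//.
apply/seteqP; split=> [_ [x _ <-]|_ ->]; first by rewrite e0 integral_set0.
by exists point => //; rewrite e0 integral_set0.
Unshelve. all: by end_near. Qed.

Lemma fine_density_kernel x D : measurable D ->
  fine (density_kernel nu alpha x D) = \int[nu]_y (\1_D y * alpha (x, y)).
Proof.
move=> mD; rewrite -[LHS]/(Rintegral nu D (fun y => alpha (x, y))) Rintegral_mkcond patch_indic.
by apply: eq_Rintegral => y _; rewrite /= mulrC.
Qed.

Lemma measurable_fine_density_kernel D : measurable D ->
  measurable_fun setT (fun x => \int[nu]_y (\1_D y * alpha (x, y))).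
Proof.
move=> mD; pose f (z : E * E) := (\1_D z.2 * alpha z)%:E.
have mf : measurable_fun setT f.
  apply/measurable_EFinP; apply: measurable_funM => //.
  apply: (measurableT_comp _ measurable_snd); exact: measurable_indic.
have f0 z : (0 <= f z)%E.
  by rewrite lee_fin mulr_ge0//; case/andP: (alpha_bound z).
apply: (measurableT_comp _ (measurable_fun_fubini_tonelli_F (m2 := nu) f mf f0)).
exact: fine_measurable.
Qed.

Lemma defect_kernel : exists S : bounded_kernel E R, forall x D, measurable D ->
  S x D = (fine (P x D) - \int[nu]_y (\1_D y * alpha (x, y)))%:C%C.
Proof.
have [M PM] := measure_uub P.
have PT x D : measurable D -> 0 <= fine (P x D) <= M.
  move=> mD; rewrite fine_ge0//= -lee_fin fineK ?(kernel_finite_transition (s := P) x)//.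
  by apply: le_trans (ltW (PM x)); rewrite le_measure// inE.
have iT x D : measurable D -> 0 <= \int[nu]_y (\1_D y * alpha (x, y)) <= c.
  move=> mD; have bD := bounded_measurable_indic R mD.
  have b := bounded_measurableM bD (bounded_measurable_section x).
  have a01 y := alpha_bound (x, y).
  rewrite Rintegral_ge0T//=; last first.
    by move=> y; rewrite mulr_ge0//; case/andP: (a01 y).
  apply: (@le_trans _ _ (\int[nu]_y c)).
    apply: Rintegral_le => //; first exact: bounded_measurable_cst.
    move=> y; have /andP[h1 h2] := a01 y; rewrite indicE.
    by case: (_ \in _); rewrite ?mul1r ?mul0r// (le_trans h1).
  rewrite Rintegral_cst// ler_piMr//; first by have /andP[h1 h2] := a01 point; exact: le_trans h2.
  by rewrite -lee_fin fineK ?fin_num_measure// probability_le1.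
apply: kernel_of_setfun => [D mD|D mD||x|x|x].
- apply: measurable_funB; last exact: measurable_fine_density_kernel.
  by apply: (measurableT_comp _ (measurable_kernel P D mD)); exact: fine_measurable.
- exact: measurable_cst.
- exists (M + c) => x D mD; rewrite normc_real (le_trans (ler_normB _ _))//.
  have /andP[h1 h2] := PT x D mD; have /andP[h3 h4] := iT x D mD.
  by rewrite !ger0_norm// lerD.
- rewrite measure0 (_ : \int[nu]_y _ = 0) ?subrr//.
  by rewrite -[RHS](Rintegral0T nu); apply: eq_Rintegral => y _; rewrite indic0 mul0r.
- move=> F mF tF; have [q qE] := fker_finite_measure P x.
  have c1 := finite_measure_countably_additive (m := q) mF tF.
  have c2 := Rintegral_countably_additive (m := nu) (bounded_measurable_section x) mF tF.
  rewrite /= (_ : (fun n => _) = (fun n => \sum_(i < n) fine (q (F i)) -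
    \sum_(i < n) \int[nu]_y (\1_(F i) y * alpha (x, y)))); last first.
    by apply/funext => n /=; rewrite -sumrB; apply: eq_bigr => i _; rewrite qE.
  by rewrite -qE; exact: cvgB c1 c2.
- move=> F mF tF /=; rewrite (_ : (fun n => _) = (fun=> 0)); first exact: cvg_cst.
  by apply/funext => n; rewrite big1.
Qed.

End defect.

Section operator_norm.
Context (d : measure_display) (E : measurableType d) (R : realType).
Local Notation V := (bmfun E R).

Lemma opnorm_le (T : {linear V -> V}) (b : R) : (forall f, nrm (T f) <= b * nrm f) ->
  0 <= b -> 0 <= opnorm T <= b.
Proof.
move=> Tb b0; rewrite /opnorm; set X := [set _ | _ in _].
have X0 : X 0 by exists 0; [rewrite /= normr0 ler01|rewrite linear0 normr0].
have Xb : ubound X b.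
  move=> _ [f /= f1 <-]; rewrite -/(nrm _) (le_trans (Tb f))// ler_piMr//.
  by move: f1; rewrite nrmE -[1]/((1 : R)%:C%C) lecR.
by apply/andP; split; [apply: ub_le_sup => //; exists b|apply: ge_sup => //; exists 0].
Qed.

(** The factor 4 is 2 for the Jordan parts in [charge_integral_bound] times 2 for the real and
    imaginary parts of f. *)
Lemma positive_kernel_opnorm (S : bounded_kernel E R) (b : R) :
  (forall x A, measurable A -> 0 <= complex.Re (S x A) <= b /\ complex.Im (S x A) = 0) ->
  0 <= opnorm (kernel_op S) <= 4 * b.
Proof.
move=> Sb.
have b0 : 0 <= b by have [/andP[h1 h2] _] := Sb point setT measurableT; exact: le_trans h2.
apply: opnorm_le => [f|]; last by rewrite mulr_ge0.
apply: nrm_le => x.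
have sf y : `|complex.Re (f y)| <= nrm f.
  by rewrite (le_trans (Re_le_normc _))// normc_le_nrm.
have sg y : `|complex.Im (f y)| <= nrm f.
  by rewrite (le_trans (Im_le_normc _))// normc_le_nrm.
have Sr A : measurable A -> `|fine (kernel_re S x A)| <= b.
  by move=> mA; have [/andP[h1 h2] _] := Sb x A mA; rewrite ger0_norm.
have Si A : measurable A -> `|fine (kernel_im S x A)| <= 0.
  by move=> mA; have [_ /= h] := Sb x A mA; rewrite h normr0.
have c1 := charge_integral_bound (bmfun_Re f) sf Sr.
have c2 := charge_integral_bound (bmfun_Im f) sg Si.
have c3 := charge_integral_bound (bmfun_Im f) sg Sr.
have c4 := charge_integral_bound (bmfun_Re f) sf Si.
have e1 := le_trans (ler_normB _ _) (lerD c1 c2).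
have e2 := le_trans (ler_normD _ _) (lerD c3 c4).
apply: le_trans (normc_le_ReIm _) _; apply: le_trans (lerD e1 e2) _.
by rewrite le_eqVlt; apply/orP; left; apply/eqP; ring.
Qed.

End operator_norm.

Lemma root_lt (R : realType) (b rho : R) (l : nat) : (0 < l)%N -> 0 < rho ->
  0 <= b -> b < rho ^+ l -> b `^ l%:R^-1 < rho.
Proof.
move=> l0 rho0 b0 bl.
have li : 0 < (l%:R : R)^-1 by rewrite invr_gt0 ltr0n.
have -> : rho = (rho ^+ l) `^ l%:R^-1.
  by rewrite -powR_mulrn ?ltW// -powRrM divff ?powRr1 ?ltW// pnatr_eq0 -lt0n.
by apply: gt0_ltr_powR => //; rewrite nnegrE// exprn_ge0// ltW.
Qed.

(** S is positive on the complement of D, so S(x, D) <= S(x, E) <= P(x, B) <= a nu(B) + t / 16 for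
    the exceptional set B of the truncation. Choosing c large brings this to t / 8, and the operator
    norm to 4 (t / 8). *)
Lemma dominated_part (R : realType) (d : measure_display) (E : measurableType d)
    (P : R.-fker E ~> E) (nu : probability E R) (a t : R) : 0 <= a -> 0 < t ->
  (forall x A, measurable A -> fine (P x A) <= a * fine (nu A) + t / 16) ->
  countably_generated E ->
  exists (alpha : E * E -> R) (S : bounded_kernel E R),
    [/\ unif_integrable_density nu alpha,
        forall x A, measurable A ->
          S x A = complex_kernel P x A - (fine (density_kernel nu alpha x A))%:C%C,
        forall x A, measurable A -> 0 <= S x A &
        0 <= opnorm (kernel_op S) <= t / 2].
Proof.
move=> a0 t0 PA /generating_sequence[A [mA AE]].
have [M PM] := measure_uub P.
have PT x : fine (P x setT) <= M.
  by rewrite -lee_fin fineK ?(kernel_finite_transition (s := P) x)// ltW.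
have M0 : 0 <= M by apply: le_trans (PT point); rewrite fine_ge0.
(* P(x, .) + nu has mass at most M + 1, so nu(B) <= (M + 1) / (1 + c) and a nu(B) <= t / 16; the
   last + 1 makes c positive. *)
pose c := 16 * a * (M + 1) / t + 1.
have c0 : 0 < c by rewrite ltr_wpDl// divr_ge0 ?(ltW t0)// !mulr_ge0// addr_ge0.
have [alpha [malpha ab aP aB]] := kernel_truncated_density P nu mA AE c0.
have [S SE] := defect_kernel P nu malpha ab.
have S0 x D : measurable D -> 0 <= fine (P x D) - \int[nu]_y (\1_D y * alpha (x, y)).
  by move=> mD; rewrite subr_ge0 aP.
have Sb x D : measurable D ->
    fine (P x D) - \int[nu]_y (\1_D y * alpha (x, y)) <= t / 8.
  move=> mD; have mC := measurableC mD.
  have bx := bounded_measurable_section malpha ab x.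
  have bi D' (mD' : measurable D') := bounded_measurableM (bounded_measurable_indic R mD') bx.
  have split_int : \int[nu]_y alpha (x, y) =
      \int[nu]_y (\1_D y * alpha (x, y)) + \int[nu]_y (\1_(~` D) y * alpha (x, y)).
    rewrite -[X in X + _]mul1r -Rintegral_lin; [|exact: bi|exact: bi].
    apply: eq_Rintegral => y _; rewrite !indicE in_setC.
    by case: (_ \in _) => /=; ring.
  have split_P : fine (P x setT) = fine (P x D) + fine (P x (~` D)).
    rewrite -fineD ?(kernel_finite_transition (s := P) x)//; congr fine.
    by rewrite -(setUv D) measureU//; exact: setICr.
  have [B [mB h1 h2]] := aB x.
  have h3 := PA x B mB; have h4 := S0 x _ mC.
  have c1 : 0 < 1 + c by rewrite addr_gt0.
  have h5 : a * fine (nu B) <= t / 16.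
    have h6 : fine (nu B) * (1 + c) <= M + 1.
      rewrite -ler_pdivlMr// (le_trans h2)// ler_wpM2r ?invr_ge0 ?(ltW c1)// lerD//.
      by rewrite -lee_fin fineK ?fin_num_measure// probability_le1.
    have h7 : 16 * a * (M + 1) / t <= 1 + c by rewrite /c addrCA lerDl.
    have h8 : 16 * a * (M + 1) <= (1 + c) * t by rewrite -ler_pdivrMr.
    rewrite -(ler_pM2r c1) -mulrA.
    apply: (@le_trans _ _ (a * (M + 1))); first by rewrite ler_wpM2l.
    lra.
  lra.
exists alpha, S; split.
- exact: bounded_unif_integrable ab.
- by move=> x D mD; rewrite SE// complex_kernelE fine_density_kernel// rmorphB.
- by move=> x D mD; rewrite SE// lecR S0.
- rewrite (_ : t / 2 = 4 * (t / 8)); last by field.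
  apply: positive_kernel_opnorm => x D mD; rewrite SE//=; split=> //.
  by rewrite S0//= Sb.
Qed.

Theorem mainTheorem3 (R : realType) (d : measure_display)
    (E : measurableType d) (Q : R.-fker E ~> E) (rho : R)
    (hqc : quasi_compact (kernel_op (complex_kernel Q)))
    (hre : ess_spectral_radius (kernel_op (complex_kernel Q)) < rho)
    (hr : rho < spectral_radius (kernel_op (complex_kernel Q))) :
  (exists L N : bounded_kernel E R,
    [/\ forall x A, measurable A -> complex_kernel Q x A = L x A + N x A,
        (forall f, kernel_op L (kernel_op N f) = 0) /\
        (forall f, kernel_op N (kernel_op L f) = 0),
        spectral_radius (kernel_op N) < rho,
        finite_dim (range (kernel_op L)) &
        forall lam : R[i], lam != 0 -> eigenvalue_on (kernel_op L) setT lam ->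
          rho <= normc lam]) /\
  (exists l_rho : nat, (0 < l_rho)%N /\ forall l : nat, (l_rho <= l)%N ->
    exists nu : probability E R,
      (Delta nu (kernel_pow Q l) <= (rho ^+ l)%:E)%E /\
      (countably_generated E ->
       exists (alpha : E * E -> R) (S : bounded_kernel E R),
         [/\ unif_integrable_density nu alpha,
             forall x A, measurable A ->
               S x A = complex_kernel (kernel_pow Q l) x A -
                       (fine (density_kernel nu alpha x A))%:C%C,
             forall x A, measurable A -> 0 <= S x A &
             opnorm (kernel_op S) `^ l%:R^-1 < rho])).
Proof.
split; first exact: kernel_splitting.
have [rho0 [/andP[r0 r1] _]] := ess_spectral_radius_splitting hre hr.
have rho_gt0 : 0 < rho := le_lt_trans r0 r1.
have [l0 [l0_gt0 H]] := fker_power_absolutely_continuous hre hr.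
exists l0; split => // l ll; have [nu [a [a0 PA]]] := H l ll.
have t0 : 0 < rho ^+ l by rewrite exprn_gt0.
exists nu; split.
  by apply: Delta_le a0 _ PA; rewrite ltr_pdivrMr// ltr_pMr// ltr1n.
move=> /(dominated_part a0 t0 PA)[alpha [S [h1 h2 h3 /andP[h4 h5]]]].
exists alpha, S; split => //; apply: root_lt => //; first exact: leq_trans ll.
by apply: le_lt_trans h5 _; rewrite ltr_pdivrMr// ltr_pMr// ltr1n.
Qed.
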